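(* Fix $d \in \mathbb{N}$, $\rho > 0$, $g \in \mathcal{G}$ with $r \mapsto r/g^{-1}(r)$ increasing for sufficiently small $r > 0$, and $\gamma \in (0,2]$. There exist $\lambda_* > 0$, $\epsilon_* > 0$ and $M_* > 0$, depending only on $d$, such that for $\lambda \geq \lambda_*$, $M_0 \geq M_*$, $\epsilon_0 \in (0,\min(\epsilon_*,1/(4M_0))]$ and $\ell \in \mathcal{L}$ with $\ell(\delta) \geq 2/\epsilon_0$ for all $\delta \in (0,\infty)$, writing $\theta = (\epsilon_{0}, M_0, \rho, \ell, g) \in \Theta$, we can find $c = c(d, \theta,\gamma,\lambda) >0$ such that for all $n \in \mathbb{N}$ and all $\nu \geq 0$ (for which the number $q$ below exists), we have \[ \inf_{C_n} \sup_{P \in \mathcal{P}_{d,\theta} \cap \mathcal{Q}_{d,\gamma,\lambda}} \{R(C_n) - R(C^{\mathrm{Bayes}})\} \geq c \, g^{-1}(1/q)^{\frac{2d(1+\nu)}{4+d+\nu(\rho + d)}}n^{-\frac{4 + \nu \rho}{4 + d + \nu(\rho +d)}}, \] where $q = q_n \in (1/\|g\|_\infty,\infty)$ is the unique solution to $\frac{q^{4+d+\nu(\rho + d)}}{g^{-1}(1/q)^{2}} = n$ and the infimum is taken over all measurable functions $C_n: (\mathbb{R}^d \times \{0,1\})^{\times n} \times \mathbb{R}^{d} \rightarrow \{0,1\}$. In particular, for every $\epsilon > 0$, there exists $c = c(d, \theta,\gamma,\lambda,\epsilon) >0$ such that \[ \inf_{C_n} \sup_{P \in \mathcal{P}_{d,\theta}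 \cap \mathcal{Q}_{d,\gamma,\lambda}} \{R(C_n) - R(C^{\mathrm{Bayes}})\} \geq c \, n^{-(\min\{\frac{4}{4 + d},\frac{\rho}{\rho + d}\}+\epsilon)} \] for all $n\in\mathbb{N}$.
   Context: Notation. $\|\cdot\|$ is the Euclidean norm, $\|\cdot\|_{\mathrm{op}}$ the operator norm of a matrix, $\|\cdot\|_\infty$ the supremum norm of a function, $B_r(x) := \{z\in\mathbb{R}^d : \|x-z\|<r\}$, and $a_d := \frac{2\pi^{d/2}}{d\,\Gamma(d/2)}$ is the Lebesgue measure of $B_1(0)$. For a real-valued function $h$, $\dot h$ and $\ddot h$ denote its gradient and Hessian. $g^{-1}$ denotes the inverse function of $g$. Classification setting. Let $P$ be a distribution on $\mathbb{R}^d\times\{0,1\}$ and let $(X,Y),(X_1,Y_1),\ldots,(X_n,Y_n)$ be i.i.d. with distribution $P$. Put $\pi_r := \mathbb{P}(Y=r)$, let $P_r$ be the conditional distribution of $X$ given $Y=r$ ($r=0,1$), $P_X := \pi_0P_0+\pi_1P_1$ the marginal distribution of $X$, and $\eta(x) := \mathbb{P}(Y=1|X=x)$ the regression function. For a data-dependent classifier $C_n$, its risk is $R(C_n) := \mathbb{P}\{C_n((X_1,Y_1),\ldots,(X_n,Y_n),X)\neq Y\}$, the probability being over the training data as well as the test pair $(X,Y)$. The Bayes classifier is $C^{\mathrm{Bayes}}(x) := 1$ if $\eta(x)\ge 1/2$ and $0$ otherwise, with risk $R(C^{\mathrm{Bayes}}) := \mathbb{P}\{C^{\mathrm{Bayes}}(X)\neq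 Y\}$. Classes of distributions. $\mathcal{L}$ is the class of decreasing functions $\ell:(0,\infty)\to[1,\infty)$ with $\ell(\delta)=o(\delta^{-\tau})$ as $\delta\searrow0$ for every $\tau>0$. $\mathcal{G}$ is the class of strictly increasing functions $g:(0,1)\to(0,1)$ with $g(\epsilon)=o(\epsilon^M)$ as $\epsilon\searrow0$ for every $M>0$. $\Theta := (0,\infty)\times[1,\infty)\times(0,\infty)\times\mathcal{L}\times\mathcal{G}$. For $\theta=(\epsilon_0,M_0,\rho,\ell,g)\in\Theta$, $\mathcal{P}_{d,\theta}$ is the class of distributions $P$ on $\mathbb{R}^d\times\{0,1\}$ such that $P_0,P_1$ are absolutely continuous with respect to Lebesgue measure with densities $f_0,f_1$, and versions of $f_0,f_1$ exist for which the following hold, where $\bar f := \pi_0f_0+\pi_1f_1$, $\eta(x) := \pi_1f_1(x)/\bar f(x)$ (with $0/0:=0$), $\mathcal{S}:=\{x\in\mathbb{R}^d:\eta(x)=1/2\}$, $\mathcal{S}^\epsilon := \mathcal{S}+B_\epsilon(0)$ and $p_r(x):=P_X(B_r(x))$: (A.1) $\bar f$ is continuous $P_X$-almost everywhere, and the set of continuity points of $\bar f$ is open. (A.2) $\mathcal{S}\cap\{x:\bar f(x)>0\}$ is non-empty and $\sup_{x_0\in\mathcal{S}}\bar f(x_0)\le M_0$. The function $\bar f$ is twice continuously differentiable on $\mathcal{S}^{\epsilon_0}$, and $\max\{\|\dot{\bar f}(x_0)\|, \sup_{u\in B_{\epsilon_0}(0)}\|\ddot{\bar f}(x_0+u)\|_{\mathrm{op}}\}\le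 \bar f(x_0)\,\ell(\bar f(x_0))$ for all $x_0\in\mathcal{S}$. Furthermore, $p_r(x)\ge\epsilon_0a_dr^d\bar f(x)$ for all $x\in\mathbb{R}^d\setminus\mathcal{S}^{\epsilon_0}$ and $r\in(0,\epsilon_0]$. (A.3) $\eta$ is twice differentiable on $\mathcal{S}^{2\epsilon_0}$ with $\inf_{x_0\in\mathcal{S}}\|\dot\eta(x_0)\|\ge\epsilon_0M_0$, $\sup_{x\in\mathcal{S}^{2\epsilon_0}}\|\dot\eta(x)\|\le M_0$, $\sup_{x\in\mathcal{S}^{2\epsilon_0}}\|\ddot\eta(x)\|_{\mathrm{op}}\le M_0$, and for every $\epsilon$ in the domain $(0,1)$ of $g$, $\sup_{x,z\in\mathcal{S}^{2\epsilon_0}:\|z-x\|\le g(\epsilon)}\|\ddot\eta(z)-\ddot\eta(x)\|_{\mathrm{op}}\le\epsilon$. Finally, $\eta$ is continuous on $\{x:\bar f(x)>0\}$, and $|\eta(x)-1/2|\ge 1/\ell(\bar f(x))$ for all $x\in\mathbb{R}^d\setminus\mathcal{S}^{\epsilon_0}$ (with $\bar f(x)>0$). (A.4) $\int_{\mathbb{R}^d}\|x\|^\rho\,dP_X(x)\le M_0$. For $\gamma\in(0,1]$ and $\lambda>0$, $\mathcal{Q}_{d,\gamma,\lambda}$ is the class of distributions $P$ on $\mathbb{R}^d\times\{0,1\}$ whose marginal $P_X$ has a Lebesgue density $\bar f$ with $\|\bar f\|_\infty\le\lambda$ and $|\bar f(y)-\bar f(x)|\le\lambda\|y-x\|^\gamma$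 for all $x,y\in\mathbb{R}^d$. For $\gamma\in(1,2]$, $\mathcal{Q}_{d,\gamma,\lambda}$ is the class of such $P$ with $\|\bar f\|_\infty\le\lambda$, $\bar f$ differentiable, and $\|\dot{\bar f}(y)-\dot{\bar f}(x)\|\le\lambda\|y-x\|^{\gamma-1}$ for all $x,y\in\mathbb{R}^d$. *)

(* Defs.v *)
From HB Require Import structures.
From mathcomp Require Import all_boot all_order all_algebra.
From mathcomp Require Import all_classical all_reals all_analysis.

Set Implicit Arguments.
Unset Strict Implicit.
Unset Printing Implicit Defensive.

Import Order.TTheory GRing.Theory Num.Theory.
Import numFieldNormedType.Exports.

Local Open Scope classical_set_scope.
Local Open Scope ring_scope.

(* R^d is 'rV[R]_d.  Its library norm is the supremum norm, which induces the
   usual topology and hence the usual notions of continuity and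
   differentiability; the Euclidean norm is enorm below.  Its sigma-algebra is
   generated by the coordinate maps, as for tuples, i.e. it is the Borel
   sigma-algebra. *)
Definition rV_display : measure_display. Proof. exact. Qed.

Section measurable_rV.
Context (R : realType) (d : nat).

Definition rV_coord (i : 'I_d) (x : 'rV[R]_d) : R := x ord0 i.

Let rV_set0 : g_sigma_preimage rV_coord set0.
Proof. exact: sigma_algebra0. Qed.

Let rV_setC A : g_sigma_preimage rV_coord A -> g_sigma_preimage rV_coord (~` A).
Proof. by move=> mA; rewrite -setTD; exact: sigma_algebraCD. Qed.

Let rV_bigcup (F : (set 'rV[R]_d)^nat) :
  (forall i, g_sigma_preimage rV_coord (F i)) ->
  g_sigma_preimage rV_coord (\bigcup_i (F i)).
Proof. exact: sigma_algebra_bigcup. Qed.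

HB.instance Definition _ := @isMeasurable.Build rV_display 'rV[R]_d
  (g_sigma_preimage rV_coord) rV_set0 rV_setC rV_bigcup.

Lemma measurable_rV_coord (i : 'I_d) : measurable_fun [set: 'rV[R]_d] (rV_coord i).
Proof.
move=> _ Y mY; rewrite setTI; apply: sub_sigma_algebra => /=.
rewrite -bigcup_seq/=; exists i => /=; first by rewrite mem_index_enum.
by exists Y => //; rewrite setTI.
Qed.

Definition rV_of_tuple (t : d.-tuple (measurableTypeR R)) : 'rV[R]_d := \row_i tnth t i.
Definition tuple_of_rV (x : 'rV[R]_d) : d.-tuple (measurableTypeR R) :=
  [tuple x ord0 i | i < d].

Lemma rV_of_tupleK : cancel rV_of_tuple tuple_of_rV.
Proof. by move=> t; apply: eq_from_tnth => i; rewrite tnth_mktuple mxE. Qed.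

Lemma measurable_rV_of_tuple : measurable_fun [set: d.-tuple (measurableTypeR R)] rV_of_tuple.
Proof.
move=> _ A mA; rewrite setTI.
suff : g_sigma_preimage rV_coord `<=`
    image_set_system setT rV_of_tuple (@measurable _ (d.-tuple (measurableTypeR R))).
  by move=> /(_ _ mA); rewrite /image_set_system /= setTI.
apply: smallest_sub; first exact/sigma_algebra_image/sigma_algebra_measurable.
rewrite -bigcup_seq/= => B [i _] [C mC <-]; rewrite /image_set_system /= !setTI.
rewrite (_ : _ @^-1` _ = (@tnth _ (measurableTypeR R) ^~ i) @^-1` C).
  by rewrite -[X in measurable X]setTI; exact: measurable_tnth.
by apply/funext => t /=; rewrite /rV_coord mxE.
Qed.

Lemma measurable_tuple_of_rV : measurable_fun [set: 'rV[R]_d] tuple_of_rV.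
Proof.
apply/measurable_fun_tnthP => i.
rewrite (_ : _ \o _ = rV_coord i); first exact: measurable_rV_coord.
by apply/funext => x /=; rewrite tnth_mktuple.
Qed.

End measurable_rV.

Section image_measure.
Context d1 d2 (T1 : measurableType d1) (T2 : measurableType d2) (R : realType).
Variables (f : T1 -> T2) (h : T2 -> T1).
Hypotheses (mf : measurable_fun setT f) (mh : measurable_fun setT h).
Hypothesis fK : cancel f h.
Variable mu : {measure set T1 -> \bar R}.
Hypothesis sigma_finite_mu : sigma_finite setT mu.

Let image := pushforward mu f.

Let image0 : image set0 = 0%E. Proof. exact: measure0. Qed.

Let image_ge0 A : (0 <= image A)%E. Proof. exact: measure_ge0. Qed.

Let image_sigma_additive : semi_sigma_additive image.
Proof. exact: measure_semi_sigma_additive. Qed.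

HB.instance Definition _ := isMeasure.Build _ _ _ image
  image0 image_ge0 image_sigma_additive.

Let image_sigma_finite : sigma_finite setT image.
Proof.
have [F FT mF] := sigma_finite_mu.
exists (fun k => h @^-1` F k).
  by rewrite -preimage_bigcup -FT preimage_setT.
move=> k; have [mFk Fkoo] := mF k; split.
  by rewrite -[X in measurable X]setTI; exact: mh.
rewrite /image /pushforward (_ : _ @^-1` _ = F k)//.
by apply/funext => x /=; rewrite fK.
Qed.

HB.instance Definition _ := Measure_isSigmaFinite.Build _ _ _ image
  image_sigma_finite.

Definition image_measure : {sigma_finite_measure set T2 -> \bar R} := image.

End image_measure.

Lemma product_sigma_finite d1 d2 (T1 : measurableType d1)
    (T2 : measurableType d2) (R : realType)
    (m1 : {sigma_finite_measure set T1 -> \bar R})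
    (m2 : {sigma_finite_measure set T2 -> \bar R}) :
  sigma_finite setT (m1 \x m2)%E.
Proof.
have /sigma_finiteP[F [TF ndF Foo]] := sigma_finiteT m1.
have /sigma_finiteP[G [TG ndG Goo]] := sigma_finiteT m2.
exists (fun n => F n `*` G n).
  rewrite -setXTT TF TG predeqE => -[x y]; split.
    move=> [/= [n _ Fnx] [k _ Gky]]; exists (maxn n k) => //; split.
    - by move: x Fnx; exact/subsetPset/ndF/leq_maxl.
    - by move: y Gky; exact/subsetPset/ndG/leq_maxr.
  by move=> [n _ []/= ? ?]; split; exists n.
move=> k; have [? ?] := Foo k; have [? ?] := Goo k.
split; first exact: measurableX.
by rewrite product_measure1E// lte_mul_pinfty// ge0_fin_numE.
Qed.

Section power_measure.
Context d (T : measurableType d) (R : realType).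

Definition tuple_cons n (z : T * n.-tuple T) : n.+1.-tuple T :=
  [tuple of z.1 :: z.2].
Definition tuple_uncons n (t : n.+1.-tuple T) : T * n.-tuple T :=
  (tnth t ord0, [tuple of behead t]).

Lemma tuple_consK n : cancel (@tuple_cons n) (@tuple_uncons n).
Proof.
move=> [x t]; rewrite /tuple_uncons /tuple_cons /=; congr pair.
by apply/val_inj.
Qed.

Lemma measurable_tuple_cons n : measurable_fun setT (@tuple_cons n).
Proof. exact: measurable_cons. Qed.

Lemma measurable_tuple_uncons n : measurable_fun setT (@tuple_uncons n).
Proof.
by apply: measurable_fun_pair; [exact: measurable_tnth | exact: measurable_behead].
Qed.

Definition cons_measure n (m1 : {sigma_finite_measure set T -> \bar R})
    (m2 : {sigma_finite_measure set (n.-tuple T) -> \bar R}) :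
    {sigma_finite_measure set (n.+1.-tuple T) -> \bar R} :=
  image_measure (@measurable_tuple_cons n) (@measurable_tuple_uncons n)
    (@tuple_consK n) (product_sigma_finite m1 m2).

(* mu^n *)
Fixpoint power_measure (mu : {sigma_finite_measure set T -> \bar R}) n :
    {sigma_finite_measure set (n.-tuple T) -> \bar R} :=
  match n with
  | 0 => @dirac _ (0.-tuple T) [tuple] R
  | n'.+1 => cons_measure mu (power_measure mu n')
  end.

End power_measure.

HB.instance Definition _ d1 d2 (T1 : measurableType d1) (T2 : measurableType d2) :=
  isMeasurableFun.Build _ _ (T1 * T2)%type T1 fst measurable_fst.

Section euclidean_space.
Context (R : realType) (d : nat).
Implicit Types (x : 'rV[R]_d) (h : 'rV[R]_d -> R) (A : set 'rV[R]_d).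

Definition lebesgue_rV : {sigma_finite_measure set 'rV[R]_d -> \bar R} :=
  image_measure (@measurable_rV_of_tuple R d) (@measurable_tuple_of_rV R d)
    (@rV_of_tupleK R d)
    (sigma_finiteT (power_measure (@lebesgue_measure R) d)).

Definition enorm x : R := Num.sqrt (\sum_i x ord0 i ^+ 2).

Definition eball x (r : R) : set 'rV[R]_d := [set z | enorm (x - z) < r].

Definition enlarge A (r : R) : set 'rV[R]_d :=
  [set x + u | x in A & u in eball 0 r].

(* vectors are rows, so B acts by v |-> v *m B *)
Definition opnorm (B : 'M[R]_d) : R :=
  sup [set enorm (v *m B) | v in [set v | enorm v <= 1]].

Definition grad h x : 'rV[R]_d := \row_i 'D_(delta_mx ord0 i) h x.

Definition hess h x : 'M[R]_d := 'J (grad h) x.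

(* for open A; differentiable is Frechet differentiability *)
Definition twice_differentiable_on A h : Prop :=
  forall x, A x -> differentiable h x /\ differentiable (grad h) x.

Definition C2_on A h : Prop :=
  twice_differentiable_on A h /\ forall x, A x -> {for x, continuous (hess h)}.

Definition Gamma (s : R) : R :=
  \int[@lebesgue_measure R]_(t in `]0, +oo[) (t `^ (s - 1) * expR (- t)).

(* pi^(d/2) / Gamma(d/2 + 1) *)
Definition unit_ball_volume : R :=
  2 * pi `^ (d%:R / 2) / (d%:R * Gamma (d%:R / 2)).

Definition is_density (m : set 'rV[R]_d -> \bar R) h : Prop :=
  [/\ measurable_fun setT h, (forall x, 0 <= h x)
    & forall A, measurable A -> (m A = \int[lebesgue_rV]_(x in A) (h x)%:E)%E].

End euclidean_space.

Definition sup_norm (R : realType) T (A : set T) (h : T -> R) : \bar R :=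
  ereal_sup [set `|h x|%:E | x in A].

Section classification.
Context (R : realType) (d : nat).

(* labels: true is 1, false is 0 *)
Definition observation := ('rV[R]_d * bool)%type.

Implicit Type P : probability observation R.

Definition prior P (r : bool) : R := fine (P [set z | z.2 = r]).

(* the conditional distribution of X given Y = r *)
Definition class_distribution P (r : bool) (A : set 'rV[R]_d) : \bar R :=
  (fine (P (A `*` [set r])) / prior P r)%:E.

Definition marginal P := distribution P fst.

Definition is_regression P (eta : 'rV[R]_d -> R) : Prop :=
  [/\ measurable_fun setT eta, (forall x, 0 <= eta x <= 1)
    & forall A, measurable A ->
        (P (A `*` [set true]) = \int[marginal P]_(x in A) (eta x)%:E)%E].

(* a version of x |-> P(Y = 1 | X = x); the Bayes risk does not depend on the
   choice of the version *)
Definition regression P : 'rV[R]_d -> R := get (is_regression P).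

Definition bayes_classifier P (x : 'rV[R]_d) : bool := 1 / 2 <= regression P x.

Definition bayes_risk P : \bar R := P [set z | bayes_classifier P z.1 != z.2].

(* the training sample has distribution P^n and the test pair is independent
   of it with distribution P *)
Definition risk n (C : n.-tuple observation * 'rV[R]_d -> bool) P : \bar R :=
  (power_measure P n \x P)%E [set w | C (w.1, w.2.1) != w.2.2].

Definition minimax_excess_risk n (cls : set (probability observation R)) : \bar R :=
  ereal_inf [set ereal_sup [set risk C P - bayes_risk P | P in cls]%E
            | C in [set C : n.-tuple observation * 'rV[R]_d -> bool |
                    measurable_fun setT C]].

End classification.

Local Notation right0 := (0^'+).

(* Functions on (0, oo) or (0, 1) are functions on R of which only the values on
   that interval matter. *)
Definition class_L (R : realType) (l : R -> R) : Prop :=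
  [/\ (forall x, 0 < x -> 1 <= l x),
      (forall x y, 0 < x -> x <= y -> l y <= l x)
    & forall tau, 0 < tau -> l =o_ right0 (fun x => x `^ (- tau))].

Definition class_G (R : realType) (g : R -> R) : Prop :=
  [/\ (forall x, 0 < x < 1 -> 0 < g x < 1),
      (forall x y, 0 < x -> x < y -> y < 1 -> g x < g y)
    & forall M, 0 < M -> g =o_ right0 (fun x => x `^ M)].

(* the inverse of g : (0, 1) -> (0, 1); meaningful only on the range of g *)
Definition inverse01 (R : realType) (g : R -> R) : R -> R :=
  'pinv_(fun=> 0) (`]0, 1[ : set R) g.

Record param (R : realType) := Param {
  eps0 : R ; M0 : R ; rho : R ; ell : R -> R ; gfun : R -> R }.

Definition Theta (R : realType) : set (param R) :=
  [set t | [/\ 0 < eps0 t, 1 <= M0 t, 0 < rho t, class_L (ell t)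
             & class_G (gfun t)]].

Section distribution_classes.
Context (R : realType) (d : nat).
Implicit Type P : probability (observation R d) R.

Section assumptions.
Variables (P : probability (observation R d) R) (t : param R).
Variable f : bool -> 'rV[R]_d -> R.

Definition fbar x := prior P false * f false x + prior P true * f true x.

(* 0 / 0 = 0 in the library *)
Definition eta x := prior P true * f true x / fbar x.

Definition decision_boundary : set 'rV[R]_d := [set x | eta x = 1 / 2].

Local Notation S := decision_boundary.

Definition assumption_A1 : Prop :=
  (\forall x \ae marginal P, {for x, continuous fbar}) /\
  open [set x | {for x, continuous fbar}].

Definition assumption_A2 : Prop :=
  [/\ S `&` [set x | 0 < fbar x] !=set0 /\ (forall x0, S x0 -> fbar x0 <= M0 t),
      C2_on (enlarge S (eps0 t)) fbar,
      (forall x0, S x0 ->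
         enorm (grad fbar x0) <= fbar x0 * ell t (fbar x0) /\
         (forall u, eball 0 (eps0 t) u ->
            opnorm (hess fbar (x0 + u)) <= fbar x0 * ell t (fbar x0)))
    & forall x r, ~ enlarge S (eps0 t) x -> 0 < r <= eps0 t ->
        ((eps0 t * unit_ball_volume R d * r ^+ d * fbar x)%:E
           <= marginal P (eball x r))%E].

Definition assumption_A3 : Prop :=
  [/\ twice_differentiable_on (enlarge S (2 * eps0 t)) eta,
      (forall x0, S x0 -> eps0 t * M0 t <= enorm (grad eta x0)),
      (forall x, enlarge S (2 * eps0 t) x ->
         enorm (grad eta x) <= M0 t /\ opnorm (hess eta x) <= M0 t),
      (forall e, 0 < e < 1 -> forall x z,
         enlarge S (2 * eps0 t) x -> enlarge S (2 * eps0 t) z ->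
         enorm (z - x) <= gfun t e -> opnorm (hess eta z - hess eta x) <= e)
    & {within [set x | 0 < fbar x], continuous eta} /\
      (forall x, ~ enlarge S (eps0 t) x -> 0 < fbar x ->
         1 / ell t (fbar x) <= `|eta x - 1 / 2|)].

Definition assumption_A4 : Prop :=
  (\int[marginal P]_x (enorm x `^ rho t)%:E <= (M0 t)%:E)%E.

End assumptions.

Definition class_P (t : param R) : set (probability (observation R d) R) :=
  [set P | exists f : bool -> 'rV[R]_d -> R,
     (forall r, is_density (class_distribution P r) (f r)) /\
     [/\ assumption_A1 P f, assumption_A2 P t f, assumption_A3 P t f
       & assumption_A4 P t]].

Definition class_Q (gamma lambda : R) : set (probability (observation R d) R) :=
  [set P | exists h : 'rV[R]_d -> R,
     [/\ is_density (marginal P) h,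
         (sup_norm setT h <= lambda%:E)%E
       & if gamma <= 1
         then forall x y, `|h y - h x| <= lambda * enorm (y - x) `^ gamma
         else (forall x, differentiable h x) /\
              forall x y, enorm (grad h y - grad h x)
                            <= lambda * enorm (y - x) `^ (gamma - 1)]].

End distribution_classes.

Definition is_rate_solution (R : realType) (d n : nat) (rho nu : R) (g : R -> R)
    (q : R) : Prop :=
  [/\ 1 / fine (sup_norm `]0, 1[ g) < q,
      (g @` `]0, 1[) (1 / q)
    & q `^ (4 + d%:R + nu * (rho + d%:R)) / inverse01 g (1 / q) ^+ 2 = n%:R].

(* Main.v *)
From HB Require Import structures.
Require Import Defs.
From mathcomp Require Import all_boot all_order all_algebra.
From mathcomp Require Import all_classical all_reals all_analysis.
From mathcomp Require Import measurable_realfun.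
From mathcomp Require Import ring lra.

Set Implicit Arguments.
Unset Strict Implicit.
Unset Printing Implicit Defensive.

Import Order.TTheory GRing.Theory Num.Theory.
Import numFieldNormedType.Exports.

Local Open Scope classical_set_scope.
Local Open Scope ring_scope.

(** Why the bound holds.  The lower bound is an instance of Assouad's method: the
class of distributions contains a cube of distributions P_s, indexed by vectors
s of bits, one bit for each of many disjoint balls.  All P_s have the same
marginal distribution, and two of them differ only in the regression function
on the balls where their bits differ.  If this difference is so small that n
observations do not reveal the bit of a given ball, then for some s a classifier
has the wrong sign in a fixed proportion of the balls ([testing_bound],
[assouad]), and pays for each of them the mass of a slab times the distance of
the regression function from 1/2 there.

The cube depends on three scales e, r and W.  The regression function is 1/2 +
zigzag (x_0) plus a perturbation, where zigzag t = dist (t, Z) - 1/4, so that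
the unperturbed decision boundary is a family of parallel hyperplanes.  The
balls have radius r and centres on these hyperplanes, and on the ball with
centre z the perturbation is A b ((x - z) / r) up to sign, for a fixed bump b
and A proportional to e r^2.  Its Hessian is bounded by e and has a Lipschitz
constant of order e / r; hence it varies by at most e' over a distance g e' as
soon as g e' / e' <= r / e, which for r = g e is where the monotonicity of
r / g^-1 (r) enters.  The marginal density is a bump near the origin, far from
the decision boundary, plus a polynomial tail of height w and width L = 1 / W
with w proportional to W^(rho + d), which is the largest height that the bound
on the moment of order rho permits.  Its derivatives are small compared to the
density itself since L is large.  That the P_s belong to the two classes is
[perturbed_in_class_P] and [design_class_Q].

A ball has mass of order w r^d, so its bit is hidden as long as n A^2 w r^d is
small, that is, n <= e^-2 r^-(4 + d) W^-(rho + d).  There are of order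
L^d r^(1 - d) balls, and a wrong sign costs A on a slab of thickness A, whose
mass is of order w A r^(d - 1).  The resulting excess risk has order
L^d w A^2, which is e^2 r^4 W^rho ([design_excess]).

The rates are obtained by choosing the scales.  With r = g e = 1 / q and
W = r^nu, the equation for q says exactly that n = e^-2 r^-(4 + d) W^-(rho + d)
([rate_bound]).  With W fixed, r of order n^(-1 / (4 + d)) and e of order
n^(-eps / 2), which is possible since g vanishes faster than every power, the
rate is n^(-4 / (4 + d) - eps) ([smooth_rate]); with e and r fixed and W of
order n^(-1 / (rho + d)) it is n^(-rho / (rho + d)) ([tail_rate]). *)

(** * Measures with a density *)

Section density.
Context d (T : measurableType d) (R : realType).
Variables (mu : {measure set T -> \bar R}) (w : T -> R).
Hypotheses (mw : measurable_fun setT w) (w0 : forall x, 0 <= w x).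

Definition with_density (A : set T) : \bar R := (\int[mu]_(x in A) (w x)%:E)%E.

Let with_density0 : with_density set0 = 0%E.
Proof. exact: integral_set0. Qed.

Let with_density_ge0 A : (0 <= with_density A)%E.
Proof. by apply: integral_ge0 => x _; rewrite lee_fin. Qed.

Let with_density_sigma_additive : semi_sigma_additive with_density.
Proof.
move=> F mF tF mUF; rewrite /with_density ge0_integral_bigcup//; last 2 first.
- exact/measurable_EFinP/measurable_funTS.
- by move=> x _; rewrite lee_fin.
by apply: is_cvg_nneseries => n _ _; exact: with_density_ge0.
Qed.

HB.instance Definition _ := isMeasure.Build _ _ _ with_density
  with_density0 with_density_ge0 with_density_sigma_additive.

Definition density_measure : {measure set T -> \bar R} := with_density.

End density.

Section integral_density.
Context d (T : measurableType d) (R : realType).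
Variables (mu nu : {measure set T -> \bar R}) (w : T -> R).
Hypotheses (mw : measurable_fun setT w) (w0 : forall x, 0 <= w x).
Hypothesis nuE : forall A, measurable A -> nu A = (\int[mu]_(x in A) (w x)%:E)%E.

Import HBNNSimple.

Lemma sintegral_density (h : {nnsfun T >-> R}) :
  (\int[nu]_x (h x)%:E = \int[mu]_x (h x * w x)%:E)%E.
Proof.
rewrite integralT_nnsfun sintegralE.
under [RHS]eq_integral.
  move=> x _; rewrite EFinM fimfunE -fsumEFin// ge0_mule_fsuml; last first.
    by move=> r; exact: nnfun_muleindic_ge0.
  over.
rewrite [RHS]ge0_integral_fsum//; last 2 first.
  - move=> r; rewrite -[X in measurable_fun _ X]/(fun x => (r * \1_(h @^-1` [set r]) x)%:E * (w x)%:E)%E.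
    by apply: emeasurable_funM; apply/measurable_EFinP => //; exact: measurable_funM.
  - by move=> r x _; rewrite mule_ge0// ?lee_fin//; exact: nnfun_muleindic_ge0.
apply: eq_fsbigr => r rh.
have [x _ hr] : range h r by move: rh; rewrite inE.
have r0 : 0 <= r by rewrite -hr.
have mh : measurable (h @^-1` [set r]) by [].
rewrite nuE//.
under [RHS]eq_integral do rewrite EFinM -muleA.
rewrite ge0_integralZl//; last 2 first.
  - by apply/measurable_EFinP; apply: measurable_funM.
  - by move=> y _; rewrite mule_ge0// lee_fin.
congr (_ * _)%E; rewrite [LHS]integral_mkcond; apply: eq_integral => y _.
by rewrite patchE indicE; case: ifPn; rewrite ?mul1e ?mul0e.
Qed.

Lemma ge0_integral_density (f : T -> \bar R) : measurable_fun setT f ->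
  (forall x, 0 <= f x)%E ->
  (\int[nu]_x f x = \int[mu]_x (f x * (w x)%:E))%E.
Proof.
move=> mf f0; pose g := nnsfun_approx measurableT mf.
have cg x : (g n x)%:E @[n --> \oo] --> f x by exact: cvg_nnsfun_approx.
transitivity (limn (fun n => \int[nu]_x (g n x)%:E))%E.
  rewrite -monotone_convergence//.
  - by apply: eq_integral => x _; apply/esym/cvg_lim.
  - by move=> n; exact/measurable_EFinP.
  - by move=> n x _; rewrite lee_fin.
  - by move=> x _ a b ab; rewrite lee_fin; exact/lefP/nd_nnsfun_approx.
transitivity (limn (fun n => \int[mu]_x (g n x * w x)%:E))%E.
  by congr (limn _); apply/funext => n; exact: sintegral_density.
rewrite -monotone_convergence//.
- apply: eq_integral => x _; apply/cvg_lim => //.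
  by under eq_fun do rewrite EFinM; exact: cvgeZr.
- by move=> n; apply/measurable_EFinP/measurable_funM.
- by move=> n x _; rewrite lee_fin mulr_ge0.
- move=> x _ a b ab; rewrite lee_fin ler_wpM2r//; exact/lefP/nd_nnsfun_approx.
Qed.

End integral_density.

(** * Labelling a random point *)

Section label_measure.
Context d (X : measurableType d) (R : realType).
Variables (mu : probability X R) (eta : X -> R).
Hypotheses (meta : measurable_fun setT eta) (eta01 : forall x, 0 <= eta x <= 1).

Let tag (b : bool) (x : X) : X * bool := (x, b).

Lemma measurable_tag b : measurable_fun setT (tag b).
Proof. by apply/measurable_fun_pair => //; exact: measurable_cst. Qed.

Definition label_density (b : bool) (x : X) : R := if b then eta x else 1 - eta x.

Lemma measurable_label_density b : measurable_fun setT (label_density b).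
Proof. by case: b => //; exact: measurable_funB. Qed.

Lemma label_density_ge0 b x : 0 <= label_density b x.
Proof. by case: b; rewrite /label_density; have := eta01 x; lra. Qed.

Let part b : set (X * bool) -> \bar R := pushforward
  (density_measure mu (measurable_label_density b) (label_density_ge0 b)) (tag b).

Let part_sigma_additive b : semi_sigma_additive (part b).
Proof. by have mb := measurable_tag b; exact: measure_semi_sigma_additive. Qed.

Let part0 b : part b set0 = 0%E. Proof. by rewrite /part /pushforward preimage_set0 measure0. Qed.

Let part_ge0 b A : (0 <= part b A)%E.
Proof. by rewrite /part /pushforward measure_ge0. Qed.

HB.instance Definition _ b := isMeasure.Build _ _ _ (part b)
  (part0 b) (part_ge0 b) (@part_sigma_additive b).

Let label : set (X * bool) -> \bar R := measure_add (part true) (part false).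

HB.instance Definition _ := Measure.on label.

Let part_integral b (f : X * bool -> \bar R) : measurable_fun setT f ->
  (forall z, 0 <= f z)%E ->
  (\int[part b]_z f z = \int[mu]_x (f (x, b) * (label_density b x)%:E))%E.
Proof.
move=> mf f0; rewrite ge0_integral_pushforward//; last exact: measurable_tag.
rewrite preimage_setT (@ge0_integral_density _ _ _ mu _ (label_density b))//.
- exact: measurable_label_density.
- exact: label_density_ge0.
- by apply: measurableT_comp => //; exact: measurable_tag.
- by move=> x; exact: f0.
Qed.

Let label_integral (f : X * bool -> \bar R) : measurable_fun setT f ->
  (forall z, 0 <= f z)%E ->
  (\int[label]_z f z =
   \int[mu]_x (f (x, true) * (eta x)%:E + f (x, false) * (1 - eta x)%:E))%E.
Proof.
move=> mf f0; rewrite ge0_integral_measure_add// !part_integral// ge0_integralD//.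
- by move=> x _; rewrite mule_ge0// lee_fin (label_density_ge0 true).
- apply: emeasurable_funM; last exact/measurable_EFinP.
  by apply: (@measurableT_comp _ _ _ _ _ _ _ _ (tag true)) => //; exact: measurable_tag.
- by move=> x _; rewrite mule_ge0// lee_fin (label_density_ge0 false).
- apply: emeasurable_funM; last exact/measurable_EFinP/(measurable_label_density false).
  by apply: (@measurableT_comp _ _ _ _ _ _ _ _ (tag false)) => //; exact: measurable_tag.
Qed.

Let label_setT : label setT = 1%E.
Proof.
rewrite -[LHS]mul1e -integral_cst// label_integral//.
under eq_integral do rewrite !mul1e -EFinD addrC subrK.
rewrite integral_cst// mul1e. exact: probability_setT.
Qed.

HB.instance Definition _ := Measure_isProbability.Build _ _ _ label label_setT.

(** The law of a pair (X, Y) for which X has law [mu] and Y is 1 with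
probability [eta x] given X = x: the sum over the two labels of the image of a
density measure. *)
Definition label_measure : probability (X * bool)%type R := label.

Lemma ge0_integral_label (f : X * bool -> \bar R) : measurable_fun setT f ->
  (forall z, 0 <= f z)%E ->
  (\int[label_measure]_z f z =
   \int[mu]_x (f (x, true) * (eta x)%:E + f (x, false) * (1 - eta x)%:E))%E.
Proof. exact: label_integral. Qed.

Lemma label_average_ge0 (f : X * bool -> \bar R) x : (forall z, 0 <= f z)%E ->
  (0 <= f (x, true) * (eta x)%:E + f (x, false) * (1 - eta x)%:E)%E.
Proof.
by move=> f0; rewrite adde_ge0// mule_ge0// lee_fin
  ?(label_density_ge0 true) ?(label_density_ge0 false).
Qed.

Lemma measurable_label_average (f : X * bool -> \bar R) : measurable_fun setT f ->
  measurable_fun setT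
    (fun x => f (x, true) * (eta x)%:E + f (x, false) * (1 - eta x)%:E)%E.
Proof.
move=> mf; have mft b : measurable_fun setT (fun x => f (x, b)).
  by apply: (@measurableT_comp _ _ _ _ _ _ _ _ (tag b)) => //; exact: measurable_tag.
apply: emeasurable_funD; apply: emeasurable_funM => //; apply/measurable_EFinP.
  exact: (measurable_label_density true).
exact: (measurable_label_density false).
Qed.

Lemma label_measureE (A : set (X * bool)) : measurable A ->
  (label_measure A = \int[mu]_x
    ((\1_A (x, true))%:E * (eta x)%:E + (\1_A (x, false))%:E * (1 - eta x)%:E))%E.
Proof.
move=> mA.
have <- : (\int[label_measure]_z (\1_A z)%:E = label_measure A)%E.
  by rewrite integral_indic// setIT.
apply: (@ge0_integral_label (fun z => (\1_A z)%:E)) => [|z]; rewrite ?lee_fin//.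
exact/measurable_EFinP.
Qed.

End label_measure.

(** * Testing with a product sample *)

Section power_measure_theory.
Context d (T : measurableType d) (R : realType) (P : probability T R).

(** Peeling off the first observation of a sample is what inductions on the
sample size rest on. *)
Definition tail_section n (z : T) (A : set (n.+1.-tuple T)) : set (n.-tuple T) :=
  xsection (@tuple_cons _ T n @^-1` A) z.

Lemma measurable_preimage_tuple_cons n (A : set (n.+1.-tuple T)) : measurable A ->
  measurable (@tuple_cons _ T n @^-1` A).
Proof. by move=> mA; rewrite -[X in measurable X]setTI; exact: measurable_tuple_cons. Qed.

Lemma measurable_tail_section n (z : T) (A : set (n.+1.-tuple T)) : measurable A ->
  measurable (tail_section z A).
Proof. by move=> mA; apply: measurable_xsection; exact: measurable_preimage_tuple_cons. Qed.

Lemma power_measureS n (A : set (n.+1.-tuple T)) :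
  (power_measure P n.+1 A = \int[P]_z power_measure P n (tail_section z A))%E.
Proof. by []. Qed.

Lemma measurable_power_tail n (A : set (n.+1.-tuple T)) : measurable A ->
  measurable_fun setT (fun z => power_measure P n (tail_section z A)).
Proof.
by move=> mA; apply: measurable_fun_xsection; exact: measurable_preimage_tuple_cons.
Qed.

Lemma tail_sectionC n z (A : set (n.+1.-tuple T)) :
  tail_section z (~` A) = ~` tail_section z A.
Proof. by apply/funext => t; rewrite /tail_section /xsection /= !in_setE. Qed.

Lemma power_measure_setT n : power_measure P n setT = 1%E.
Proof.
elim: n => [|n IHn]; first by rewrite /= diracT.
rewrite power_measureS.
have tailT z : tail_section z [set: n.+1.-tuple T] = setT.
  by apply/seteqP; split => // t _; rewrite /tail_section /xsection /= in_setE.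
under eq_integral do rewrite tailT IHn.
rewrite integral_cst// mul1e; exact: probability_setT.
Qed.

Lemma power_measure_le1 n A : measurable A -> (power_measure P n A <= 1)%E.
Proof.
by move=> mA; rewrite -(power_measure_setT n); apply: le_measure; rewrite ?inE.
Qed.

Lemma power_measure_fin n A : measurable A -> power_measure P n A \is a fin_num.
Proof.
move=> mA; apply/fin_numPlt; rewrite (lt_le_trans _ (measure_ge0 _ _)) ?ltNyr//=.
by rewrite (le_lt_trans (power_measure_le1 mA)) ?ltry.
Qed.

Lemma power_measure_setC n A : measurable A ->
  (power_measure P n (~` A) = 1 - power_measure P n A)%E.
Proof.
move=> mA; rewrite -(power_measure_setT n) -(setvU A) measureU ?addeK ?setICl//.
- exact: power_measure_fin.
- exact: measurableC.
Qed.

End power_measure_theory.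

(** If two hypotheses have weights s and t, then s t / (s + t) is at most min s
t, the error of the best test without data. A label that has probability p under
one hypothesis and q under the other splits the weights into s p, t q and s (1 -
p), t (1 - q), and this lemma says that little of that quantity is lost when p
and q are close. The reason is the identity p q (s + t)^2 = (s p + t q) (s q + t
p) - s t (p - q)^2. *)
Lemma label_overlap (R : realFieldType) (p q s t : R) :
  1 / 8 <= p <= 7 / 8 -> 1 / 8 <= q <= 7 / 8 -> 0 < s -> 0 < t ->
  s * t / (s + t) * (1 - 4 * (p - q) ^+ 2) <=
  (s * p) * (t * q) / (s * p + t * q) +
  (s * (1 - p)) * (t * (1 - q)) / (s * (1 - p) + t * (1 - q)).
Proof.
move=> hp hq s0 t0.
(* a and b are the probabilities of one label under the two hypotheses *)
have term (a b : R) : 1 / 8 <= a -> 1 / 8 <= b ->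
    s * t / (s + t) ^+ 2 * (s * b + t * a - 2 * (s + t) * (a - b) ^+ 2) <=
    (s * a) * (t * b) / (s * a + t * b).
  move=> ha hb.
  have D0 : 0 < s * a + t * b by nra.
  have S0 : 0 < s + t by lra.
  rewrite mulrAC ler_pdivrMr ?exprn_gt0// [leRHS]mulrAC ler_pdivlMr//.
  rewrite [leLHS](_ : _ = (s * t) * ((s * a + t * b) *
    (s * b + t * a - 2 * (s + t) * (a - b) ^+ 2))); last by ring.
  rewrite [leRHS](_ : _ = (s * t) * (a * b * (s + t) ^+ 2)); last by ring.
  apply: ler_wpM2l; first by nra.
  rewrite (_ : a * b * (s + t) ^+ 2 =
    (s * a + t * b) * (s * b + t * a) - s * t * (a - b) ^+ 2); last by ring.
  rewrite mulrBr lerB// [leRHS](_ : _ = (s * a + t * b) * (2 * (s + t)) * (a - b) ^+ 2); last by ring.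
  rewrite ler_wpM2r ?sqr_ge0//.
  have : (s + t) / 8 * (2 * (s + t)) <= (s * a + t * b) * (2 * (s + t)).
    by apply: ler_wpM2r; nra.
  have := sqr_ge0 (s - t); rewrite !expr2; nra.
have S0 : 0 < s + t by lra.
have h1 := term p q ltac:(lra) ltac:(lra).
have h2 := term (1 - p) (1 - q) ltac:(lra) ltac:(lra).
apply: le_trans (lerD h1 h2); rewrite -mulrDr le_eqVlt; apply/orP; left; apply/eqP.
by field; rewrite gt_eqF.
Qed.

Section testing.
Context d (X : measurableType d) (R : realType) (mu : probability X R).

Lemma integral_two_valued (E : set X) (a b : R) : measurable E -> 0 <= a -> 0 <= b ->
  (\int[mu]_x (a * \1_E x + b * \1_(~` E) x)%:E =
   (a * fine (mu E) + b * (1 - fine (mu E)))%:E)%E.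
Proof.
move=> mE a0 b0; under eq_integral do rewrite EFinD.
have mi (c : R) (B : set X) : measurable B -> measurable_fun setT (fun x => (c * \1_B x)%:E).
  by move=> mB; apply/measurable_EFinP; exact: measurable_funM.
have i0 (c : R) (B : set X) x : 0 <= c -> (0 <= (c * \1_B x)%:E)%E.
  by move=> c0; rewrite lee_fin mulr_ge0.
have mCE : measurable (~` E) by exact: measurableC.
rewrite ge0_integralD//; [|by move=> x _; exact: i0|exact: mi|by move=> x _; exact: i0|exact: mi].
have iZ (c : R) (B : set X) : measurable B -> 0 <= c ->
    (\int[mu]_x (c * \1_B x)%:E = (c * fine (mu B))%:E)%E.
  move=> mB c0; under eq_integral do rewrite EFinM.
  rewrite ge0_integralZl//; last exact/measurable_EFinP.
  by rewrite integral_indic// setIT EFinM fineK// fin_num_measure.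
rewrite !iZ// -EFinD probability_setC//; congr (_ + _ * _)%:E.
by rewrite fineB// ?fin_num_measure.
Qed.

Variables (eta1 eta2 : X -> R).
Hypotheses (m1 : measurable_fun setT eta1) (m2 : measurable_fun setT eta2).
Hypotheses (r1 : forall x, 0 <= eta1 x <= 1) (r2 : forall x, 0 <= eta2 x <= 1).
Hypotheses (b1 : forall x, 1 / 8 <= eta1 x <= 7 / 8).
Hypotheses (b2 : forall x, 1 / 8 <= eta2 x <= 7 / 8).
Variables (E : set X) (mE : measurable E) (delta : R).
Hypothesis delta2 : 4 * delta ^+ 2 <= 1.
Hypothesis outE : forall x, ~ E x -> eta1 x = eta2 x.
Hypothesis onE : forall x, E x -> `|eta1 x - eta2 x| <= delta.

Local Notation P := (label_measure mu m1 r1).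
Local Notation Q := (label_measure mu m2 r2).

(** Le Cam's bound for two hypotheses that differ only on E: no test does much
better than the weights alone while few observations fall in E. The induction
peels off one observation. Outside E it leaves the ratio of the weights s and t
unchanged, and in E its label changes them as in [label_overlap]; this is why
the weights have to be arbitrary. *)
Lemma testing_bound n (A : set (n.-tuple (X * bool))) (s t : R) :
  measurable A -> 0 < s -> 0 < t ->
  ((s * t / (s + t) * (1 - 4 * delta ^+ 2 * fine (mu E)) ^+ n)%:E <=
   s%:E * power_measure P n A + t%:E * power_measure Q n (~` A))%E.
Proof.
have v01 : 0 <= fine (mu E) <= 1.
  rewrite fine_ge0//= -lee_fin fineK ?fin_num_measure//; exact: probability_le1.
have d0 : 0 <= 4 * delta ^+ 2 by rewrite mulr_ge0// sqr_ge0.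
elim: n A s t => [|n IHn] A s t mA s0 t0.
  have S0 : 0 < s + t by lra.
  have hs : s * t / (s + t) <= s by rewrite ler_pdivrMr//; nra.
  have ht : s * t / (s + t) <= t by rewrite ler_pdivrMr//; nra.
  rewrite expr0 mulr1 /= !diracE.
  have [inA|ninA] := boolP ([tuple] \in A).
    rewrite (_ : _ \in ~` A = false) ?mule0 ?adde0 ?mule1 ?lee_fin//.
    by apply/negbTE; rewrite in_setC negbK.
  by rewrite (_ : _ \in ~` A = true) ?mule0 ?add0e ?mule1 ?lee_fin// in_setC.
set v := fine (mu E) in v01 IHn *; set c := (1 - 4 * delta ^+ 2 * v) ^+ n in IHn *.
have S0 : 0 < s + t by lra.
have c0 : 0 <= c by rewrite exprn_ge0// subr_ge0; case/andP: v01 => *; exact: mulr_ile1.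
have mCA : measurable (~` A) by exact: measurableC.
pose f z := power_measure P n (tail_section z A).
pose g z := power_measure Q n (tail_section z (~` A)).
have mf : measurable_fun setT f by exact: measurable_power_tail.
have mg : measurable_fun setT g by exact: measurable_power_tail.
have f0 z : (0 <= f z)%E by exact: measure_ge0.
have g0 z : (0 <= g z)%E by exact: measure_ge0.
have sf0 z : (0 <= s%:E * f z)%E by rewrite mule_ge0// lee_fin ltW.
have tg0 z : (0 <= t%:E * g z)%E by rewrite mule_ge0// lee_fin ltW.
have msf : measurable_fun setT (fun z => s%:E * f z)%E by exact: measurable_funeM.
have mtg : measurable_fun setT (fun z => t%:E * g z)%E by exact: measurable_funeM.
rewrite !power_measureS -(ge0_integralZl _ measurableT mf) ?lee_fin ?(ltW s0)//.
rewrite -(ge0_integralZl _ measurableT mg) ?lee_fin ?(ltW t0)//.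
rewrite !ge0_integral_label// -ge0_integralD//; last 4 first.
- by move=> x _; exact: (label_average_ge0 r1 _ sf0).
- exact: (measurable_label_average m1 msf).
- by move=> x _; exact: (label_average_ge0 r2 _ tg0).
- exact: (measurable_label_average m2 mtg).
pose K := s * t / (s + t) * c.
have K0 : 0 <= K by rewrite mulr_ge0// divr_ge0 ?mulr_ge0// ltW.
have -> : s * t / (s + t) * (1 - 4 * delta ^+ 2 * v) ^+ n.+1 =
    (K * (1 - 4 * delta ^+ 2)) * v + K * (1 - v).
  by rewrite exprS /K -/c; ring.
rewrite /v -integral_two_valued//; last by rewrite mulr_ge0// subr_ge0.
apply: ge0_le_integral => //.
- move=> x _; rewrite lee_fin addr_ge0// mulr_ge0// mulr_ge0// subr_ge0//.
- by apply/measurable_EFinP; apply: measurable_funD; apply: measurable_funM => //;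
    apply: measurable_indic; exact: measurableC.
- by apply: emeasurable_funD;
    [exact: (measurable_label_average m1 msf)|exact: (measurable_label_average m2 mtg)].
move=> x _.
have [hb1 hb2] := (b1 x, b2 x).
have := IHn _ (s * eta1 x) (t * eta2 x) (measurable_tail_section (x, true) mA) _ _.
have := IHn _ (s * (1 - eta1 x)) (t * (1 - eta2 x)) (measurable_tail_section (x, false) mA) _ _.
rewrite -!tail_sectionC -/(f (x, true)) -/(f (x, false)) -/(g (x, true)) -/(g (x, false)).
have [p1 p1' p2 p2'] : [/\ 0 < eta1 x, 0 < 1 - eta1 x, 0 < eta2 x & 0 < 1 - eta2 x].
  by split; lra.
move=> /(_ (mulr_gt0 s0 p1') (mulr_gt0 t0 p2')) h0 /(_ (mulr_gt0 s0 p1) (mulr_gt0 t0 p2)) h1.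
have fE b : f (x, b) \is a fin_num by apply: power_measure_fin; exact: measurable_tail_section.
have gE b : g (x, b) \is a fin_num by apply: power_measure_fin; exact: measurable_tail_section.
have := label_overlap hb1 hb2 s0 t0.
move: h0 h1; rewrite -(fineK (fE true)) -(fineK (gE true)) -(fineK (fE false)) -(fineK (gE false)).
rewrite -!EFinM -!EFinD !lee_fin => h0 h1 ho.
apply: (@le_trans _ _ (K * (1 - 4 * (eta1 x - eta2 x) ^+ 2))).
  rewrite !indicE in_setC; have [xE|xE] := boolP (x \in E).
    rewrite mulr1 mulr0 addr0 ler_wpM2l// lerB// ler_wpM2l// -real_normK ?num_real//.
    have := onE (set_mem xE); have := normr_ge0 (eta1 x - eta2 x); rewrite !expr2; nra.
  rewrite mulr0 add0r mulr1 outE; first by rewrite subrr expr0n mulr0 subr0 mulr1.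
  by move=> /mem_set; rewrite (negbTE xE).
have := ler_wpM2r c0 ho; rewrite mulrDl /K.
by move=> h; apply: le_trans (_ : _ <= s * t / (s + t) * (1 - 4 * (eta1 x - eta2 x) ^+ 2) * c) _;
  [lra|nra].
Qed.

End testing.

(** * Assouad's method *)

Section flip_average.
Variables (R : realFieldType) (J : finType).
Implicit Types s : {ffun J -> bool}.

Definition flip (j : J) s : {ffun J -> bool} := [ffun i => if i == j then ~~ s i else s i].

Lemma flipK j : involutive (flip j).
Proof. by move=> s; apply/ffunP => i; rewrite !ffunE; case: eqP => // _; rewrite negbK. Qed.

(** The flip of bit j is an involution, so in the average over all s the terms F
s j and F (flip j s) j weigh the same. *)
Lemma exists_large_sum (F : {ffun J -> bool} -> J -> R) (W : R) :
  (forall s j, W <= F s j + F (flip j s) j) ->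
  exists s, #|J|%:R * W / 2 <= \sum_j F s j.
Proof.
move=> FW; apply: contrapT => /forallNP noS.
have lt1 : \sum_s \sum_j F s j < \sum_(s : {ffun J -> bool}) (#|J|%:R * W / 2).
  apply: ltr_sum => [|s _]; first by apply/hasP; exists [ffun=> true]; rewrite ?mem_index_enum.
  by have /negP := noS s; rewrite -ltNge.
suff : \sum_(s : {ffun J -> bool}) (#|J|%:R * W / 2) <= \sum_s \sum_j F s j.
  by rewrite leNgt lt1.
have half j : \sum_(s : {ffun J -> bool}) (W / 2) <= \sum_s F s j.
  have : \sum_(s : {ffun J -> bool}) W <= \sum_s (F s j + F (flip j s) j).
    by apply: ler_sum => s _; exact: FW.
  have reix : \sum_(s : {ffun J -> bool}) F (flip j s) j = \sum_s F s j.
    by rewrite [RHS](reindex_inj (inv_inj (flipK j))).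
  rewrite big_split /= reix.
  by rewrite -mulr_suml; lra.
rewrite [leRHS]exchange_big /= (_ : \sum_(s : {ffun J -> bool}) _ =
  \sum_(j : J) \sum_(s : {ffun J -> bool}) (W / 2)); first by apply: ler_sum => j _.
rewrite exchange_big /=; apply: eq_bigr => s _.
by rewrite sumr_const -[RHS]mulr_natl mulrA.
Qed.

End flip_average.

Section risks.
Context (R : realType) (d : nat).
Local Notation X := 'rV[R]_d.

Section bayes.
Variable P : probability (observation R d) R.

Lemma measurable_errors (c : X -> bool) : measurable_fun setT c ->
  measurable [set z : observation R d | c z.1 != z.2].
Proof.
move=> mc; have m1 : measurable_fun setT (fun z : observation R d => c z.1).
  by apply: measurableT_comp => //; exact: measurable_fst.
have m2 : measurable_fun setT (fun z : observation R d => z.2) by exact: measurable_snd.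
rewrite (_ : [set _ | _] = ((fun z => c z.1) @^-1` [set true] `&` snd @^-1` [set false]) `|`
  ((fun z => c z.1) @^-1` [set false] `&` snd @^-1` [set true])).
  apply: measurableU; apply: measurableI; rewrite -[X in measurable X]setTI;
  by [exact: m1|exact: m2].
apply/seteqP; split => -[x y] /=; first by case: (c x) y => -[]//=; [left|right].
by move=> [] [-> ->].
Qed.

(** Any version of the regression function computes the errors of a fixed
classifier. This applies both to an explicit version and to the version chosen
in the Bayes classifier. *)
Lemma regression_errors (eta : X -> R) (c : X -> bool) :
  is_regression P eta -> measurable_fun setT c ->
  (P [set z | c z.1 != z.2] =
    \int[marginal P]_x (if c x then 1 - eta x else eta x)%:E)%E.
Proof.
move=> [meta eta01 Peta] mc.
have mct b : measurable (c @^-1` [set b]) by rewrite -[X in measurable X]setTI; exact: mc.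
have etag A : (0 <= \int[marginal P]_(x in A) (eta x)%:E)%E.
  by apply: integral_ge0 => x _; rewrite lee_fin; case/andP: (eta01 x).
have mprod (A : set X) (b : bool) : measurable A -> measurable (A `*` [set b]).
  by move=> mA; exact: measurableX.
have Pfalse A : measurable A ->
    (P (A `*` [set false]) = \int[marginal P]_(x in A) (1 - eta x)%:E)%E.
  move=> mA.
  have : (P (A `*` [set true]) + P (A `*` [set false]) = marginal P A)%E.
    rewrite -measureU; [|exact: mprod|exact: mprod|].
      rewrite /marginal /distribution /pushforward; congr (P _).
      apply/seteqP; split => -[x y] /=; first by move=> [] [].
      by case: y => Ax; [left|right].
    by rewrite -subset0 => -[x y] /= [[_ ->] []].
  have : (\int[marginal P]_(x in A) (eta x)%:E +
          \int[marginal P]_(x in A) (1 - eta x)%:E = marginal P A)%E.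
    rewrite -ge0_integralD//; last 4 first.
    - by move=> x _; rewrite lee_fin; case/andP: (eta01 x).
    - by apply/measurable_EFinP/measurable_funTS.
    - by move=> x _; rewrite lee_fin subr_ge0; case/andP: (eta01 x).
    - by apply/measurable_EFinP/measurable_funTS; exact: measurable_funB.
    under eq_integral do rewrite -EFinD addrC subrK.
    by rewrite integral_cst// mul1e.
  have fin1 : P (A `*` [set true]) \is a fin_num by apply: fin_num_measure; exact: mprod.
  rewrite -Peta// => <- e.
  by rewrite -[LHS](addeK _ fin1) [X in (X - _)%E]addeC e [X in (X - _)%E]addeC addeK.
rewrite (_ : [set _ | _] = ((c @^-1` [set true]) `*` [set false]) `|`
   ((c @^-1` [set false]) `*` [set true])); last first.
  apply/seteqP; split => -[x y] /=; first by case: (c x) y => -[]//=; [left|right].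
  by move=> [] [-> ->].
rewrite measureU; [|exact: mprod|exact: mprod|]; last first.
  by rewrite -subset0 => -[x y] /= [[_ ->] []].
transitivity (\int[marginal P]_(x in c @^-1` [set true]) (1 - eta x)%:E +
              \int[marginal P]_(x in c @^-1` [set false]) (eta x)%:E)%E.
  by congr (_ + _)%E; [exact: Pfalse|exact: Peta].
rewrite (_ : c @^-1` [set false] = ~` (c @^-1` [set true])); last first.
  by apply/seteqP; split => x /=; case: (c x).
rewrite -[in RHS](setUv (c @^-1` [set true])) ge0_integral_setU//; last 4 first.
- exact: measurableC.
- rewrite setUv; apply/measurable_EFinP.
  by apply: measurable_fun_ifT => //; exact: measurable_funB.
- by move=> x _; rewrite lee_fin; case: ifP; have := eta01 x; lra.
- by rewrite disj_set2E setICr eqxx.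
by congr (_ + _)%E; apply: eq_integral => x; rewrite inE /=; case: (c x).
Qed.

(** The existence of a regression function makes the chosen one a version of it,
and then the Bayes classifier minimizes the integrand of [regression_errors] at
each point. *)
Lemma bayes_risk_le (c : X -> bool) : measurable_fun setT c ->
  (exists eta, is_regression P eta) ->
  (bayes_risk P <= P [set z | c z.1 != z.2])%E.
Proof.
move=> mc ex; have regP : is_regression P (regression P) by exact: xgetPex.
have [meta eta01 _] := regP.
have mb : measurable_fun setT (bayes_classifier P).
  by apply: measurable_fun_ler => //; exact: measurable_cst.
have merr (b : X -> bool) : measurable_fun setT b ->
    measurable_fun setT
      (fun x => (if b x then 1 - regression P x else regression P x)%:E).
  move=> mbx; apply/measurable_EFinP; apply: measurable_fun_ifT => //.
  exact: measurable_funB.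
rewrite /bayes_risk !(regression_errors regP)//; apply: ge0_le_integral => //.
- by move=> x _; rewrite lee_fin; case: ifP; have := eta01 x; lra.
- exact: merr.
- exact: merr.
move=> x _; rewrite lee_fin /bayes_classifier.
by have := eta01 x; case: (leP (1 / 2) (regression P x)); case: (c x); lra.
Qed.

End bayes.

End risks.

Section label_risks.
Context (R : realType) (d : nat).
Local Notation X := 'rV[R]_d.
Variables (mu : probability X R) (eta : X -> R).
Hypotheses (meta : measurable_fun setT eta) (eta01 : forall x, 0 <= eta x <= 1).

Local Notation P := (label_measure mu meta eta01).

Lemma label_measureX A b : measurable A ->
  (P (A `*` [set b]) = \int[mu]_(x in A) (label_density eta b x)%:E)%E.
Proof.
move=> mA; transitivity (label_measure mu meta eta01 (A `*` [set b])) => //.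
rewrite label_measureE; last exact: measurableX.
rewrite [RHS]integral_mkcond; apply: eq_integral => x _.
rewrite patchE !indicE /label_density.
have AE (c : bool) : ((x, c) \in A `*` [set b]) = (x \in A) && (c == b).
  apply/idP/andP; first by rewrite inE /= => -[/mem_set ? ->].
  by move=> [/set_mem xA /eqP ->]; rewrite inE.
rewrite !AE; case: (x \in A); case: (b) => /=; rewrite ?mul0e ?add0e ?adde0 ?mul1e//.
Qed.

Lemma marginal_labelE A : measurable A -> (marginal P A = mu A)%E.
Proof.
move=> mA; rewrite /marginal /distribution /pushforward.
transitivity (label_measure mu meta eta01 (fst @^-1` A)) => //.
rewrite label_measureE; last by rewrite -[X in measurable X]setTI; exact: measurable_fst.
transitivity (\int[mu]_x (\1_A x)%:E)%E; last by rewrite integral_indic// setIT.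
apply: eq_integral => x _; rewrite !indicE.
have AE b : ((x, b) \in fst @^-1` A) = (x \in A) by apply/idP/idP; rewrite !in_setE.
by rewrite !AE -muleDr// -EFinD addrC subrK mule1.
Qed.

Lemma label_is_regression : is_regression P eta.
Proof.
split => // A mA; rewrite label_measureX//.
by apply: eq_measure_integral => B mB _; rewrite [RHS]marginal_labelE.
Qed.

Lemma label_errors (c : X -> bool) : measurable_fun setT c ->
  (P [set z | c z.1 != z.2] = \int[mu]_x (if c x then 1 - eta x else eta x)%:E)%E.
Proof.
move=> mc; rewrite (regression_errors label_is_regression mc).
by apply: eq_measure_integral => B mB _; exact: marginal_labelE.
Qed.

Let bayes (x : X) : bool := 1 / 2 <= eta x.

(** A classifier that disagrees with the Bayes label at x loses |2 eta x - 1|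
there; Fubini's theorem separates the sample from the test point. *)
Lemma label_excess_risk n (C : n.-tuple (observation R d) * X -> bool) :
  measurable_fun setT C ->
  (\int[mu]_x (`|2 * eta x - 1|%:E *
     power_measure P n [set t | C (t, x) != bayes x]) <=
   risk C P - bayes_risk P)%E.
Proof.
move=> mC.
have mb : measurable_fun setT bayes by apply: measurable_fun_ler => //; exact: measurable_cst.
pose W := [set w : n.-tuple (observation R d) * observation R d |
  C (w.1, w.2.1) != w.2.2].
have mW : measurable W.
  have mc : measurable_fun setT (fun w : n.-tuple (observation R d) * observation R d =>
      C (w.1, w.2.1)).
    apply: measurableT_comp => //; apply/measurable_fun_pair => //.
    by apply: measurableT_comp => //; exact: measurable_fst.
  have mlab : measurable_fun setT (fun w : n.-tuple (observation R d) * observation R d =>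
      w.2.2).
    by apply: measurableT_comp => //; exact: measurable_snd.
  rewrite (_ : W = ((fun w => C (w.1, w.2.1)) @^-1` [set true] `&`
                    (fun w => w.2.2) @^-1` [set false]) `|`
    ((fun w => C (w.1, w.2.1)) @^-1` [set false] `&` (fun w => w.2.2) @^-1` [set true])).
    apply: measurableU; apply: measurableI; rewrite -[X in measurable X]setTI;
    by [exact: mc|exact: mlab].
  apply/seteqP; split => -[t [x y]] /=; rewrite /W /=.
    by case: (C (t, x)) y => -[]//=; [left|right].
  by move=> [] [-> ->].
pose h z := power_measure P n (ysection W z).
have mh : measurable_fun setT h by exact: measurable_fun_ysection.
have h0 z : (0 <= h z)%E by exact: measure_ge0.
have riskE : (risk C P =
    \int[mu]_x (h (x, true) * (eta x)%:E + h (x, false) * (1 - eta x)%:E))%E.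
  rewrite -(ge0_integral_label mu meta eta01 mh h0).
  transitivity (\int[(power_measure P n \x P)%E]_w (\1_W w)%:E)%E.
    by rewrite integral_indic// setIT.
  rewrite fubini_tonelli2//; last exact/measurable_EFinP.
  apply: eq_integral => z _; rewrite /fubini_G /h.
  have mz : measurable (ysection W z) by exact: measurable_ysection.
  transitivity (\int[power_measure P n]_t (\1_(ysection W z) t)%:E)%E.
    by apply: eq_integral => t _; rewrite !indicE /ysection; congr ((_ : bool)%:R)%:E;
      apply/idP/idP; rewrite !in_setE /= in_setE.
  by rewrite integral_indic// setIT.
have hE x b : h (x, b) = power_measure P n [set t | C (t, x) != b].
  by congr (power_measure _ _ _); apply/funext => t; rewrite /ysection /= in_setE.
pose p x := power_measure P n [set t | C (t, x) != bayes x].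
have mCx b x : measurable [set t | C (t, x) != b].
  rewrite (_ : [set _ | _] = ysection W (x, b)); first exact: measurable_ysection.
  by apply/funext => t; rewrite /ysection /= in_setE.
have mp : measurable_fun setT p.
  rewrite (_ : p = fun x => if bayes x then h (x, true) else h (x, false)); last first.
    by apply/funext => x; rewrite !hE /p; case: (bayes x).
  by apply: measurable_fun_ifT => //; apply: measurableT_comp => //;
    exact/measurable_fun_pair.
have mabs : measurable_fun setT (fun x => `|2 * eta x - 1|%:E).
  apply/measurable_EFinP; apply: measurableT_comp => //.
  by apply: measurable_funB => //; exact: measurable_funM.
have merr : measurable_fun setT (fun x => (if bayes x then 1 - eta x else eta x)%:E).
  by apply/measurable_EFinP; apply: measurable_fun_ifT => //; exact: measurable_funB.
have bayes_le : (bayes_risk P <= \int[mu]_x (if bayes x then 1 - eta x else eta x)%:E)%E.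
  rewrite -(label_errors mb).
  by apply: bayes_risk_le => //; exists eta; exact: label_is_regression.
have bfin : bayes_risk P \is a fin_num.
  rewrite ge0_fin_numE; last exact: measure_ge0.
  apply: le_lt_trans bayes_le _; rewrite -(label_errors mb).
  rewrite (le_lt_trans (probability_le1 _ _)) ?ltry//; exact: measurable_errors.
rewrite leeBrDr//.
apply: (@le_trans _ _ (\int[mu]_x (`|2 * eta x - 1|%:E * p x) +
    \int[mu]_x (if bayes x then 1 - eta x else eta x)%:E)%E).
  exact: leeD.
rewrite -ge0_integralD//; last 3 first.
- by move=> x _; rewrite mule_ge0// lee_fin.
- exact: emeasurable_funM.
- by move=> x _; rewrite lee_fin; case: ifP; have := eta01 x; lra.
rewrite riskE; apply: ge0_le_integral => //.
- move=> x _; rewrite adde_ge0// ?mule_ge0// ?lee_fin//.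
  by case: ifP; have := eta01 x; lra.
- by apply: emeasurable_funD => //; exact: emeasurable_funM.
- by apply: measurable_label_average.
move=> x _; rewrite !hE.
have pC : (power_measure P n [set t | C (t, x) != ~~ bayes x] = 1 - p x)%E.
  rewrite -power_measure_setC//; congr (power_measure _ _ _).
  by apply/funext => t /=; apply/propext; split => [|/negP]; case: (C (t, x)) (bayes x) => -[].
have pfin : p x \is a fin_num by exact: power_measure_fin.
have ? := eta01 x.
move: pC pfin; rewrite /p; case bx : (bayes x) => /= -> pfin;
  rewrite -(fineK pfin) -!EFinM -!EFinD -?EFinM -?EFinD lee_fin;
  move: bx; rewrite /bayes.
  by move=> bx; rewrite ger0_norm; lra.
by move=> /negbT; rewrite -ltNge => bx; rewrite ler0_norm; lra.
Qed.

End label_risks.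

Lemma bernoulli_ineq (R : realFieldType) (x : R) n : 0 <= x <= 1 ->
  1 - n%:R * x <= (1 - x) ^+ n.
Proof.
move=> x01; elim: n => [|n IHn]; first by rewrite mul0r subr0 expr0.
have n0 : 0 <= n%:R :> R by exact: ler0n.
rewrite exprS -natr1; have : (1 - x) * (1 - n%:R * x) <= (1 - x) * (1 - x) ^+ n.
  by apply: ler_wpM2l => //; lra.
by apply: le_trans; nra.
Qed.

Section assouad.
Context (R : realType) (d : nat).
Local Notation X := 'rV[R]_d.
Variables (mu : probability X R) (J : finType).
Variables (eta : {ffun J -> bool} -> X -> R).
Hypotheses (meta : forall s, measurable_fun setT (eta s)).
Hypotheses (eta01 : forall s x, 0 <= eta s x <= 1).
Hypothesis eta_range : forall s x, 1 / 8 <= eta s x <= 7 / 8.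
Variables (E D : J -> set X) (delta h v b : R) (n : nat).
Hypotheses (mE : forall j, measurable (E j)) (mD : forall j, measurable (D j)).
Hypothesis tD : trivIset setT D.
Hypothesis outE : forall j s x, ~ E j x -> eta s x = eta (flip j s) x.
Hypothesis onE : forall j s x, E j x -> `|eta s x - eta (flip j s) x| <= delta.
Hypothesis onD1 : forall j (s : {ffun J -> bool}) x, D j x -> s j -> 1 / 2 + h <= eta s x.
Hypothesis onD0 : forall j (s : {ffun J -> bool}) x, D j x -> ~~ s j -> eta s x <= 1 / 2 - h.
Hypotheses (h0 : 0 < h) (v0 : 0 <= v) (delta2 : 4 * delta ^+ 2 <= 1).
Hypothesis Ev : forall j, (mu (E j) <= v%:E)%E.
Hypothesis Db : forall j, (b%:E <= mu (D j))%E.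
Hypothesis nv : n%:R * (4 * delta ^+ 2 * v) <= 1 / 2.

Local Notation P s := (label_measure mu (meta s) (eta01 s)).

(** The set E j is where bit j is visible, and D j is the part of it where a
wrong sign costs 2 h. Since s and [flip j s] agree outside E j, [testing_bound]
applies to each such pair with equal weights, at each test point separately; the
errors of the pair then add up to at least (1 - 4 delta^2 v)^n / 2, which
Bernoulli's inequality bounds below by 1/4. *)
Theorem assouad (C : n.-tuple (observation R d) * X -> bool) : measurable_fun setT C ->
  exists s, ((#|J|%:R * (h * b / 4))%:E <= risk C (P s) - bayes_risk (P s))%E.
Proof.
move=> mC.
pose wrong (s : {ffun J -> bool}) y x := power_measure (P s) n [set t | C (t, x) != y].
have mCy y : measurable [set w | C w != y].
  by rewrite -[X in measurable X]setTI; exact: (mC measurableT [set z | z != y]).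
have CxE y x : [set t | C (t, x) != y] = ysection [set w | C w != y] x.
  by apply/funext => t; rewrite /ysection /= in_setE.
have mCx y x : measurable [set t | C (t, x) != y].
  by rewrite CxE; exact: measurable_ysection.
have mwrong s y : measurable_fun setT (wrong s y).
  rewrite /wrong; under eq_fun do rewrite CxE.
  exact: (@measurable_fun_ysection _ _ _ _ _ (power_measure (P s) n)).
have wrong0 s y x : (0 <= wrong s y x)%E by exact: measure_ge0.
have wrong1 s y x : (wrong s y x <= 1)%E by exact: power_measure_le1.
pose F (s : {ffun J -> bool}) j := (\int[mu]_(x in D j) wrong s (s j) x)%E.
have F0 s j : (0 <= F s j)%E by apply: integral_ge0.
have Ffin s j : F s j \is a fin_num.
  rewrite ge0_fin_numE//; apply: (@le_lt_trans _ _ (\int[mu]_(x in D j) 1)%E).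
    by apply: ge0_le_integral => //; exact: measurable_funTS.
  rewrite integral_cst// mul1e (le_lt_trans (probability_le1 _ _))// ltry//.
have excess s : ((2 * h)%:E * \sum_j F s j <= risk C (P s) - bayes_risk (P s))%E.
  apply: le_trans (label_excess_risk mu (meta s) (eta01 s) mC).
  pose G x := (`|2 * eta s x - 1|%:E *
    power_measure (P s) n [set t | C (t, x) != (1 / 2 <= eta s x)%R])%E.
  have mbayes : measurable_fun setT (fun x => 1 / 2 <= eta s x).
    by apply: measurable_fun_ler => //; exact: measurable_cst.
  have mG : measurable_fun setT G.
    apply: emeasurable_funM.
      apply/measurable_EFinP; apply: measurableT_comp => //.
      by apply: measurable_funB => //; exact: measurable_funM.
    rewrite (_ : (fun x => _) = fun x => if 1 / 2 <= eta s x then wrong s true x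
        else wrong s false x); last by apply/funext => x; case: ifP.
    exact: measurable_fun_ifT.
  have G0 x : (0 <= G x)%E by rewrite mule_ge0// lee_fin.
  apply: (@le_trans _ _ (\sum_j \int[mu]_(x in D j) G x)%E).
    rewrite ge0_sume_distrr//; apply: lee_sum => j _.
    rewrite /F -ge0_integralZl//; last 2 first.
    - exact: measurable_funTS.
    - by rewrite lee_fin mulr_ge0// ltW.
    apply: ge0_le_integral => //.
    - by move=> x _; rewrite mule_ge0// lee_fin mulr_ge0// ltW.
    - by apply: measurable_funTS; exact: measurable_funeM.
    - exact: measurable_funTS.
    move=> x Dx; rewrite /G /wrong.
    have [sj|sj] := boolP (s j).
      have := onD1 Dx sj => e1.
      have -> : 1 / 2 <= eta s x by move: h0; lra.
      by apply: lee_wpmul2r => //; rewrite lee_fin ger0_norm; move: h0; lra.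
    have := onD0 Dx sj => e1.
    have -> : (1 / 2 <= eta s x) = false by apply/negbTE; rewrite -ltNge; move: h0; lra.
    by apply: lee_wpmul2r => //; rewrite lee_fin ler0_norm; move: h0; lra.
  rewrite -ge0_integral_bigsetU//=; last 3 first.
  - exact: index_enum_uniq.
  - by apply: sub_trivIset tD.
  - by apply: measurable_funTS.
  apply: ge0_subset_integral => //.
  exact: bigsetU_measurable.
have pair s j : b / 4 <= fine (F s j) + fine (F (flip j s) j).
  rewrite -lee_fin EFinD !fineK//.
  rewrite /F [flip j s j]ffunE eqxx.
  set s' := flip j s.
  rewrite -ge0_integralD//; [|exact: measurable_funTS|exact: measurable_funTS].
  have testing x : ((1 / 4)%:E <= wrong s (s j) x + wrong s' (~~ s j) x)%E.
    have -> : wrong s' (~~ s j) x =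
        power_measure (P s') n (~` [set t | C (t, x) != s j]).
      congr (power_measure _ _ _); apply/funext => t /=; apply/propext.
      by split => [|/negP]; case: (C (t, x)) (s j) => -[].
    have := testing_bound mu (meta s) (meta s') (eta01 s) (eta01 s') (eta_range s)
      (eta_range s') (mE j) delta2 (outE s) (onE s) (mCx (s j) x) ltr01 ltr01.
    rewrite !mul1e; apply: le_trans; rewrite lee_fin.
    have Ej : 0 <= fine (mu (E j)) <= v.
      by rewrite fine_ge0//= -lee_fin fineK ?fin_num_measure.
    have d0 : 0 <= 4 * delta ^+ 2 by rewrite mulr_ge0// sqr_ge0.
    have dE : 0 <= 4 * delta ^+ 2 * fine (mu (E j)) <= 1.
      have /andP[E0 _] := Ej; rewrite mulr_ge0//= mulr_ile1//.
      by rewrite -lee_fin fineK ?fin_num_measure//; exact: probability_le1.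
    have := bernoulli_ineq n dE.
    have : n%:R * (4 * delta ^+ 2 * fine (mu (E j))) <= n%:R * (4 * delta ^+ 2 * v).
      by rewrite ler_wpM2l// ler_wpM2l//; case/andP: Ej.
    have -> : 1 * 1 / (1 + 1) = 1 / 2 :> R by rewrite mulr1.
    by move: nv; lra.
  apply: (@le_trans _ _ (\int[mu]_(x in D j) (1 / 4)%:E)%E).
    rewrite integral_cst// (_ : b / 4 = 1 / 4 * b); last by ring.
    by rewrite EFinM; apply: lee_wpmul2l; [rewrite lee_fin; lra|exact: Db].
  apply: ge0_le_integral => //.
  by apply: emeasurable_funD; exact: measurable_funTS.
have [s Fs] := exists_large_sum pair.
exists s; apply: le_trans (excess s).
have -> : (\sum_j F s j = (\sum_j fine (F s j))%:E)%E.
  by rewrite -sumEFin; apply: eq_bigr => j _; rewrite fineK.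
rewrite -EFinM lee_fin (_ : _ * _ = 2 * h * (#|J|%:R * (b / 4) / 2)); last by field.
by rewrite ler_wpM2l// mulr_ge0// ltW.
Qed.

End assouad.

(** * Product integrals over Euclidean space *)

Section product_integral.
Context (R : realType).
Local Notation leb := (@lebesgue_measure R).

Lemma measurable_prod_tnth n (g : 'I_n -> R -> R) :
  (forall i, measurable_fun setT (g i)) ->
  measurable_fun setT (fun t : n.-tuple (measurableTypeR R) => \prod_i g i (tnth t i)).
Proof.
move=> mg; apply: measurable_prod => i _.
apply: (@measurableT_comp _ _ _ _ _ _ (g i)) => //. exact: measurable_tnth.
Qed.

Lemma integral_prod_tuple n (g : 'I_n -> R -> R) :
  (forall i, measurable_fun setT (g i)) -> (forall i x, 0 <= g i x) ->
  (\int[power_measure leb n]_t (\prod_i g i (tnth t i))%:E =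
   \prod_i \int[leb]_x (g i x)%:E)%E.
Proof.
elim: n g => [|n IHn] g mg g0.
  rewrite big_ord0; under eq_integral do rewrite big_ord0.
  by rewrite integral_cst//= diracT mul1e.
pose h (t : n.+1.-tuple (measurableTypeR R)) := (\prod_i g i (tnth t i))%:E.
have mh : measurable_fun setT h by apply/measurable_EFinP; exact: measurable_prod_tnth.
have h0 t : (0 <= h t)%E by rewrite lee_fin prodr_ge0.
transitivity (\int[(leb \x power_measure leb n)%E]_z h (tuple_cons z))%E.
  rewrite /cons_measure.
  have := @ge0_integral_pushforward _ _ _ _ _ _ (@measurable_tuple_cons _ (measurableTypeR R) n)
   (leb \x power_measure leb n)%E setT h measurableT mh.
  rewrite preimage_setT => <-//.
rewrite fubini_tonelli1//; last first.
  apply: (@measurableT_comp _ _ _ _ _ _ h) => //.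
  exact: (@measurable_tuple_cons _ (measurableTypeR R) n).
pose c := (\prod_(i < n) \int[leb]_x (g (lift ord0 i) x)%:E)%E.
rewrite big_ord_recl.
transitivity (\int[leb]_x ((g ord0 x)%:E * c))%E.
  apply: eq_integral => x _; rewrite /fubini_F /c -IHn//.
  rewrite -ge0_integralZl//; last 3 first.
  - by apply/measurable_EFinP; exact: (measurable_prod_tnth (fun i => mg (lift ord0 i))).
  - by move=> t _; rewrite lee_fin prodr_ge0.
  - by rewrite lee_fin.
  apply: eq_integral => t _; rewrite /h big_ord_recl EFinM; congr (_ * _)%E.
  by congr (_%:E); apply: eq_bigr => i _; rewrite tnthS.
rewrite ge0_integralZr//.
- by apply/measurable_EFinP; exact: mg.
- by move=> x _; rewrite lee_fin.
- by apply: prode_ge0 => i _; apply: integral_ge0 => x _; rewrite lee_fin.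
Qed.

Lemma integral_prod_rV d (g : 'I_d -> R -> R) :
  (forall i, measurable_fun setT (g i)) -> (forall i x, 0 <= g i x) ->
  (\int[lebesgue_rV R d]_x (\prod_i g i (x ord0 i))%:E =
   \prod_i \int[leb]_x (g i x)%:E)%E.
Proof.
move=> mg g0; rewrite -integral_prod_tuple//.
pose h (x : 'rV[R]_d) := (\prod_i g i (x ord0 i))%:E.
have mh : measurable_fun setT h.
  apply/measurable_EFinP; apply: measurable_prod => i _.
  apply: (@measurableT_comp _ _ _ _ _ _ (g i)) => //; exact: measurable_rV_coord.
have := @ge0_integral_pushforward _ _ _ _ _ _ (@measurable_rV_of_tuple R d)
   (power_measure leb d) setT h measurableT mh.
rewrite preimage_setT => e; transitivity (\int[power_measure leb d]_x (h \o @rV_of_tuple R d) x)%E.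
  by apply: e => x _; rewrite lee_fin prodr_ge0.
by apply: eq_integral => t _; rewrite /h /=; congr (_%:E); apply: eq_bigr => i _; rewrite mxE.
Qed.

Definition box d (a b : 'I_d -> R) : set 'rV[R]_d :=
  [set x | forall i, a i <= x ord0 i <= b i].

Lemma box_prod_indic d (a b : 'I_d -> R) x :
  \1_(box a b) x = \prod_i \1_(`[a i, b i]%classic : set R) (x ord0 i) :> R.
Proof.
rewrite indicE; have [/set_mem xab|/negP xab] := boolP (x \in box a b).
  rewrite big1// => i _; rewrite indicE mem_set//= in_itv/=; exact: xab.
have /existsNP[i xi] : ~ (forall i, a i <= x ord0 i <= b i) by move=> xb; apply: xab; exact: mem_set.
rewrite (bigD1 i)//= indicE memNset ?mul0r//= in_itv/=; exact: xi.
Qed.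

Lemma measurable_box d (a b : 'I_d -> R) : measurable (box a b).
Proof.
rewrite (_ : box a b = \bigcap_(i in [set: 'I_d]) (@rV_coord R d i @^-1` `[a i, b i])).
  apply: fin_bigcap_measurable => // i _.
  by rewrite -[X in measurable X]setTI; apply: measurable_rV_coord.
by apply/seteqP; split => x /= h i; have := h i; rewrite /= in_itv/= => hi //; apply: hi.
Qed.

Lemma lebesgue_box d (a b : 'I_d -> R) : (forall i, a i <= b i) ->
  (lebesgue_rV R d (box a b) = (\prod_i (b i - a i))%:E)%E.
Proof.
move=> ab; transitivity (\int[lebesgue_rV R d]_x (\1_(box a b) x)%:E)%E.
  rewrite integral_indic ?setIT//; exact: measurable_box.
under eq_integral do rewrite box_prod_indic.
rewrite (@integral_prod_rV _ (fun i => \1_(`[a i, b i]%classic : set R)))//.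
rewrite -prodEFin; apply: eq_bigr => i _.
rewrite integral_indic// setIT.
transitivity (lebesgue_measure (`[a i, b i]%classic : set R)) => //.
rewrite lebesgue_measure_itv/= lte_fin.
case: ltP => [_ //|ba]; have -> : b i = a i by apply/eqP; rewrite eq_le ba ab.
by rewrite subrr.
Qed.

(** The primitive is L atan (x / L). *)
Lemma integral_cauchy_kernel (L : R) : 0 < L ->
  (\int[leb]_x ((1 + (x / L) ^+ 2)^-1)%:E = (pi * L)%:E)%E.
Proof.
move=> L0.
have cdiv : continuous (fun x : R => x / L) by move=> x; apply: cvgMr_tmp; exact: cvg_id.
have ck : continuous (fun x : R => (1 + (x / L) ^+ 2)^-1).
  rewrite -[X in continuous X]/((fun y => (oneDsqr y)^-1) \o (fun x => x / L)) => x.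
  apply: continuous_comp; first exact: cdiv.
  exact: continuous_oneDsqrV.
have dF (x : R) : is_derive x 1 (fun x => L * atan (x / L)) ((1 + (x / L) ^+ 2)^-1).
  have d1 : is_derive x 1 (fun x : R => x / L) L^-1.
    have : is_derive x 1 (L^-1 \*: (@id R)) (L^-1 *: 1 : R) by apply: is_deriveZ.
    by rewrite (_ : L^-1 \*: (@id R) = fun x : R => x / L) ?[L^-1 *: 1]mulr1//;
      apply/funext => y; rewrite /= [RHS]mulrC.
  have d2 := @is_derive1_comp R (@atan R) (fun x => x / L) x _ _ (is_derive1_atan (x / L)) d1.
  have := @is_deriveZ _ _ _ _ L _ _ _ d2.
  rewrite (_ : L *: _ = (1 + (x / L) ^+ 2)^-1)//.
  rewrite -[LHS]/(L * ((1 + (x / L) ^+ 2)^-1 * L^-1)) mulrCA mulfV ?mulr1//.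
  by rewrite gt_eqF.
rewrite ge0_symfun_integralT//; last 2 first.
- by move=> x; rewrite invr_ge0 addr_ge0// sqr_ge0.
- by move=> x /=; rewrite mulNr sqrrN.
rewrite -set_itvcy (@ge0_continuous_FTC2y _ _ (fun x => L * atan (x / L)) _ (L * (pi / 2))).
- by rewrite mul0r atan0 mulr0 sube0 -EFinM; congr (_%:E); field.
- by move=> x _; rewrite invr_ge0 addr_ge0// sqr_ge0.
- exact: continuous_subspaceT.
- apply: cvgMl_tmp.
  apply: (@cvg_comp _ _ _ (fun x : R => x / L) atan _ +oo _ _ (@cvgy_atan R)).
  by apply: gt0_cvgMly; [rewrite invr_gt0|exact: cvg_id].
- by move=> x _; exact: ex_derive.
- apply: cvg_at_right_filter; apply: cvgMl_tmp.
  apply: (@cvg_comp _ _ _ (fun x : R => x / L) atan _ (nbhs (0 / L))); first exact: cdiv.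
  exact: continuous_atan.
- by move=> x _; rewrite derive1E; exact: derive_val.
Qed.

End product_integral.

(** * The Euclidean norm and its balls *)

Section euclidean_norm.
Context (R : realType) (d : nat).
Implicit Types (x y z : 'rV[R]_d) (r : R).

Definition sqn x : R := \sum_i x ord0 i ^+ 2.

Lemma sqn_ge0 x : 0 <= sqn x. Proof. by apply: sumr_ge0 => i _; exact: sqr_ge0. Qed.

Lemma enorm_ge0 x : 0 <= enorm x. Proof. exact: sqrtr_ge0. Qed.

Lemma enorm_sqr x : enorm x ^+ 2 = sqn x. Proof. by rewrite sqr_sqrtr// sqn_ge0. Qed.

Lemma sqnN x : sqn (- x) = sqn x.
Proof. by apply: eq_bigr => i _; rewrite mxE sqrrN. Qed.

Lemma enormN x : enorm (- x) = enorm x. Proof. by rewrite /enorm -!/(sqn _) sqnN. Qed.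

Lemma enormB x y : enorm (x - y) = enorm (y - x). Proof. by rewrite -enormN opprB. Qed.

Lemma enorm0 : enorm (0 : 'rV[R]_d) = 0.
Proof. by rewrite /enorm big1 ?sqrtr0// => i _; rewrite mxE expr0n. Qed.

Lemma enormZ r x : enorm (r *: x) = `|r| * enorm x.
Proof.
rewrite /enorm -sqrtr_sqr -sqrtrM ?sqr_ge0//; congr Num.sqrt.
by rewrite mulr_sumr; apply: eq_bigr => i _; rewrite mxE exprMn.
Qed.

Lemma enorm_le r x : 0 <= r -> (enorm x <= r) = (sqn x <= r ^+ 2).
Proof. by move=> r0; rewrite -enorm_sqr ler_pXn2r// nnegrE enorm_ge0. Qed.

Lemma enorm_lt r x : 0 <= r -> (enorm x < r) = (sqn x < r ^+ 2).
Proof. by move=> r0; rewrite -enorm_sqr ltr_pXn2r// nnegrE enorm_ge0. Qed.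

Lemma sqn_coord x i : x ord0 i ^+ 2 <= sqn x.
Proof.
by rewrite /sqn (bigD1 i)//= lerDl; apply: sumr_ge0 => j _; exact: sqr_ge0.
Qed.

Lemma coord_le_enorm x i : `|x ord0 i| <= enorm x.
Proof. by rewrite -sqrtr_sqr ler_wsqrtr// sqn_coord. Qed.

Lemma cauchy_schwarz (a b : 'I_d -> R) :
  (\sum_i a i * b i) ^+ 2 <= (\sum_i a i ^+ 2) * (\sum_i b i ^+ 2).
Proof.
set C := \sum_i a i * b i; set A := \sum_i a i ^+ 2; set B := \sum_i b i ^+ 2.
have B0 : 0 <= B by apply: sumr_ge0 => i _; exact: sqr_ge0.
have /eqP sumE : \sum_i (B * a i - C * b i) ^+ 2 == B * (A * B - C ^+ 2).
  apply/eqP; transitivity (\sum_i (B ^+ 2 * a i ^+ 2 - (2 * B * C) * (a i * b i) +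
      C ^+ 2 * b i ^+ 2)); first by apply: eq_bigr => i _; ring.
  by rewrite !big_split /= sumrN -!mulr_sumr -/A -/B -/C; ring.
have := B0; rewrite le_eqVlt => /predU1P[B00|Bpos].
  have b0 i : b i = 0.
    have /eqP := esym B00; rewrite psumr_eq0; last by move=> j _; exact: sqr_ge0.
    by move=> /allP /(_ i (mem_index_enum i)) /=; rewrite sqrf_eq0 => /eqP.
  by rewrite /C big1 ?expr0n -?B00 ?mulr0// => i _; rewrite b0 mulr0.
rewrite -subr_ge0 -(pmulr_rge0 _ Bpos) -sumE.
by apply: sumr_ge0 => i _; exact: sqr_ge0.
Qed.

Lemma enormD x y : enorm (x + y) <= enorm x + enorm y.
Proof.
rewrite enorm_le ?addr_ge0 ?enorm_ge0//.
have cs : \sum_i x ord0 i * y ord0 i <= enorm x * enorm y.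
  rewrite (le_trans (ler_norm _))// -(@ler_pXn2r _ 2) ?nnegrE ?mulr_ge0 ?enorm_ge0//.
  by rewrite real_normK ?num_real// exprMn !enorm_sqr cauchy_schwarz.
have -> : sqn (x + y) = sqn x + sqn y + 2 * \sum_i x ord0 i * y ord0 i.
  rewrite /sqn mulr_sumr -!big_split /=; apply: eq_bigr => i _; rewrite mxE; ring.
rewrite -!enorm_sqr; move: cs; rewrite !expr2; nra.
Qed.

Lemma enorm_triangle y x z : enorm (x - z) <= enorm (x - y) + enorm (y - z).
Proof. by rewrite (_ : x - z = (x - y) + (y - z)) ?enormD// addrA subrK. Qed.

Lemma enorm_coord_bound x b : 0 <= b -> (forall i, `|x ord0 i| <= b) ->
  enorm x <= d%:R * b.
Proof.
move=> b0 xb; rewrite enorm_le ?mulr_ge0//.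
apply: (@le_trans _ _ (\sum_(i < d) b ^+ 2)).
  by apply: ler_sum => i _; rewrite -[leLHS]real_normK ?num_real// ler_pXn2r ?nnegrE.
rewrite sumr_const card_ord -[leLHS]mulr_natl exprMn ler_wpM2r ?sqr_ge0//.
rewrite -natrX ler_nat -mulnn; case: (posnP d) => [->//|d0]; exact: leq_pmulr.
Qed.

(** The factor d^2 is crude, but constants may depend on the dimension. *)
Lemma opnorm_entry_bound (B : 'M[R]_d) b : 0 <= b -> (forall i j, `|B i j| <= b) ->
  opnorm B <= d%:R ^+ 2 * b.
Proof.
move=> b0 Bb; apply: ge_sup.
  by exists (enorm (0 *m B)), 0 => //=; rewrite enorm0.
move=> _ [v /= v1 <-].
rewrite expr2 -mulrA; apply: enorm_coord_bound => [|j]; first by rewrite mulr_ge0.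
rewrite mxE (le_trans (ler_norm_sum _ _ _))//.
apply: (@le_trans _ _ (\sum_(i < d) b)); last by rewrite sumr_const card_ord -[leLHS]mulr_natl.
apply: ler_sum => i _; rewrite normrM -[leRHS]mul1r ler_pM//.
exact: le_trans (coord_le_enorm _ _) v1.
Qed.

Lemma measurable_sqn (c : 'rV[R]_d) : measurable_fun setT (fun x => sqn (x - c)).
Proof.
apply: measurable_sum => i; under eq_fun do rewrite !mxE.
by apply: measurable_funX; apply: measurable_funB => //; exact: measurable_rV_coord.
Qed.

Lemma measurable_enorm : measurable_fun setT (@enorm R d).
Proof.
apply: (@measurableT_comp _ _ _ _ _ _ (@Num.sqrt R) _ sqn).
  by apply: continuous_measurable_fun; exact: sqrt_continuous.
by have := measurable_sqn 0; under eq_fun do rewrite subr0.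
Qed.

Lemma measurable_eball (c : 'rV[R]_d) r : measurable (eball c r).
Proof.
have [r0|r0] := leP 0 r; last first.
  rewrite (_ : eball c r = set0)//; apply/seteqP; split => // x /=.
  by rewrite /eball /= ltNge (le_trans (ltW r0))// enorm_ge0.
rewrite (_ : eball c r = (fun x => sqn (x - c)) @^-1` `]-oo, r ^+ 2[).
  by rewrite -[X in measurable X]setTI; apply: measurable_sqn.
by apply/seteqP; split => x; rewrite /eball /= in_itv/= enormB enorm_lt.
Qed.

Lemma box_sub_eball (c : 'rV[R]_d) r s : (0 < d)%N -> 0 <= s -> s < r / d%:R ->
  box (fun i => c ord0 i - s) (fun i => c ord0 i + s) `<=` eball c r.
Proof.
move=> d0 s0 sr x xb; have d0' : 0 < d%:R :> R by rewrite ltr0n.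
apply: (@le_lt_trans _ _ (d%:R * s)); last by rewrite mulrC -ltr_pdivlMr.
apply: enorm_coord_bound => // i; rewrite !mxE ler_norml.
by have := xb i; lra.
Qed.

Lemma eball_sub_box (c : 'rV[R]_d) r :
  eball c r `<=` box (fun i => c ord0 i - r) (fun i => c ord0 i + r).
Proof.
move=> x xr i; have := coord_le_enorm (c - x) i.
by move=> /le_lt_trans /(_ xr); rewrite !mxE ltr_norml; lra.
Qed.

Lemma lebesgue_eball_ge (c : 'rV[R]_d) r : (0 < d)%N -> 0 < r ->
  (((r / d%:R) ^+ d)%:E <= lebesgue_rV R d (eball c r))%E.
Proof.
move=> d0 r0; have d0' : 0 < d%:R :> R by rewrite ltr0n.
pose s := r / d%:R / 2.
have s0 : 0 < s by rewrite !divr_gt0.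
have bs : box (fun i => c ord0 i - s) (fun i => c ord0 i + s) `<=` eball c r.
  by apply: box_sub_eball => //; [exact: ltW|rewrite /s; move: s0; rewrite /s; lra].
rewrite (_ : (r / d%:R) ^+ d = \prod_(i < d) ((c ord0 i + s) - (c ord0 i - s))); last first.
  transitivity (\prod_(i < d) (r / d%:R)); first by rewrite prodr_const card_ord.
  apply: eq_bigr => i _; rewrite /s; field.
  by rewrite gt_eqF.
rewrite -lebesgue_box; last by move=> i; lra.
by apply: le_measure => //; rewrite inE; [exact: measurable_box|exact: measurable_eball].
Qed.

Lemma lebesgue_eball_le (c : 'rV[R]_d) r : 0 <= r ->
  (lebesgue_rV R d (eball c r) <= ((2 * r) ^+ d)%:E)%E.
Proof.
move=> r0.
rewrite (_ : (2 * r) ^+ d = \prod_(i < d) ((c ord0 i + r) - (c ord0 i - r))); last first.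
  transitivity (\prod_(i < d) (2 * r)); first by rewrite prodr_const card_ord.
  by apply: eq_bigr => i _; ring.
rewrite -lebesgue_box; last by move=> i; lra.
apply: le_measure; rewrite ?inE; [exact: measurable_eball|exact: measurable_box|].
exact: eball_sub_box.
Qed.

End euclidean_norm.

(** * Gradients and Hessians *)

Section locality.
Context (R : realFieldType) (V W : normedModType R).

Lemma near_eq_differentiable (f g : V -> W) (x : V) :
  (\near x, f x = g x) -> differentiable g x -> differentiable f x.
Proof.
move=> fg dg; have fgx : f x = g x by exact: nbhs_singleton fg.
have fo : f \o shift x = cst (f x) + 'd g x +o_ 0 id.
  apply/eqaddoP => e e0.
  have /eqaddoP /(_ e e0) := diff_locally dg.
  have : \forall y \near 0, f (y + x) = g (y + x).
    by move: fg; rewrite [in X in X -> _](near_shift 0)/= subr0.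
  apply: filterS2 => y fgy; rewrite fgx.
  by rewrite -[(f \o shift x - _) y]/(f (y + x) - (cst (g x) + 'd g x) y) fgy.
have dfE : 'd f x = 'd g x :> (V -> W).
  by apply: diff_unique fo; exact: diff_continuous.
by apply/diff_locallyP; rewrite dfE; split => //; exact: diff_continuous.
Qed.

End locality.

Section gradients.
Context (R : realType) (d : nat).
Local Notation E := 'rV[R]_d.
Implicit Types (f g : E -> R) (x : E) (G H : 'I_d -> R).

Local Notation e_ i := (delta_mx ord0 i : E).

(** Pairing differentiability with the values of the partial derivatives lets
one set of rules propagate both. *)
Definition has_grad f x G := differentiable f x /\ forall i, 'D_(e_ i) f x = G i.

Lemma has_grad_eq f x G H : has_grad f x G -> G =1 H -> has_grad f x H.
Proof. by move=> [df fG] GH; split => // i; rewrite fG. Qed.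

Lemma has_grad_cst (c : R) x : has_grad (fun=> c) x (fun=> 0).
Proof. by split => [|i]; [exact: differentiable_cst|exact: derive_cst]. Qed.

Lemma has_grad_coord j x : has_grad (fun y => y ord0 j) x (fun i => (i == j)%:R).
Proof.
have dc : differentiable (fun y : E => y ord0 j) x by exact: differentiable_coord.
split => // i; have did : derivable (@id E) x (e_ i) by exact: derivable_id.
have := derive_mx did; rewrite derive_id => /matrixP /(_ ord0 j).
by rewrite !mxE eqxx /= eq_sym => ->.
Qed.

Lemma has_gradD f g x G H : has_grad f x G -> has_grad g x H ->
  has_grad (fun y => f y + g y) x (fun i => G i + H i).
Proof.
move=> [df fG] [dg gH]; split => [|i]; first exact: differentiableD.
by rewrite -fG -gH; apply: deriveD; exact: diff_derivable.
Qed.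

Lemma has_gradM f g x G H : has_grad f x G -> has_grad g x H ->
  has_grad (fun y => f y * g y) x (fun i => f x * H i + g x * G i).
Proof.
move=> [df fG] [dg gH]; split => [|i]; first exact: differentiableM.
by rewrite -fG -gH; apply: deriveM; exact: diff_derivable.
Qed.

Lemma has_gradZ (c : R) f x G : has_grad f x G ->
  has_grad (fun y => c * f y) x (fun i => c * G i).
Proof.
move=> fG; apply: has_grad_eq (has_gradM (has_grad_cst c x) fG) _ => i.
by rewrite mulr0 addr0.
Qed.

Lemma has_grad_sum (I : Type) (s : seq I) (f : I -> E -> R) x (G : I -> 'I_d -> R) :
  (forall j, has_grad (f j) x (G j)) ->
  has_grad (fun y => \sum_(j <- s) f j y) x (fun i => \sum_(j <- s) G j i).
Proof.
move=> fG; elim: s => [|j s IHs].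
  under eq_fun do rewrite big_nil.
  by apply: has_grad_eq (has_grad_cst 0 x) _ => i; rewrite big_nil.
under eq_fun do rewrite big_cons.
by apply: has_grad_eq (has_gradD (fG j) IHs) _ => i; rewrite big_cons.
Qed.

Lemma has_grad_comp (phi : R -> R) f x G (a : R) :
  is_derive (f x) 1 phi a -> has_grad f x G ->
  has_grad (fun y => phi (f y)) x (fun i => a * G i).
Proof.
move=> [dphi phia] [df fG].
have dphi' : differentiable phi (f x) by exact/derivable1_diffP.
have dc : differentiable (phi \o f) x by exact: differentiable_comp.
split => // i; rewrite -fG deriveE// diff_comp//= deriveE//.
by rewrite deriv1E// derive1E phia /= [RHS]mulrC.
Qed.

Lemma has_grad_grad f x G : has_grad f x G -> grad f x = \row_i G i.
Proof. by move=> [_ fG]; apply/rowP => i; rewrite !mxE fG. Qed.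

Lemma differentiable_row (g : 'I_d -> E -> R) x : (forall j, differentiable (g j) x) ->
  differentiable (fun y => \row_j g j y) x.
Proof.
move=> dg; rewrite (_ : (fun y => \row_j g j y) = \sum_j (fun y => g j y *: e_ j)).
  by apply: differentiable_sum => j; exact: differentiableZl.
apply/funext => y; rewrite fct_sumE; apply/rowP => i.
rewrite summxE (bigD1 i)//= big1; first by rewrite !mxE !eqxx mulr1 addr0.
by move=> j ji; rewrite !mxE eqxx eq_sym (negbTE ji) mulr0.
Qed.

(** Since A is open, the gradient of f coincides near each point of A with the
row of the functions g j, whose derivatives are known. *)
Lemma hess_on (A : set E) f (g : 'I_d -> E -> R) (H : 'I_d -> 'I_d -> E -> R) :
  open A -> (forall x, A x -> has_grad f x (g ^~ x)) ->
  (forall x j, A x -> has_grad (g j) x (H j ^~ x)) ->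
  twice_differentiable_on A f /\
  (forall x, A x -> hess f x = \matrix_(i, j) H j i x).
Proof.
move=> oA fg gH.
have near_grad x : A x -> \near x, grad f x = \row_j g j x.
  move=> Ax; apply: filterS (open_nbhs_nbhs (conj oA Ax)) => y Ay.
  exact: has_grad_grad (fg _ Ay).
have drow x : A x -> differentiable (fun y => \row_j g j y) x.
  by move=> Ax; apply: differentiable_row => j; have [] := gH x j Ax.
have dgrad x : A x -> differentiable (grad f) x.
  by move=> Ax; apply: near_eq_differentiable (near_grad x Ax) (drow x Ax).
split=> x Ax; first by split; [have [] := fg x Ax|exact: dgrad].
apply/row_matrixP => i; rewrite rowE -deriveEjacobian; last exact: dgrad.
rewrite (near_eq_derive _ (near_grad x Ax)).
rewrite derive_mx; last exact/diff_derivable/drow.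
apply/rowP => j; rewrite !mxE; have [_ gHx] := gH x j Ax.
by rewrite -gHx; congr ('D_ _ _ _); apply/funext => y; rewrite mxE.
Qed.

End gradients.

(** * Bounded Lipschitz functions *)

Section bounded_lipschitz.
Context (R : realType) (d : nat).
Local Notation E := 'rV[R]_d.
Implicit Types (f g : E -> R) (x y z : E).

(** The supremum is part of the notion because products of Lipschitz functions
are Lipschitz only if the factors are bounded. *)
Definition blip (b l : R) f :=
  (forall x, `|f x| <= b) /\ (forall x y, `|f x - f y| <= l * enorm (x - y)).

Lemma blip_ge0 b l f : blip b l f -> 0 <= b.
Proof. by move=> [/(_ 0) fb _]; exact: le_trans fb. Qed.

Lemma blip_cst c : blip `|c| 0 (fun=> c).
Proof. by split => // x y; rewrite subrr normr0 mul0r. Qed.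

Lemma blipW b l b' l' f : blip b l f -> b <= b' -> l <= l' -> blip b' l' f.
Proof.
move=> [fb fl] bb ll; split => [x|x y]; first exact: le_trans bb.
by rewrite (le_trans (fl x y))// ler_wpM2r// enorm_ge0.
Qed.

Lemma blipD b l b' l' f g : blip b l f -> blip b' l' g ->
  blip (b + b') (l + l') (fun x => f x + g x).
Proof.
move=> [fb fl] [gb gl]; split => [x|x y]; first by rewrite (le_trans (ler_normD _ _))// lerD.
rewrite opprD addrACA (le_trans (ler_normD _ _))// mulrDl lerD//.
Qed.

Lemma blipM b l b' l' f g : blip b l f -> blip b' l' g ->
  blip (b * b') (b * l' + b' * l) (fun x => f x * g x).
Proof.
move=> ff gg; have [b0 b'0] := (blip_ge0 ff, blip_ge0 gg).
have [fb fl] := ff; have [gb gl] := gg.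
split => [x|x y]; first by rewrite normrM ler_pM.
rewrite (_ : f x * g x - f y * g y = f x * (g x - g y) + g y * (f x - f y)); last by ring.
rewrite (le_trans (ler_normD _ _))// !normrM mulrDl lerD// -mulrA ler_pM//.
Qed.

Lemma blipZ c b l f : blip b l f -> blip (`|c| * b) (`|c| * l) (fun x => c * f x).
Proof. by move=> ff; apply: blipW (blipM (blip_cst c) ff) _ _; rewrite ?mulr0 ?addr0. Qed.

Lemma blipX n l f : blip 1 l f -> blip 1 (n%:R * l) (fun x => f x ^+ n).
Proof.
move=> ff; elim: n => [|n IHn]; first by rewrite mul0r -normr1; exact: blip_cst.
under eq_fun do rewrite exprS.
apply: blipW (blipM ff IHn) _ _; first by rewrite mulr1.
by rewrite !mul1r -natr1 mulrDl mul1r.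
Qed.

Lemma blip_scale (c : E) r b l f : 0 < r -> blip b l f ->
  blip b (l / r) (fun x => f (r^-1 *: (x - c))).
Proof.
move=> r0 [fb fl]; split => // x y; rewrite (le_trans (fl _ _))//.
rewrite -scalerBr (_ : x - c - (y - c) = x - y); last by rewrite opprB addrA subrK.
by rewrite enormZ gtr0_norm ?invr_gt0// mulrA.
Qed.

(** At each point at most one summand is nonzero, so the supremum does not grow;
two points involve at most two summands, hence the factor 2. *)
Lemma blip_disjoint_sum (J : finType) (F : J -> E -> R) (D : J -> set E) (b l : R) :
  0 <= b -> 0 <= l ->
  (forall j, blip b l (F j)) -> (forall j x, ~ D j x -> F j x = 0) -> trivIset setT D ->
  blip b (2 * l) (fun x => \sum_j F j x).
Proof.
move=> b0 l0 FB FD tD.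
have only j x : D j x -> \sum_i F i x = F j x.
  move=> Djx; rewrite (bigD1 j)//= big1 ?addr0// => i ij; apply: FD => Dix.
  have eij : i = j by apply: (tD i j) => //; exists x.
  by rewrite eij eqxx in ij.
have none x : (forall j, ~ D j x) -> \sum_i F i x = 0.
  by move=> Dx; rewrite big1// => j _; exact: FD.
have in_one x : (exists j, D j x) \/ (forall j, ~ D j x).
  by have [?|/forallNP] := pselect (exists j, D j x); [left|right].
split => [x|x y].
  have [[j Djx]|Dx] := in_one x; last by rewrite none// normr0.
  by rewrite (only j)//; exact: (FB j).1.
have e0 := enorm_ge0 (x - y).
have half j : `|F j x - F j y| <= 2 * l * enorm (x - y).
  by rewrite (le_trans ((FB j).2 x y))//; nra.
have [[j Dx]|Dx] := in_one x; have [[k Dy]|Dy] := in_one y.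
- rewrite (only j x)// (only k y)//; have [->|jk] := eqVneq j k; first exact: half.
  have Fkx : F k x = 0.
    by apply: FD => Dkx; have e : j = k by [apply: (tD j k) => //; exists x]; rewrite e eqxx in jk.
  have Fjy : F j y = 0.
    by apply: FD => Djy; have e : j = k by [apply: (tD j k) => //; exists y]; rewrite e eqxx in jk.
  have := (FB j).2 x y; have := (FB k).2 x y; rewrite Fkx Fjy.
  rewrite subr0 sub0r normrN => h1 h2.
  by rewrite (le_trans (ler_normB _ _))//; lra.
- by rewrite (only j x)// (none y)//; have := half j; rewrite (FD _ _ (Dy j)).
- by rewrite (only k y)// (none x)//; have := half k; rewrite (FD _ _ (Dx k)).
- by rewrite !none// subrr normr0; nra.
Qed.

End bounded_lipschitz.

(** * Radial profiles *)

Section profiles.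
Context (R : realType) (d : nat).
Local Notation E := 'rV[R]_d.
Implicit Types (x y : E).

Definition bump_base x : R := Num.max (1 - sqn x) 0.
Definition tail_base x : R := (1 + sqn x)^-1.

Lemma enorm_lip x y : `|enorm x - enorm y| <= enorm (x - y).
Proof.
rewrite ler_norml; apply/andP; split.
  by have := enormD (y - x) x; rewrite subrK enormB; lra.
by have := enormD (x - y) y; rewrite subrK; lra.
Qed.

Lemma bump_base_ge0 x : 0 <= bump_base x.
Proof. by rewrite le_max lexx orbT. Qed.

Lemma bump_base0 x : 1 <= enorm x -> bump_base x = 0.
Proof.
by move=> x1; apply/max_idPr; rewrite -enorm_sqr; nra.
Qed.

Lemma bump_baseE x : enorm x <= 1 -> bump_base x = 1 - enorm x ^+ 2.
Proof.
by move=> x1; rewrite enorm_sqr; apply/max_idPl; rewrite -enorm_sqr; have := enorm_ge0 x; nra.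
Qed.

(** On the unit ball |x|^2 - |y|^2 is at most 2 |x - y|. *)
Lemma blip_bump_base : blip 1 2 bump_base.
Proof.
have one x y : bump_base x - bump_base y <= 2 * enorm (x - y).
  have := enorm_lip x y; have := enorm_ge0 x; have := enorm_ge0 y.
  have := bump_base_ge0 y; have := enorm_ge0 (x - y); rewrite ler_norml.
  have [x1|x1] := leP 1 (enorm x); first by rewrite (bump_base0 x1); lra.
  rewrite (bump_baseE (ltW x1)).
  have [y1|y1] := leP 1 (enorm y); first by rewrite (bump_base0 y1); nra.
  by rewrite (bump_baseE (ltW y1)); nra.
split => [x|x y].
  rewrite ger0_norm ?bump_base_ge0// ge_max ler01 andbT.
  by have := sqn_ge0 x; lra.
rewrite ler_norml; apply/andP; split; last exact: one.
by have := one y x; rewrite enormB; lra.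
Qed.

Lemma blip_bump_coord i : blip 1 3 (fun x => x ord0 i * bump_base x).
Proof.
have b1 x : `|x ord0 i * bump_base x| <= bump_base x.
  have [x1|x1] := leP 1 (enorm x); first by rewrite bump_base0// mulr0 normr0.
  rewrite normrM [X in _ * X <= _]ger0_norm ?bump_base_ge0// ler_piMl ?bump_base_ge0//.
  exact: le_trans (coord_le_enorm _ _) (ltW x1).
have [ub ul] := blip_bump_base.
split => [x|x y].
  by rewrite (le_trans (b1 x))// (le_trans (ler_norm _) (ub x)).
have e0 := enorm_ge0 (x - y); have := ul x y; have bx := b1 x; have b_y := b1 y.
have [x1|x1] := leP 1 (enorm x).
  move: b_y; rewrite (bump_base0 x1) mulr0 !sub0r !normrN [`|bump_base y|]ger0_norm ?bump_base_ge0//; lra.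
have [y1|y1] := leP 1 (enorm y).
  move: bx; rewrite (bump_base0 y1) mulr0 !subr0 [`|bump_base x|]ger0_norm ?bump_base_ge0//; lra.
move=> uxy; rewrite (_ : _ - _ = (x ord0 i - y ord0 i) * bump_base x +
  y ord0 i * (bump_base x - bump_base y)); last by ring.
rewrite (le_trans (ler_normD _ _))// !normrM.
have h1 : `|x ord0 i - y ord0 i| <= enorm (x - y).
  by have := coord_le_enorm (x - y) i; rewrite !mxE.
have h2 : `|y ord0 i| <= 1 by exact: le_trans (coord_le_enorm _ _) (ltW y1).
have h3 := ub x.
have h4 : `|x ord0 i - y ord0 i| * `|bump_base x| <= enorm (x - y) * 1 by rewrite ler_pM.
have h5 : `|y ord0 i| * `|bump_base x - bump_base y| <= 1 * (2 * enorm (x - y)) by rewrite ler_pM.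
lra.
Qed.

Lemma tail_base_gt0 x : 0 < tail_base x.
Proof. by rewrite invr_gt0; have := sqn_ge0 x; lra. Qed.

Lemma tail_base_le1 x : tail_base x <= 1.
Proof. by rewrite invf_le1; have := sqn_ge0 x; lra. Qed.

Lemma tail_baseB x y :
  tail_base x - tail_base y = (enorm y - enorm x) * (enorm y + enorm x) * tail_base x * tail_base y.
Proof.
rewrite /tail_base -!enorm_sqr; have hx := sqr_ge0 (enorm x); have hy := sqr_ge0 (enorm y).
by field; rewrite !gt_eqF; lra.
Qed.

Lemma enorm_tail_base x : enorm x * tail_base x <= 1 / 2.
Proof.
rewrite /tail_base -enorm_sqr; have hx := sqr_ge0 (enorm x).
rewrite ler_pdivrMr; last lra.
by have := sqr_ge0 (enorm x - 1); rewrite !expr2; lra.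
Qed.

(** The factor 1 + |y| is what multiplication by a coordinate costs in
[blip_tail_coord]. *)
Lemma tail_base_lip x y : `|tail_base x - tail_base y| * (1 + enorm y) <= 3 * enorm (x - y).
Proof.
rewrite tail_baseB !normrM -!mulrA.
rewrite [`|tail_base x|]gtr0_norm ?tail_base_gt0// [`|tail_base y|]gtr0_norm ?tail_base_gt0//.
have hx := enorm_ge0 x; have hy := enorm_ge0 y; rewrite [`|enorm y + enorm x|]ger0_norm ?addr_ge0//.
have l1 := enorm_lip y x; rewrite enormB in l1.
have ux := tail_base_gt0 x; have uy := tail_base_gt0 y.
have ux1 := tail_base_le1 x; have uy1 := tail_base_le1 y.
have ex := enorm_tail_base x; have ey := enorm_tail_base y.
have e0 := enorm_ge0 (x - y).
rewrite [leRHS]mulrC; apply: ler_pM => //; first by do ![apply: mulr_ge0; first lra]; lra.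
have y2 : enorm y * (enorm y * tail_base y) <= 1 / 2 * enorm y by nra.
have y3 : enorm y * (enorm y * tail_base y) <= 1.
  rewrite /tail_base -enorm_sqr mulrA -expr2; have hy2 := sqr_ge0 (enorm y).
  by rewrite ler_pdivrMr; lra.
rewrite (_ : _ * _ = (enorm y * tail_base y) * tail_base x +
  (enorm x * tail_base x) * tail_base y +
  (enorm y * (enorm y * tail_base y)) * tail_base x +
  (enorm x * tail_base x) * (enorm y * tail_base y)); last by ring.
have ey0 : 0 <= enorm y * tail_base y by apply: mulr_ge0 => //; lra.
have ex0 : 0 <= enorm x * tail_base x by apply: mulr_ge0 => //; lra.
have eyy0 : 0 <= enorm y * (enorm y * tail_base y) by rewrite mulr_ge0.
nra.
Qed.

Lemma blip_tail_base : blip 1 3 tail_base.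
Proof.
split => [x|x y]; first by rewrite gtr0_norm ?tail_base_gt0// tail_base_le1.
apply: le_trans (tail_base_lip x y); rewrite ler_peMr//.
by have := enorm_ge0 y; lra.
Qed.

Lemma blip_tail_coord i : blip 1 4 (fun x => x ord0 i * tail_base x).
Proof.
split => [x|x y].
  rewrite normrM [`|tail_base x|]gtr0_norm ?tail_base_gt0//.
  apply: (@le_trans _ _ (enorm x * tail_base x)); last by have := enorm_tail_base x; lra.
  by rewrite ler_wpM2r ?coord_le_enorm// ltW// tail_base_gt0.
rewrite (_ : _ - _ = (x ord0 i - y ord0 i) * tail_base x +
  y ord0 i * (tail_base x - tail_base y)); last by ring.
rewrite (le_trans (ler_normD _ _))// !normrM [`|tail_base x|]gtr0_norm ?tail_base_gt0//.
have h1 : `|x ord0 i - y ord0 i| <= enorm (x - y).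
  by have := coord_le_enorm (x - y) i; rewrite !mxE.
have := tail_base_lip x y; have := coord_le_enorm y i.
have := normr_ge0 (tail_base x - tail_base y); have := tail_base_gt0 x; have := tail_base_le1 x.
have := enorm_ge0 (x - y); have := normr_ge0 (x ord0 i - y ord0 i).
set a := `|tail_base x - _|; set b := `|x ord0 i - _|; set c := `|y ord0 i|.
set D := enorm (x - y); set s := enorm y; set u := tail_base x.
move=> b0 D0 u1 u0 a0 cs lip.
have : b * u <= D * 1 by apply: ler_pM => //; exact: ltW.
have : c * a <= s * a by apply: ler_wpM2r.
nra.
Qed.

End profiles.

Section profile_derivatives.
Context (R : realType) (d : nat).
Local Notation E := 'rV[R]_d.

(** This covers the kink of the bump, where the function is flat but given by
different formulas on the two sides. *)
Lemma is_derive_quadratic (f : R -> R) (a : R) : f a = 0 ->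
  (forall x, `|x - a| <= 1 -> `|f x| <= (x - a) ^+ 2) -> is_derive a 1 f 0.
Proof.
move=> fa0 fle.
have cv : (fun h : R => h^-1 *: (f (h *: 1 + a) - f a)) @ 0^' --> (0 : R).
  apply/cvgrPdist_le => e e0; near=> h.
  have h0 : h != 0 by near: h; exact: nbhs_dnbhs_neq.
  have h1 : `|h| <= Num.min 1 e.
    by near: h; apply: dnbhs0_le; rewrite lt_min ltr01.
  move: h1; rewrite le_min => /andP[h1 he].
  rewrite sub0r normrN fa0 subr0 normrM normfV.
  have := fle (h *: 1 + a); rewrite addrK /= [h *: 1]mulr1 => /(_ h1).
  rewrite -real_normK ?num_real// => fh.
  rewrite ler_pdivrMl ?normr_gt0//; apply: le_trans fh _.
  by rewrite expr2 ler_wpM2l.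
split; first by apply/cvg_ex; exists 0.
exact: cvg_lim cv.
Unshelve. all: by end_near. Qed.

Lemma is_derive_bump n (s : R) :
  is_derive s 1 (fun t : R => Num.max (1 - t) 0 ^+ n.+2)
    (- (n.+2%:R * Num.max (1 - s) 0 ^+ n.+1)).
Proof.
have dpoly (t : R) : is_derive t 1 (fun t : R => (1 - t) ^+ n.+2) (- (n.+2%:R * (1 - t) ^+ n.+1)).
  have d1 : is_derive t 1 (fun t : R => 1 - t) (- 1).
    have := is_deriveB (is_derive_cst (1 : R) t 1) (is_derive_id t 1).
    by rewrite sub0r.
  have := @is_deriveX _ _ _ n.+2 _ _ _ d1.
  rewrite (_ : _ *: _ = - (n.+2%:R * (1 - t) ^+ n.+1)); last by rewrite scalerN [_ *: _]mulr1.
  by rewrite (_ : _ ^+ n.+2 = fun t : R => (1 - t) ^+ n.+2)// exprfctE.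
have [s1|s1|->] := ltgtP s 1.
- rewrite [X in - (_ * X ^+ _)](_ : _ = 1 - s); last by apply/max_idPl; lra.
  apply: near_eq_is_derive (dpoly s); near=> t => /=.
  congr (_ ^+ _); apply/esym/max_idPl; rewrite subr_ge0 ltW//.
  by near: t; exact: lt_nbhsl.
- rewrite [X in - (_ * X ^+ _)](_ : _ = 0); last by apply/max_idPr; lra.
  rewrite expr0n mulr0 oppr0; apply: near_eq_is_derive (is_derive_cst (0 : R) s 1); near=> t => /=.
  rewrite (_ : Num.max _ _ = 0) ?expr0n//; apply/max_idPr.
  by rewrite subr_le0 ltW//; near: t; exact: lt_nbhsr.
rewrite subrr [X in - (_ * X ^+ _)](_ : _ = 0); last exact: max_idPr.
rewrite expr0n mulr0 oppr0; apply: is_derive_quadratic.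
  by rewrite subrr maxxx expr0n.
move=> x x1; rewrite normrX -[leRHS]real_normK ?num_real//.
have m1 : `|Num.max (1 - x) 0| <= `|x - 1|.
  rewrite [leLHS]ger0_norm ?le_max ?lexx ?orbT// ge_max normr_ge0 andbT.
  by rewrite distrC ler_norm.
apply: (@le_trans _ _ (`|Num.max (1 - x) 0| ^+ 2)); last by rewrite ler_pXn2r ?nnegrE.
by rewrite -[n.+2]addn2 exprD ler_piMl ?sqr_ge0// exprn_ile1//; apply: le_trans m1 x1.
Unshelve. all: by end_near. Qed.

Lemma has_grad_sqn (x : E) : has_grad (@sqn R d) x (fun i => 2 * x ord0 i).
Proof.
have := has_grad_sum (index_enum 'I_d)
  (fun j => has_gradM (has_grad_coord j x) (has_grad_coord j x)).
move=> h; apply: has_grad_eq h _ => i.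
rewrite (bigD1 i)//= big1 ?addr0 ?eqxx ?mulr1; first by ring.
by move=> j ji; rewrite eq_sym (negbTE ji) mulr0 addr0.
Qed.

(** The fourth power leaves two factors [bump_base] in the second derivatives,
which therefore are Lipschitz and vanish outside the unit ball. *)
Definition bump (x : E) : R := bump_base x ^+ 4.
Definition bump_grad i (x : E) : R := - 8 * bump_base x ^+ 2 * (x ord0 i * bump_base x).
Definition bump_hess i j (x : E) : R :=
  48 * ((x ord0 i * bump_base x) * (x ord0 j * bump_base x)) -
  8 * (i == j)%:R * bump_base x ^+ 3.

Lemma has_grad_bump_base n (x : E) :
  has_grad (fun y => bump_base y ^+ n.+2) x
    (fun i => - (n.+2%:R * bump_base x ^+ n.+1) * (2 * x ord0 i)).
Proof. exact: has_grad_comp (is_derive_bump n (sqn x)) (has_grad_sqn x). Qed.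

Lemma has_grad_bump (x : E) : has_grad bump x (bump_grad ^~ x).
Proof.
apply: has_grad_eq (has_grad_bump_base 2 x) _ => i; rewrite /bump_grad.
by ring.
Qed.

Lemma has_grad_bump_grad i (x : E) : has_grad (bump_grad i) x (bump_hess i ^~ x).
Proof.
rewrite (_ : bump_grad i = fun y => - 8 * (y ord0 i * bump_base y ^+ 3)); last first.
  by apply/funext => y; rewrite /bump_grad; ring.
apply: has_grad_eq (has_gradZ _ (has_gradM (has_grad_coord i x) (has_grad_bump_base 1 x))) _ => j.
by rewrite /bump_hess eq_sym; ring.
Qed.

Lemma bump_ge0 x : 0 <= bump x. Proof. by rewrite exprn_ge0// bump_base_ge0. Qed.

Lemma blip_bump : blip 1 8 bump.
Proof. by apply: blipW (blipX 4 (@blip_bump_base R d)) _ _ => //; lra. Qed.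

Lemma blip_bump_grad i : blip 8 56 (bump_grad i).
Proof.
have := blipM (blipZ (- 8) (blipX 2 (@blip_bump_base R d))) (@blip_bump_coord R d i).
rewrite normrN ger0_norm// => h; apply: blipW h _ _; lra.
Qed.

Lemma blip_bump_hess i j : blip 56 336 (bump_hess i j).
Proof.
have h1 := blipZ 48 (blipM (@blip_bump_coord R d i) (@blip_bump_coord R d j)).
have h2 := blipZ (- (8 * (i == j)%:R)) (blipX 3 (@blip_bump_base R d)).
rewrite (_ : bump_hess i j = fun x => 48 * ((x ord0 i * bump_base x) *
  (x ord0 j * bump_base x)) + - (8 * (i == j)%:R) * bump_base x ^+ 3); last first.
  by apply/funext => x; rewrite /bump_hess; ring.
have n8 : `|- (8 * (i == j)%:R)| <= 8 :> R.
  by rewrite normrN normrM !ger0_norm//; case: (i == j); rewrite ?mulr0 ?mulr1.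
by apply: blipW (blipD h1 h2) _ _; rewrite [`|48|]ger0_norm//; lra.
Qed.

Lemma bump_out (x : E) : 1 <= enorm x ->
  [/\ bump x = 0, forall i, bump_grad i x = 0 & forall i j, bump_hess i j x = 0].
Proof.
move=> x1; rewrite /bump /bump_grad /bump_hess (bump_base0 x1).
by split => [|i|i j]; rewrite ?expr0n ?mulr0 ?mul0r ?subrr.
Qed.

Section tail.
Variable k : nat.

(** A power of (1 + |x|^2)^-1 has derivatives bounded by multiples of itself,
which is what a bound relative to the density requires. *)
Definition tail (x : E) : R := tail_base x ^+ k.+1.
Definition tail_grad i (x : E) : R :=
  - (2 * k.+1%:R) * (x ord0 i * tail_base x) * tail x.
Definition tail_hess i j (x : E) : R :=
  (4 * k.+1%:R * k.+2%:R * ((x ord0 i * tail_base x) * (x ord0 j * tail_base x)) -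
   2 * k.+1%:R * (i == j)%:R * tail_base x) * tail x.

Lemma has_grad_tail_base n (x : E) :
  has_grad (fun y => tail_base y ^+ n.+1) x
    (fun i => - (n.+1%:R * tail_base x ^+ n.+2) * (2 * x ord0 i)).
Proof.
have s0 : 1 + sqn x != 0 by rewrite gt_eqF//; have := sqn_ge0 x; lra.
have d1 : is_derive (sqn x) 1 (fun t : R => 1 + t) 1.
  have := is_deriveD (is_derive_cst (1 : R) (sqn x) 1) (is_derive_id (sqn x) 1).
  by rewrite add0r.
have d2 := is_deriveV s0 d1.
have g2 : has_grad (@tail_base R d) x (fun i => - tail_base x ^+ 2 * (2 * x ord0 i)).
  apply: has_grad_eq (has_grad_comp d2 (has_grad_sqn x)) _ => i.
  by rewrite [_ *: 1]mulr1 /tail_base exprVn.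
have d3 : is_derive (tail_base x) 1 (fun t : R => t ^+ n.+1) (n.+1%:R * tail_base x ^+ n).
  have := @is_deriveX _ _ (@id R) n.+1 _ _ _ (is_derive_id (tail_base x) 1).
  by rewrite exprfctE /= [_ *: 1]mulr1.
apply: has_grad_eq (has_grad_comp d3 g2) _ => i.
by rewrite !exprS expr0; ring.
Qed.

Lemma has_grad_tail (x : E) : has_grad tail x (tail_grad ^~ x).
Proof.
apply: has_grad_eq (has_grad_tail_base k x) _ => i.
by rewrite /tail_grad /tail exprS; ring.
Qed.

Lemma has_grad_tail_grad i (x : E) : has_grad (tail_grad i) x (tail_hess i ^~ x).
Proof.
rewrite (_ : tail_grad i = fun y => - (2 * k.+1%:R) * (y ord0 i * tail_base y ^+ k.+2)); last first.
  by apply/funext => y; rewrite /tail_grad /tail [in RHS]exprS; ring.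
apply: has_grad_eq (has_gradZ _ (has_gradM (has_grad_coord i x) (has_grad_tail_base k.+1 x))) _ => j.
by rewrite /tail_hess /tail eq_sym !(exprS _ k.+1, exprS _ k.+2) -!natr1; ring.
Qed.

Lemma tail_gt0 x : 0 < tail x. Proof. by rewrite exprn_gt0// tail_base_gt0. Qed.

Lemma tail_le1 x : tail x <= 1.
Proof. by rewrite exprn_ile1 ?tail_base_le1// ltW// tail_base_gt0. Qed.

Lemma blip_tail : blip 1 (k.+1%:R * 3) tail.
Proof. exact: blipX (@blip_tail_base R d). Qed.

Lemma blip_tail_grad i : blip (2 * k.+1%:R) (2 * k.+1%:R * (4 + k.+1%:R * 3)) (tail_grad i).
Proof.
have h := blipM (blipZ (- (2 * k.+1%:R)) (@blip_tail_coord R d i)) blip_tail.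
have k0 : 0 <= 2 * k.+1%:R :> R by rewrite mulr_ge0.
by apply: blipW h _ _; rewrite normrN ger0_norm//; lra.
Qed.

Lemma tail_grad_bound i x : `|tail_grad i x| <= 2 * k.+1%:R * tail x.
Proof.
rewrite normrM [X in _ * X](gtr0_norm (tail_gt0 x)); apply: ler_wpM2r (ltW (tail_gt0 x)) _ _ _.
rewrite normrM normrN [`|2 * _|]ger0_norm ?mulr_ge0// ler_piMr ?mulr_ge0//.
exact: (@blip_tail_coord R d i).1.
Qed.

Lemma tail_hess_bound i j x :
  `|tail_hess i j x| <= (4 * k.+1%:R * k.+2%:R + 2 * k.+1%:R) * tail x.
Proof.
rewrite normrM [X in _ * X](gtr0_norm (tail_gt0 x)); apply: ler_wpM2r (ltW (tail_gt0 x)) _ _ _.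
rewrite (le_trans (ler_normB _ _))// lerD//.
  rewrite normrM [`|4 * _ * _|]ger0_norm ?mulr_ge0// ler_piMr ?mulr_ge0// normrM mulr_ile1//;
  exact: (@blip_tail_coord R d _).1.
rewrite -mulrA normrM [`|2 * _|]ger0_norm ?mulr_ge0// ler_piMr ?mulr_ge0//.
rewrite normrM mulr_ile1 ?(@blip_tail_base R d).1//.
by case: (i == j); rewrite ?normr0 ?normr1.
Qed.

(** The gradient of the logarithm of [tail] is at most k + 1 in norm; here this
is obtained from Bernoulli's inequality instead of an exponential. *)
Lemma tail_harnack x y : 4 * k.+1%:R * enorm (x - y) <= 1 -> tail x <= 2 * tail y.
Proof.
move=> xy; have k1 : 1 <= k.+1%:R :> R by rewrite ler1n.
have e0 := enorm_ge0 (x - y); have ex := enorm_ge0 x.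
have l1 := enorm_lip y x; rewrite enormB in l1.
pose c : R := (2 * k.+1%:R)^-1.
have c0 : 0 < c by rewrite invr_gt0 mulr_gt0.
have c1 : c <= 1 by rewrite invf_le1 ?mulr_gt0//; lra.
have ck : c * (2 * k.+1%:R) = 1 by rewrite mulVf// gt_eqF// mulr_gt0.
have D4 : enorm (x - y) <= c / 2.
  rewrite -(@ler_pM2l _ (4 * k.+1%:R)); last lra.
  by rewrite (_ : 4 * _ * (c / 2) = c * (2 * k.+1%:R)) ?ck//; lra.
have ub : (1 - c) * tail_base x <= tail_base y.
  rewrite /tail_base -!enorm_sqr.
  have sx := sqr_ge0 (enorm x); have sy := sqr_ge0 (enorm y).
  rewrite -[leRHS]mul1r ler_pdivlMr; last lra.
  rewrite mulrAC ler_pdivrMr; last lra.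
  have hy : enorm y <= enorm x + c / 2 by move: l1; rewrite ler_norml; lra.
  have hy2 : enorm y ^+ 2 <= (enorm x + c / 2) ^+ 2.
    by rewrite ler_pXn2r ?nnegrE ?enorm_ge0//; lra.
  have hx1 : 2 * enorm x <= 1 + enorm x ^+ 2.
    by have := sqr_ge0 (enorm x - 1); rewrite !expr2; lra.
  move: hy2 hx1 sx sy; rewrite !expr2; nra.
have pk : (1 - c) ^+ k.+1 * tail x <= tail y.
  rewrite /tail -exprMn ler_pXn2r ?nnegrE// ?mulr_ge0 ?subr_ge0// ltW// tail_base_gt0//.
have bern : 1 / 2 <= (1 - c) ^+ k.+1.
  apply: le_trans (bernoulli_ineq k.+1 _); last by rewrite ltW.
  by lra.
have := ler_wpM2r (ltW (tail_gt0 x)) bern; lra.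
Qed.

End tail.

End profile_derivatives.

(** * Distance to the integers *)

Section zigzag.
Context (R : realType).
Implicit Types (s t : R).

Definition dist_int t : R :=
  Num.min (t - (Num.floor t)%:~R) (1 - (t - (Num.floor t)%:~R)).

(** Near each of its zeros k + 1/4 and k + 3/4 this is an affine function of
slope 1 or -1, so that the set where it vanishes is spread over the whole line
while the slope stays away from 0. *)
Definition zigzag t : R := dist_int t - 1 / 4.

Lemma dist_int_le t (m : int) : dist_int t <= `|t - m%:~R|.
Proof.
have /andP[f1 f2] := floor_itv t; rewrite intrD in f2.
rewrite /dist_int ge_min; have [mf|fm] := leP m (Num.floor t).
  have : (m%:~R : R) <= (Num.floor t)%:~R by rewrite ler_int.
  by move=> mf'; rewrite ger0_norm; [apply/orP; left; lra|lra].
have : ((Num.floor t + 1)%:~R : R) <= m%:~R by rewrite ler_int lezD1.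
rewrite intrD => mf'; rewrite ler0_norm; [apply/orP; right; lra|lra].
Qed.

Lemma dist_int_attained t : exists m : int, dist_int t = `|t - m%:~R|.
Proof.
have /andP[f1 f2] := floor_itv t; rewrite intrD in f2.
rewrite /dist_int; case: leP => _; first by exists (Num.floor t); rewrite ger0_norm//; lra.
by exists (Num.floor t + 1); rewrite intrD ler0_norm; lra.
Qed.

Lemma zigzag_lipschitz s t : `|zigzag s - zigzag t| <= `|s - t|.
Proof.
have one x y : zigzag x - zigzag y <= `|x - y|.
  have [m ym] := dist_int_attained y; have xm := dist_int_le x m.
  have := ler_normD (x - y) (y - m%:~R); rewrite addrA subrK /zigzag; lra.
by rewrite ler_norml; have := one s t; have := one t s; rewrite (distrC t s); lra.
Qed.

Lemma zigzag_piece t : exists c sg : R, [/\ sg = 1 \/ sg = -1, `|t - c| <= 1 / 4 &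
  forall s, `|s - c| <= 1 / 4 -> zigzag s = sg * (s - c)].
Proof.
have /andP[f1 f2] := floor_itv t; rewrite intrD in f2.
set k : R := (Num.floor t)%:~R in f1 f2.
have val s : k <= s < k + 1 -> dist_int s = Num.min (s - k) (1 - (s - k)).
  move=> ks; rewrite /dist_int (_ : Num.floor s = Num.floor t)//.
  by apply: floor_def; rewrite intrD.
have [tk|tk] := leP (t - k) (1 / 2).
  exists (k + 1 / 4), 1; split; [by left|by rewrite ler_norml; lra|move=> s].
  rewrite ler_norml => sk; rewrite /zigzag val; last lra.
  by rewrite min_l; lra.
exists (k + 3 / 4), (-1); split; [by right|by rewrite ler_norml; lra|move=> s].
rewrite ler_norml => sk; rewrite /zigzag.
have [sk1|sk1] := ltP s (k + 1); first by rewrite val ?min_r; lra.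
have se : s = k + 1 by lra.
have -> : dist_int s = 0; last by rewrite se; lra.
have fs : Num.floor s = Num.floor t + 1.
  by apply: floor_def; rewrite !intrD -/k se; lra.
by rewrite /dist_int fs intrD -/k se subrr subr0 min_l.
Qed.

Lemma zigzag_bound t : `|zigzag t| <= 1 / 4.
Proof.
have [c [sg [sg1 tc zE]]] := zigzag_piece t; rewrite zE// normrM.
by case: sg1 => ->; rewrite ?normrN normr1; lra.
Qed.

Lemma zigzag_affine t : `|zigzag t| < 1 / 4 ->
  exists c sg : R, (sg = 1 \/ sg = -1) /\ (\forall s \near t, zigzag s = sg * (s - c)).
Proof.
have [c [sg [sg1 tc zE]]] := zigzag_piece t; rewrite zE// normrM => lt4.
have {}lt4 : `|t - c| < 1 / 4 by case: sg1 lt4 => ->; rewrite ?normrN normr1; lra.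
exists c, sg; split => //; near=> s; apply: zE; apply: ltW.
apply: (@le_lt_trans _ _ (`|s - t| + `|t - c|)).
  by rewrite (le_trans _ (ler_normD _ _))// addrA subrK.
rewrite -ltrBrDr distrC; near: s.
by apply: cvgr_dist_lt; [exact: cvg_id|lra].
Unshelve. all: by end_near. Qed.

(** The marginal density has its bulk where |t| <= 1/8, and there the regression
function must stay away from 1/2. *)
Lemma zigzag0 t : `|t| <= 1 / 8 -> zigzag t <= - 1 / 8.
Proof.
by move=> t8; have := dist_int_le t 0; rewrite subr0 /zigzag; lra.
Qed.

Lemma zigzag_nat (k : nat) t : `|t - (k%:R + 1 / 4)| <= 1 / 4 ->
  zigzag t = t - (k%:R + 1 / 4).
Proof.
rewrite ler_norml => tk; have kE : (k%:R : R) = (k%:Z)%:~R by [].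
rewrite /zigzag /dist_int (@floor_def _ _ k%:Z); last by rewrite intrD -kE; lra.
by rewrite -kE min_l; lra.
Qed.

End zigzag.

(** * The two components of the marginal density *)

Section ball_mass.
Context (R : realType) (d : nat).
Hypothesis d0 : (0 < d)%N.
Local Notation E := 'rV[R]_d.
Local Notation leb := (lebesgue_rV R d).
Implicit Types (x y c : E) (r : R) (f : E -> R).

(** A ball of half the radius on which f loses at most a factor 2 already
carries the mass; the volume of a ball is bounded below by that of a cube. *)
Lemma ball_mass f x c r : measurable_fun setT f -> (forall y, 0 <= f y) -> 0 < r ->
  (forall y, eball c (r / 2) y -> eball x r y /\ f x / 2 <= f y) ->
  (((r / 2 / d%:R) ^+ d * (f x / 2))%:E <= \int[leb]_(y in eball x r) (f y)%:E)%E.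
Proof.
move=> mf f0 r0 H.
have mb (z : E) s : measurable (eball z s) by exact: measurable_eball.
apply: (@le_trans _ _ (\int[leb]_(y in eball c (r / 2)) (f y)%:E)%E); last first.
  apply: ge0_subset_integral => //.
  - by apply/measurable_EFinP/measurable_funTS.
  - by move=> y _; rewrite lee_fin.
  - by move=> y cy; have [] := H y cy.
apply: (@le_trans _ _ (\int[leb]_(y in eball c (r / 2)) (f x / 2)%:E)%E).
  rewrite integral_cst// EFinM muleC lee_wpmul2l// ?lee_fin ?divr_ge0//.
  by apply: lebesgue_eball_ge => //; rewrite divr_gt0.
apply: ge0_le_integral => //.
- by move=> y _; rewrite lee_fin divr_ge0.
- by apply/measurable_EFinP/measurable_funTS.
- by move=> y cy; rewrite lee_fin; have [] := H y cy.
Qed.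

Lemma bump_base_mono x y : enorm y <= enorm x -> bump_base x <= bump_base y.
Proof.
move=> yx; have [x1|x1] := leP 1 (enorm x); first by rewrite bump_base0// bump_base_ge0.
rewrite (bump_baseE (ltW x1)) bump_baseE; last exact: ltW (le_lt_trans yx x1).
by have := enorm_ge0 y; rewrite !expr2; nra.
Qed.

(** Supported in the ball of radius 1/8, hence at a distance from the decision
boundary, whose points have first coordinates close to k + 1/4 or k + 3/4. *)
Definition bulk x : R := bump (8 *: x).

Lemma bulk_ge0 x : 0 <= bulk x. Proof. exact: bump_ge0. Qed.

Lemma bulk_le1 x : bulk x <= 1.
Proof. by have := (@blip_bump R d).1 (8 *: x); rewrite ger0_norm ?bump_ge0. Qed.

Lemma bulk_half y : enorm y <= 1 / 32 -> 1 / 2 <= bulk y.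
Proof.
move=> y32; have e0 := enorm_ge0 y.
have e8 : enorm (8 *: y) = 8 * enorm y by rewrite enormZ ger0_norm.
have b0 : 15 / 16 <= bump_base (8 *: y).
  by rewrite bump_baseE e8; [rewrite expr2; nra|lra].
apply: (@le_trans _ _ ((15 / 16) ^+ 4)); first by lra.
by rewrite /bulk /bump ler_pXn2r ?nnegrE ?bump_base_ge0//; lra.
Qed.

(** The bump decreases radially, so shifting a ball of half the radius towards
the origin keeps its values above that at x, even where [bulk x] is arbitrarily
small. Close to the origin there is no room for this shift, but there the bump
is at least half of its maximum. *)
Lemma bulk_center x r : 0 < r <= 1 / 32 ->
  exists c, forall y, eball c (r / 2) y -> eball x r y /\ bulk x / 2 <= bulk y.
Proof.
move=> r32; have e0 := enorm_ge0 x.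
have [rx|xr] := leP r (enorm x).
  have x0 : 0 < enorm x by lra.
  exists ((1 - r / (2 * enorm x)) *: x) => y; set c := _ *: x; rewrite /eball /= => cy.
  have xc : enorm (x - c) = r / 2.
    rewrite /c -[in X in X - _](scale1r x) -scalerBl enormZ (_ : 1 - (1 - _) = r / (2 * enorm x)); last by ring.
    by rewrite ger0_norm ?divr_ge0 ?mulr_ge0//; [field; rewrite gt_eqF|lra].
  have ec : enorm c = enorm x - r / 2.
    rewrite /c enormZ ger0_norm; first by field; rewrite gt_eqF.
    by rewrite subr_ge0 ler_pdivrMr ?mulr_gt0//; lra.
  split; first by apply: le_lt_trans (enorm_triangle c _ _) _; lra.
  have yx : enorm y <= enorm x.
    have := enormD (y - c) c; rewrite subrK enormB; lra.
  have : bulk x <= bulk y.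
    rewrite /bulk /bump ler_pXn2r ?nnegrE ?bump_base_ge0// bump_base_mono//.
    by rewrite !enormZ ler_wpM2l.
  by have := bulk_ge0 x; lra.
exists (2^-1 *: x) => y; rewrite /eball /= => cy.
have xc : enorm (x - 2^-1 *: x) = enorm x / 2.
  by rewrite (_ : x - _ = 2^-1 *: x) ?enormZ ?ger0_norm// 1?mulrC// -[in X in X - _](scale1r x) -scalerBl; congr (_ *: _); lra.
have ec : enorm (2^-1 *: x) = enorm x / 2 by rewrite enormZ ger0_norm// mulrC.
split; first by apply: le_lt_trans (enorm_triangle (2^-1 *: x) _ _) _; lra.
have y32 : enorm y <= 1 / 32.
  have := enormD (y - 2^-1 *: x) (2^-1 *: x); rewrite subrK enormB; lra.
by have := bulk_half y32; have := bulk_le1 x; lra.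
Qed.

Lemma sqnZ (a : R) x : sqn (a *: x) = a ^+ 2 * sqn x.
Proof. by rewrite mulr_sumr; apply: eq_bigr => i _; rewrite mxE exprMn. Qed.

Lemma measurable_bump_scaled (a : R) c :
  measurable_fun setT (fun x : E => bump (a *: (x - c))).
Proof.
apply: measurable_funX; apply: measurable_maxr => //; apply: measurable_funB => //.
under eq_fun do rewrite sqnZ.
by apply: measurable_funM => //; exact: measurable_sqn.
Qed.

Lemma measurable_bulk : measurable_fun setT bulk.
Proof. by have := measurable_bump_scaled 8 0; under eq_fun do rewrite subr0. Qed.

Lemma bulk_out x : 1 / 8 <= enorm x -> bulk x = 0.
Proof.
by move=> x8; have [] := @bump_out R d (8 *: x) _; rewrite ?enormZ ?ger0_norm//; lra.
Qed.

Definition bulk_mass : R := fine (\int[leb]_x (bulk x)%:E)%E.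

Lemma integral_bulk_le : (\int[leb]_x (bulk x)%:E <= ((2 * (1 / 8)) ^+ d)%:E)%E.
Proof.
apply: le_trans (lebesgue_eball_le (0 : E) (_ : 0 <= 1 / 8)); last by lra.
have mb : measurable (eball (0 : E) (1 / 8)) by exact: measurable_eball.
rewrite -[leRHS]mul1e -integral_cst// [leRHS]integral_mkcond; apply: ge0_le_integral => //.
- by move=> x _; rewrite lee_fin bulk_ge0.
- by apply/measurable_EFinP; exact: measurable_bulk.
- by apply/(measurable_restrictT _ _).1 => //; exact: measurable_cst.
move=> x _; rewrite patchE; case: ifPn => [_|/negP xb]; rewrite lee_fin ?bulk_le1//.
rewrite bulk_out// leNgt; apply/negP => x8; apply: xb; apply/mem_set.
by rewrite /eball /= sub0r enormN.
Qed.

Lemma integral_bulk_fin : (\int[leb]_x (bulk x)%:E)%E \is a fin_num.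
Proof.
rewrite ge0_fin_numE; last by apply: integral_ge0 => x _; rewrite lee_fin bulk_ge0.
exact: le_lt_trans integral_bulk_le (ltry _).
Qed.

Lemma bulk_mass_gt0 : 0 < bulk_mass.
Proof.
have h32 : 0 < (1 / 32 : R) <= 1 / 32 by rewrite lexx divr_gt0.
have [c H] := bulk_center (0 : E) h32.
have [h0 _] := andP h32.
have := ball_mass measurable_bulk bulk_ge0 h0 H.
set q := _ * _ => lb.
have q0 : 0 < q.
  rewrite mulr_gt0 ?exprn_gt0 ?divr_gt0// ?ltr0n//.
  by have := @bulk_half 0; rewrite enorm0; lra.
rewrite -lte_fin fineK ?integral_bulk_fin//; apply: (@lt_le_trans _ _ q%:E); first by rewrite lte_fin.
apply: le_trans lb _; apply: ge0_subset_integral => //; first exact: measurable_eball.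
- by apply/measurable_EFinP; exact: measurable_bulk.
- by move=> x _; rewrite lee_fin bulk_ge0.
Qed.

Section wide_tail.
Variables (rho L : R).
Hypotheses (rho0 : 0 < rho) (L1 : 1 <= L).

Let m := (Num.truncn rho).+1.

(** Of the k + 1 factors of the tail, d make it integrable over R^d and the
remaining ones, which exceed rho in number, absorb |x|^rho. *)
Definition tail_exponent := (d + m).-1.

Lemma tail_exponentS : tail_exponent.+1 = (d + m)%N.
Proof. by rewrite /tail_exponent prednK// addnS. Qed.

Definition wide x : R := tail tail_exponent (L^-1 *: x).

Lemma wide_gt0 x : 0 < wide x. Proof. exact: tail_gt0. Qed.

Lemma wide_le1 x : wide x <= 1. Proof. exact: tail_le1. Qed.

Lemma measurable_tail_base_scaled (a : R) : measurable_fun setT (fun x : E => tail_base (a *: x)).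
Proof.
rewrite (_ : (fun _ => _) = (fun x => (oneDsqr (a * enorm x))^-1)).
  apply: (@measurableT_comp _ _ _ _ _ _ (fun t : R => (oneDsqr t)^-1)).
    by apply: continuous_measurable_fun; exact: continuous_oneDsqrV.
  by apply: measurable_funM => //; exact: measurable_enorm.
by apply/funext => x; rewrite /tail_base sqnZ /oneDsqr exprMn enorm_sqr.
Qed.

Lemma measurable_wide : measurable_fun setT wide.
Proof. by apply: measurable_funX; exact: measurable_tail_base_scaled. Qed.

Let L0 : 0 < L. Proof. by rewrite (lt_le_trans _ L1). Qed.

(** A product of one-dimensional Cauchy kernels dominates the tail and has an
explicit integral. *)
Let kernel (x : E) : R := \prod_i (1 + (x ord0 i / L) ^+ 2)^-1.

Let kernel_ge0 x : 0 <= kernel x.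
Proof. by apply: prodr_ge0 => i _; rewrite invr_ge0 addr_ge0// sqr_ge0. Qed.

Let mkernel1 : measurable_fun setT (fun t : R => (1 + (t / L) ^+ 2)^-1).
Proof.
rewrite -[X in measurable_fun _ X]/((fun t : R => (oneDsqr t)^-1) \o (fun t => t / L)).
apply: measurableT_comp.
  by apply: continuous_measurable_fun; exact: continuous_oneDsqrV.
exact: measurable_funM.
Qed.

Let mkernel : measurable_fun setT kernel.
Proof.
apply: measurable_prod => i _.
rewrite -[X in measurable_fun _ X]/((fun t : R => (1 + (t / L) ^+ 2)^-1) \o @rV_coord R d i).
apply: measurableT_comp; [exact: mkernel1|exact: measurable_rV_coord].
Qed.

Let integral_kernel : (\int[leb]_x (kernel x)%:E = ((pi * L) ^+ d)%:E)%E.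
Proof.
rewrite (@integral_prod_rV _ _ (fun=> fun t => (1 + (t / L) ^+ 2)^-1))//; last first.
  by move=> _ t; rewrite invr_ge0 addr_ge0// sqr_ge0.
under eq_bigr do rewrite integral_cauchy_kernel//.
by rewrite prodEFin prodr_const card_ord.
Qed.

Let tail_base_kernel x : tail_base (L^-1 *: x) ^+ d <= kernel x.
Proof.
rewrite (_ : _ ^+ d = \prod_(i < d) tail_base (L^-1 *: x)); last by rewrite prodr_const card_ord.
apply: ler_prod => i _; rewrite (ltW (tail_base_gt0 _))/=.
rewrite /tail_base lef_pV2 ?posrE ?ltr_pwDl ?sqr_ge0 ?sqn_ge0//.
by rewrite lerD2l; have := sqn_coord (L^-1 *: x) i; rewrite mxE mulrC.
Qed.

Lemma integral_wide_le : (\int[leb]_x (wide x)%:E <= ((pi * L) ^+ d)%:E)%E.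
Proof.
rewrite -integral_kernel; apply: ge0_le_integral => //.
- by move=> x _; rewrite lee_fin ltW// wide_gt0.
- by apply/measurable_EFinP; exact: measurable_wide.
- exact/measurable_EFinP.
move=> x _; rewrite lee_fin; apply: le_trans (tail_base_kernel x).
rewrite /wide /tail tail_exponentS exprD ler_piMr ?exprn_ge0 ?exprn_ile1 ?tail_base_le1//;
by rewrite ltW ?tail_base_gt0.
Qed.

Definition wide_mass : R := fine (\int[leb]_x (wide x)%:E)%E.

Lemma integral_wide_fin : (\int[leb]_x (wide x)%:E)%E \is a fin_num.
Proof.
rewrite ge0_fin_numE; last by apply: integral_ge0 => x _; rewrite lee_fin ltW// wide_gt0.
exact: le_lt_trans integral_wide_le (ltry _).
Qed.

Lemma wide_mass_le : wide_mass <= (pi * L) ^+ d.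
Proof. by rewrite -lee_fin fineK ?integral_wide_fin ?integral_wide_le. Qed.

Lemma wide_mass_ge0 : 0 <= wide_mass.
Proof. by apply: fine_ge0; apply: integral_ge0 => x _; rewrite lee_fin ltW// wide_gt0. Qed.

Lemma wide_moment :
  (\int[leb]_x (enorm x `^ rho * wide x)%:E <= (L `^ rho * (pi * L) ^+ d)%:E)%E.
Proof.
rewrite EFinM -integral_kernel -ge0_integralZl//; last 3 first.
- exact/measurable_EFinP.
- by move=> x _; rewrite lee_fin.
- by rewrite lee_fin powR_ge0.
apply: ge0_le_integral => //.
- by move=> x _; rewrite lee_fin mulr_ge0 ?powR_ge0// ltW// wide_gt0.
- apply/measurable_EFinP; apply: measurable_funM; last exact: measurable_wide.
  by apply: (measurableT_comp (measurable_powR rho)); exact: measurable_enorm.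
- by apply/measurable_EFinP; exact: measurable_funM.
move=> x _; rewrite lee_fin; set y := L^-1 *: x.
have -> : x = L *: y by rewrite scalerA mulfV ?scale1r// gt_eqF.
rewrite enormZ gtr0_norm// powRM ?enorm_ge0 ?(ltW L0)// -mulrA ler_wpM2l ?powR_ge0//.
have -> : kernel (L *: y) = kernel x by rewrite scalerA mulfV ?scale1r// gt_eqF.
have -> : wide (L *: y) = tail_base y ^+ m * tail_base y ^+ d.
  by rewrite /wide /tail tail_exponentS scalerA mulVf ?scale1r ?gt_eqF// exprD mulrC.
have uy := tail_base_gt0 y.
rewrite mulrA; apply: le_trans (_ : 1 * tail_base y ^+ d <= _); last by rewrite mul1r tail_base_kernel.
rewrite ler_wpM2r ?exprn_ge0 ?(ltW uy)//.
rewrite /tail_base exprVn ler_pdivrMr ?exprn_gt0 ?ltr_pwDl ?sqn_ge0// mul1r.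
have s1 : 1 <= 1 + sqn y by rewrite lerDl sqn_ge0.
apply: (@le_trans _ _ ((1 + sqn y) `^ rho)).
  apply: ge0_ler_powR; rewrite ?nnegrE ?enorm_ge0 ?(ltW rho0)//; first lra.
  by rewrite -enorm_sqr; have := sqr_ge0 (enorm y - 1); rewrite !expr2; have := enorm_ge0 y; nra.
rewrite -powR_mulrn; last lra.
by apply: ler_powR => //; rewrite ltW// truncnS_gt.
Qed.

End wide_tail.

End ball_mass.

(** * The marginal distribution *)

Section design_density.
Context (R : realType) (d : nat).
Hypothesis d0 : (0 < d)%N.
Local Notation E := 'rV[R]_d.
Local Notation leb := (lebesgue_rV R d).
Implicit Types (x y c : E) (r : R).

Variables (rho L w : R).
Hypotheses (rho0 : 0 < rho) (L1 : 1 <= L) (w0 : 0 < w).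
Hypothesis w_small : w * (pi * L) ^+ d <= 1 / 2.

Local Notation wd := (@wide R d rho L).
Local Notation wide_mass := (wide_mass d rho L).
Local Notation bulk_mass := (bulk_mass R d).

Definition bulk_weight : R := (1 - w * wide_mass) / bulk_mass.

Lemma bulk_weight_ge0 : 0 <= bulk_weight.
Proof.
rewrite divr_ge0 ?(ltW (bulk_mass_gt0 R d0))// subr_ge0.
have := wide_mass_le d rho L1; have := w_small; have := w0; move=> ? ? ?.
have : w * wide_mass <= w * (pi * L) ^+ d by rewrite ler_pM2l.
by lra.
Qed.

Lemma bulk_weight_le : bulk_weight <= bulk_mass^-1.
Proof.
rewrite /bulk_weight ler_piMl ?invr_ge0 ?(ltW (bulk_mass_gt0 R d0))//.
by rewrite gerBl mulr_ge0 ?(ltW w0)// wide_mass_ge0.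
Qed.

(** The mixture of the bump and the tail, with total mass 1 by the choice of
[bulk_weight]. *)
Definition design x : R := bulk_weight * bulk x + w * wd x.

Lemma design_gt0 x : 0 < design x.
Proof.
by rewrite ltr_pwDr ?mulr_gt0 ?wide_gt0// mulr_ge0 ?bulk_weight_ge0// bulk_ge0.
Qed.

Lemma measurable_design : measurable_fun setT design.
Proof.
by apply: measurable_funD; apply: measurable_funM => //;
  [exact: measurable_bulk|exact: measurable_wide].
Qed.

Lemma integral_design (h : E -> R) (A : set E) : measurable A ->
  measurable_fun setT h -> (forall x, 0 <= h x) ->
  (\int[leb]_(x in A) (h x * design x)%:E =
   bulk_weight%:E * \int[leb]_(x in A) (h x * bulk x)%:E +
   w%:E * \int[leb]_(x in A) (h x * wd x)%:E)%E.
Proof.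
move=> mA mh h0.
have m1 : measurable_fun A (fun x => (h x * bulk x)%:E).
  by apply/measurable_EFinP/measurable_funTS; apply: measurable_funM => //; exact: measurable_bulk.
have m2 : measurable_fun A (fun x => (h x * wd x)%:E).
  by apply/measurable_EFinP/measurable_funTS; apply: measurable_funM => //; exact: measurable_wide.
have p1 x : A x -> (0 <= (h x * bulk x)%:E)%E by rewrite lee_fin mulr_ge0 ?bulk_ge0.
have p2 x : A x -> (0 <= (h x * wd x)%:E)%E by rewrite lee_fin mulr_ge0// (ltW (wide_gt0 _ _ _)).
rewrite -!ge0_integralZl ?lee_fin ?bulk_weight_ge0 ?(ltW w0)//.
rewrite -ge0_integralD//; last 4 first.
- by move=> x Ax; rewrite mule_ge0 ?lee_fin ?bulk_weight_ge0//; exact: p1.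
- exact: measurable_funeM.
- by move=> x Ax; rewrite mule_ge0 ?lee_fin ?(ltW w0)//; exact: p2.
- exact: measurable_funeM.
by apply: eq_integral => x _; rewrite -!EFinM -EFinD /design; congr (_%:E); ring.
Qed.

Let dm : set E -> \bar R :=
  density_measure leb measurable_design (fun x => ltW (design_gt0 x)).

HB.instance Definition _ := Measure.on dm.

Let dm_setT : dm setT = 1%E.
Proof.
transitivity (\int[leb]_x (1 * design x)%:E)%E.
  by apply: eq_integral => x _; rewrite mul1r.
rewrite (@integral_design (fun=> 1) setT)//.
under eq_integral do rewrite mul1r.
under [X in (_ + _ * X)%E]eq_integral do rewrite mul1r.
rewrite -(fineK (integral_bulk_fin _ _)) -(fineK (integral_wide_fin d rho L1)).
rewrite -/bulk_mass -/wide_mass -!EFinM -EFinD; congr (_%:E); rewrite /bulk_weight.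
by field; rewrite gt_eqF// (bulk_mass_gt0 R d0).
Qed.

HB.instance Definition _ := Measure_isProbability.Build _ _ _ dm dm_setT.

Definition design_measure : probability E R := dm.

Lemma design_measureE A : (design_measure A = \int[leb]_(x in A) (design x)%:E)%E.
Proof. by []. Qed.

Lemma integral_design_measure (f : E -> \bar R) : measurable_fun setT f ->
  (forall x, 0 <= f x)%E ->
  (\int[design_measure]_x f x = \int[leb]_x (f x * (design x)%:E))%E.
Proof.
move=> mf f0; apply: ge0_integral_density => //; first exact: measurable_design.
by move=> x; exact: ltW (design_gt0 x).
Qed.

Lemma design_ball x r : 0 < r <= 1 / 32 -> 4 * (tail_exponent d rho).+1%:R * r <= L ->
  (((r / 2 / d%:R) ^+ d * (design x / 2))%:E <= design_measure (eball x r))%E.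
Proof.
move=> r32 rL; have [r0 _] := andP r32.
rewrite design_measureE.
have mb : measurable (eball x r) by exact: measurable_eball.
have -> : (\int[leb]_(y in eball x r) (design y)%:E =
    \int[leb]_(y in eball x r) (1 * design y)%:E)%E.
  by apply: eq_integral => y _; rewrite mul1r.
rewrite (@integral_design (fun=> 1) _ mb)//.
under eq_integral do rewrite mul1r.
under [X in (_ + _ * X)%E]eq_integral do rewrite mul1r.
have [c Hc] := bulk_center x r32.
have b1 := ball_mass d0 (@measurable_bulk R d) (@bulk_ge0 R d) r0 Hc.
have Hw y : eball x (r / 2) y -> eball x r y /\ wd x / 2 <= wd y.
  rewrite /eball /= => xy; split; first by lra.
  have L0 : 0 < L by exact: lt_le_trans ltr01 L1.
  have -> : wd x / 2 <= wd y = (wd x <= 2 * wd y) by rewrite ler_pdivrMr// mulrC.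
  apply: tail_harnack; rewrite -scalerBr enormZ gtr0_norm ?invr_gt0// mulrCA.
  rewrite mulrC ler_pdivrMr// mul1r; apply: le_trans rL.
  by rewrite ler_wpM2l ?mulr_ge0//; lra.
have b2 := ball_mass d0 (@measurable_wide R d rho L) (fun y => ltW (wide_gt0 _ _ y)) r0 Hw.
rewrite (_ : _ * (design x / 2) = bulk_weight * ((r / 2 / d%:R) ^+ d * (bulk x / 2)) +
   w * ((r / 2 / d%:R) ^+ d * (wd x / 2))); last by rewrite /design; ring.
rewrite EFinD !EFinM; apply: leeD; apply: lee_wpmul2l; rewrite -?EFinM//.
  by rewrite lee_fin bulk_weight_ge0.
by rewrite lee_fin ltW.
Qed.

(** The bump lies in the unit ball and contributes at most 1. *)
Lemma design_moment :
  (\int[design_measure]_x (enorm x `^ rho)%:E <= (1 + w * (L `^ rho * (pi * L) ^+ d))%:E)%E.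
Proof.
have mrho : measurable_fun setT (fun x : E => enorm x `^ rho).
  by apply: (measurableT_comp (measurable_powR rho)); exact: measurable_enorm.
rewrite integral_design_measure//; last 2 first.
- exact/measurable_EFinP.
- by move=> x; rewrite lee_fin powR_ge0.
under eq_integral do rewrite -EFinM.
rewrite (integral_design measurableT mrho)// ?EFinD; last by move=> x; exact: powR_ge0.
apply: leeD; last first.
  rewrite EFinM; apply: lee_wpmul2l; first by rewrite lee_fin ltW.
  exact: wide_moment.
apply: (@le_trans _ _ (bulk_weight%:E * \int[leb]_x (bulk x)%:E)%E).
  apply: lee_wpmul2l; first by rewrite lee_fin bulk_weight_ge0.
  apply: ge0_le_integral => //.
  - by move=> x _; rewrite lee_fin mulr_ge0 ?powR_ge0 ?bulk_ge0.
  - by apply/measurable_EFinP; apply: measurable_funM => //; exact: measurable_bulk.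
  - by apply/measurable_EFinP; exact: measurable_bulk.
  move=> x _; rewrite lee_fin; have [x8|x8] := leP (1 / 8) (enorm x).
    by rewrite bulk_out// mulr0.
  have : enorm x `^ rho <= 1 `^ rho.
    by apply: ge0_ler_powR; rewrite ?nnegrE ?enorm_ge0 ?(ltW rho0)//; lra.
  by rewrite powR1 => e1; rewrite ler_piMl ?bulk_ge0.
rewrite -(fineK (integral_bulk_fin _ _)) -/bulk_mass -EFinM lee_fin.
rewrite -ler_pdivlMr ?(bulk_mass_gt0 R d0)// mul1r; exact: bulk_weight_le.
Qed.

End design_density.

(** * Regularity of the marginal density *)

Section regularity_tools.
Context (R : realType) (d : nat).
Local Notation E := 'rV[R]_d.
Implicit Types (x y c : E) (f : E -> R).

Lemma has_grad_affine f (a : R) c x G : has_grad f (a *: (x - c)) G ->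
  has_grad (fun y => f (a *: (y - c))) x (fun i => a * G i).
Proof.
move=> [df fG]; pose h (y : E) := a *: (y - c).
have dh : is_diff x h (fun v => a *: v).
  have d1 : is_diff x (fun y : E => y - c) id.
    have := is_diffB (is_diff_id x) (is_diff_cst c x).
    by rewrite (_ : _ - 0 = id)//; apply/funext => v; rewrite !fctE subr0.
  exact: (is_diffZ a d1).
have dc : differentiable (f \o h) x by apply: differentiable_comp => //; exact: ex_diff.
split => // i; rewrite -fG deriveE// diff_comp//=.
by rewrite diff_val deriveE// linearZ.
Qed.

Lemma has_grad_dilate f (a : R) x G : has_grad f (a *: x) G ->
  has_grad (fun y => f (a *: y)) x (fun i => a * G i).
Proof.
rewrite -[in X in X -> _](subr0 x) => /has_grad_affine.
by under [X in has_grad X]eq_fun do rewrite subr0.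
Qed.

Lemma blip_dilate b l f (a : R) : 0 <= a -> blip b l f -> blip b (a * l) (fun x => f (a *: x)).
Proof.
move=> a0 [fb fl]; split => // x y; rewrite (le_trans (fl _ _))//.
by rewrite -scalerBr enormZ ger0_norm// mulrA (mulrC l).
Qed.

Lemma enorm_le_norm x : enorm x <= d%:R * `|x|.
Proof.
apply: enorm_coord_bound => // i.
rewrite [leRHS]/Num.Def.normr/= mx_normrE.
by apply: (@le_bigmax _ _ _ _ (fun ij : 'I_1 * 'I_d => `|x ij.1 ij.2|) (ord0, i)).
Qed.

Lemma blip_continuous b l f : blip b l f -> continuous f.
Proof.
move=> [_ fl] x; apply/(@cvgrPdist_le _ _ _ _ (nbhs_filter x)) => e e0; near=> y.
rewrite (le_trans (fl x y))//.
have l0 : 0 <= `|l| * d%:R + 1 by rewrite addr_ge0// mulr_ge0.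
apply: (@le_trans _ _ ((`|l| * d%:R + 1) * `|x - y|)).
  have h := enorm_le_norm (x - y); have n0 := normr_ge0 (x - y).
  have := ler_norm l; have := enorm_ge0 (x - y); have := normr_ge0 l; nra.
rewrite mulrC -ler_pdivlMr; last by rewrite ltr_wpDl// mulr_ge0.
near: y; apply/nbhs_ballP; exists (e / (`|l| * d%:R + 1)).
  by rewrite /= divr_gt0// ltr_wpDl// mulr_ge0.
by move=> z; rewrite -ball_normE /= => /ltW.
Unshelve. all: by end_near. Qed.

Lemma continuous_mx m n (M : E -> 'M[R]_(m, n)) x :
  (forall i j, {for x, continuous (fun y => M y i j)}) -> {for x, continuous M}.
Proof.
move=> cM; apply/(@cvgrPdist_le _ _ _ _ (nbhs_filter x)) => e e0; near=> y.
rewrite [leLHS]/Num.Def.normr/= mx_normrE (bigmax_le _ (ltW e0))//= => ij _.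
rewrite !mxE /=; move: ij; near: y; apply: filter_forall => /= ij.
by move/(@cvgrPdist_le _ _ _ _ (nbhs_filter x)) : (cM ij.1 ij.2); apply.
Unshelve. all: by end_near. Qed.

End regularity_tools.

Section design_regularity.
Context (R : realType) (d : nat).
Hypothesis d0 : (0 < d)%N.
Local Notation E := 'rV[R]_d.
Implicit Types (x y : E).

(** For D = |y - x| <= 1 the Lipschitz bounds suffice, because D <= D^q for q in
(0, 1]; for D >= 1 the supremum bounds do. *)
Lemma blip_class_Q (P : probability (observation R d) R) (f : E -> R) (G : 'I_d -> E -> R)
    (T gamma lambda : R) :
  is_density (marginal P) f -> blip T T f -> (forall x, has_grad f x (G ^~ x)) ->
  (forall i, blip T T (G i)) -> 0 < gamma <= 2 -> d%:R * (2 * T) <= lambda ->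
  class_Q gamma lambda P.
Proof.
move=> fP fT fG GT /andP[g0 g2] ll; exists f.
have T0 : 0 <= T by exact: blip_ge0 fT.
have T2 : 0 <= 2 * T by exact: mulr_ge0.
have d1 : 1 <= d%:R :> R by rewrite ler1n.
have lb : 2 * T <= lambda by apply: le_trans ll; rewrite ler_peMl.
have [fb fl] := fT.
have lambda0 : 0 <= lambda by exact: le_trans lb.
have powle (t q : R) : 0 <= t <= 1 -> 0 < q <= 1 -> t <= t `^ q.
  move=> /andP[]; rewrite le_eqVlt => /predU1P[<- _ _|t0 t1 /andP[q0 q1]].
    exact: powR_ge0.
  by apply: ger1_powR => //; rewrite t0.
have powge (t q : R) : 1 <= t -> 0 < q -> 1 <= t `^ q.
  by move=> t1 q0; rewrite -(powRr0 t); apply: ler_powR => //; exact: ltW.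
split=> //.
  by apply: ge_ereal_sup => _ [x _ <-]; rewrite lee_fin; apply: le_trans (fb x) _; lra.
case: ifP => [g1|/negbT]; last first.
  rewrite -ltNge => g1; split => [x|x y]; first by have [] := fG x.
  set D := enorm (y - x); have D0 : 0 <= D by exact: enorm_ge0.
  have gB i : (grad f y - grad f x) ord0 i = G i y - G i x.
    by rewrite (has_grad_grad (fG x)) (has_grad_grad (fG y)) !mxE.
  have [D1|D1] := leP D 1.
    have e1 : enorm (grad f y - grad f x) <= d%:R * (T * D).
      apply: enorm_coord_bound => [|i]; first exact: mulr_ge0.
      by rewrite gB; exact: (GT i).2.
    have e2 : d%:R * T <= lambda.
      by apply: le_trans ll; rewrite ler_wpM2l//; lra.
    have e3 : D <= D `^ (gamma - 1).
      by apply: powle; apply/andP; split; rewrite ?subr_gt0// lerBlDr.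
    by apply: (le_trans e1); rewrite mulrA; apply: ler_pM => //; exact: mulr_ge0.
  have e1 : enorm (grad f y - grad f x) <= d%:R * (2 * T).
    apply: enorm_coord_bound => [//|i].
    rewrite gB; apply: le_trans (ler_normB _ _) _.
    by have := (GT i).1 y; have := (GT i).1 x; lra.
  have p1 : 1 <= D `^ (gamma - 1) by apply: powge; rewrite ?subr_gt0// ltW.
  by apply: le_trans (le_trans e1 ll) _; rewrite ler_peMr.
move=> x y; set D := enorm (y - x); have D0 : 0 <= D by exact: enorm_ge0.
have [D1|D1] := leP D 1.
  have e3 : D <= D `^ gamma by apply: powle; apply/andP.
  by apply: (le_trans (fl y x)); apply: ler_pM => //; lra.
have p1 : 1 <= D `^ gamma by apply: powge => //; exact: ltW.
apply: (@le_trans _ _ lambda); last by rewrite ler_peMr.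
by apply: le_trans (ler_normB _ _) _; have := fb y; have := fb x; lra.
Qed.

Variables (rho L w : R).
Hypotheses (rho0 : 0 < rho) (L1 : 1 <= L) (w0 : 0 < w).
Hypothesis w_small : w * (pi * L) ^+ d <= 1 / 2.

Local Notation k := (tail_exponent d rho).
Local Notation wd := (@wide R d rho L).
Local Notation design := (@design R d rho L w).
Local Notation bulk_weight := (@bulk_weight R d rho L w).

Definition tail_lip : R := 2 * k.+1%:R * (4 + k.+1%:R * 3).

Hypothesis w_lip : w * tail_lip <= 1.

Definition design_grad i x : R :=
  bulk_weight * (8 * bump_grad i (8 *: x)) + w * (L^-1 * tail_grad k i (L^-1 *: x)).

Definition design_hess i j x : R :=
  bulk_weight * (8 * (8 * bump_hess i j (8 *: x))) +
  w * (L^-1 * (L^-1 * tail_hess k i j (L^-1 *: x))).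

Lemma has_grad_design x : has_grad design x (design_grad ^~ x).
Proof.
by apply: has_gradD; apply: has_gradZ; apply: has_grad_dilate;
  [exact: has_grad_bump|exact: has_grad_tail].
Qed.

Lemma has_grad_design_grad i x : has_grad (design_grad i) x (design_hess i ^~ x).
Proof.
apply: has_gradD; apply: has_gradZ; apply: has_gradZ.
  exact: (has_grad_dilate (has_grad_bump_grad i (8 *: x))).
exact: (has_grad_dilate (has_grad_tail_grad k i (L^-1 *: x))).
Qed.

Lemma design_twice : twice_differentiable_on setT design /\
  (forall x, setT x -> hess design x = \matrix_(i, j) design_hess j i x).
Proof.
apply: hess_on; first exact: openT.
- by move=> x _; exact: has_grad_design.
- by move=> x j _; exact: has_grad_design_grad.
Qed.

Lemma continuous_design : continuous design.
Proof. by move=> x; apply: differentiable_continuous; have [] := has_grad_design x. Qed.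

Lemma blip_tail_hess i j : exists b l, blip b l (tail_hess k i j : E -> R).
Proof.
have h1 := blipM (@blip_tail_coord R d i) (@blip_tail_coord R d j).
have h2 := blipD (blipZ (4 * k.+1%:R * k.+2%:R) h1)
  (blipZ (- (2 * k.+1%:R * (i == j)%:R)) (@blip_tail_base R d)).
have h3 := blipM h2 (@blip_tail R d k).
do 2 eexists.
have -> : tail_hess k i j = (fun x : E => (4 * k.+1%:R * k.+2%:R *
  ((x ord0 i * tail_base x) * (x ord0 j * tail_base x)) +
  - (2 * k.+1%:R * (i == j)%:R) * tail_base x) * tail k x); last exact: h3.
by apply/funext => x; rewrite /tail_hess mulNr.
Qed.

Lemma design_C2 A : C2_on A design.
Proof.
have [tw hE] := design_twice; split => [x _|x _]; first exact: tw.
have -> : hess design = (fun y => \matrix_(i, j) design_hess j i y).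
  by apply/funext => y; exact: hE.
apply: continuous_mx => i j.
have [b [l tb]] := blip_tail_hess j i.
have c1 : continuous (fun y => bulk_weight * (8 * (8 * bump_hess j i (8 *: y)))).
  apply: (@blip_continuous _ _ _ _); do 3 apply: blipZ.
  by apply: blip_dilate; [lra|exact: blip_bump_hess].
have c2 : continuous (fun y => w * (L^-1 * (L^-1 * tail_hess k j i (L^-1 *: y)))).
  apply: (@blip_continuous _ _ _ _); do 3 apply: blipZ.
  by apply: blip_dilate tb; rewrite invr_ge0; exact: le_trans ler01 L1.
rewrite (_ : (fun y => _) = (fun y => design_hess j i y)); last first.
  by apply/funext => y; rewrite mxE.
by apply: (@cvgD _ _ _ _ (nbhs_filter x)); [exact: c1|exact: c2].
Qed.

Lemma design_out x : 1 / 8 <= enorm x ->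
  [/\ design x = w * wd x,
      forall i, design_grad i x = w * (L^-1 * tail_grad k i (L^-1 *: x)) &
      forall i j, design_hess i j x = w * (L^-1 * (L^-1 * tail_hess k i j (L^-1 *: x)))].
Proof.
move=> x8; have x1 : 1 <= enorm (8 *: x) by rewrite enormZ ger0_norm//; lra.
have [b0 g0 h0] := bump_out x1.
rewrite /design /bulk b0; split => [|i|i j]; first by rewrite mulr0 add0r.
  by rewrite /design_grad g0 !mulr0 add0r.
by rewrite /design_hess h0 !mulr0 add0r.
Qed.

Local Notation Z := (bulk_mass R d).

(** As w is at most 1 / [tail_lip], the tail adds at most 1 to the bounds on the
bump and its gradient, so that neither rho nor L matters. *)
Definition lambda_star : R := d%:R * (2 * (3584 * Z^-1 + 1)).

Let k1 : 1 <= k.+1%:R :> R. Proof. by rewrite ler1n. Qed.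
Let Li0 : 0 <= L^-1. Proof. by rewrite invr_ge0; exact: le_trans ler01 L1. Qed.
Let Li1 : L^-1 <= 1. Proof. by rewrite invf_le1// (lt_le_trans ltr01 L1). Qed.
Let bw0 : 0 <= bulk_weight. Proof. exact: bulk_weight_ge0. Qed.
Let bwZ : bulk_weight <= Z^-1. Proof. exact: bulk_weight_le. Qed.

Lemma blip_design : blip (Z^-1 + 1) (64 * Z^-1 + 1) design.
Proof.
have h8 : (0 : R) <= 8 by [].
have h1 := blipZ bulk_weight (blip_dilate h8 (@blip_bump R d)).
have h2 := blipZ w (blip_dilate Li0 (@blip_tail R d k)).
have [kk bb bZ] := And3 k1 bw0 bwZ.
have [li0 li1] := (Li0, Li1).
have wt : w * tail_lip <= 1 by exact: w_lip.
have w_0 : 0 <= w by exact: ltW.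
have w1 : w * 1 <= w * tail_lip by apply: ler_wpM2l => //; rewrite /tail_lip; nra.
have w2 : w * (L^-1 * (k.+1%:R * 3)) <= w * tail_lip.
  apply: ler_wpM2l => //; apply: (@le_trans _ _ (1 * (k.+1%:R * 3))).
    by apply: ler_wpM2r => //; lra.
  by rewrite /tail_lip mul1r; nra.
apply: blipW (blipD h1 h2) _ _; rewrite !ger0_norm//; apply: lerD; [lra|lra| |lra].
by nra.
Qed.

Lemma blip_design_grad i : blip (64 * Z^-1 + 1) (3584 * Z^-1 + 1) (design_grad i).
Proof.
have h8 : (0 : R) <= 8 by [].
have h1 := blipZ bulk_weight (blipZ 8 (blip_dilate h8 (@blip_bump_grad R d i))).
have h2 := blipZ w (blipZ L^-1 (blip_dilate Li0 (@blip_tail_grad R d k i))).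
have [kk bb bZ] := And3 k1 bw0 bwZ.
have [li0 li1] := (Li0, Li1).
have wt : w * tail_lip <= 1 by exact: w_lip.
have w_0 : 0 <= w by exact: ltW.
have t0 : 0 <= tail_lip by rewrite /tail_lip; nra.
have t1 : w * (L^-1 * (2 * k.+1%:R)) <= w * tail_lip.
  apply: ler_wpM2l => //; apply: (@le_trans _ _ (1 * (2 * k.+1%:R))).
    by apply: ler_wpM2r => //; lra.
  by rewrite /tail_lip mul1r; nra.
have t2 : w * (L^-1 * (L^-1 * tail_lip)) <= w * (1 * (1 * tail_lip)).
  apply: ler_wpM2l => //; apply: ler_pM => //; [exact: mulr_ge0|exact: ler_wpM2r].
apply: blipW (blipD h1 h2) _ _; rewrite !ger0_norm//; apply: lerD.
- by nra.
- by lra.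
- by nra.
- by rewrite -/tail_lip; lra.
Qed.

Lemma design_class_Q (P : probability (observation R d) R) (gamma lambda : R) :
  (forall A, measurable A -> marginal P A = design_measure d0 rho L1 w0 w_small A) ->
  0 < gamma <= 2 -> lambda_star <= lambda -> class_Q gamma lambda P.
Proof.
move=> PE g02; rewrite /lambda_star => ll.
have Zi0 : 0 <= Z^-1 by rewrite invr_ge0 (ltW (bulk_mass_gt0 R d0)).
have T0 : 0 <= 3584 * Z^-1 + 1 by apply: addr_ge0 ler01; apply: mulr_ge0 Zi0; exact: ler0n.
have TT : 64 * Z^-1 + 1 <= 3584 * Z^-1 + 1 by rewrite lerD2r; apply: ler_wpM2r Zi0 _ _ _; rewrite ler_nat.
have Zle : Z^-1 + 1 <= 64 * Z^-1 + 1 by lra.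
have gb i := blipW (blip_design_grad i) TT (lexx _).
have fb := blipW blip_design (le_trans Zle TT) TT.
move: T0 gb fb ll; set T := 3584 * _ + 1 => T0 gb fb ll.
apply: (blip_class_Q _ fb has_grad_design gb g02 ll).
split; first exact: measurable_design.
  by move=> x; rewrite ltW// design_gt0.
by move=> A mA; rewrite PE.
Qed.

End design_regularity.

(** * The perturbed regression functions *)

Section zigzag_slope.
Context (R : realType).

Definition zigzag_slope (t : R) : R := 'D_1 (@zigzag R) t.

Lemma is_derive_zigzag t : `|zigzag t| < 1 / 4 ->
  [/\ is_derive t 1 (@zigzag R) (zigzag_slope t), zigzag_slope t = 1 \/ zigzag_slope t = -1 &
      is_derive t 1 zigzag_slope 0].
Proof.
move=> /zigzag_affine [c [sg [sg1 aff]]].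
have dlin (u : R) : is_derive u 1 (fun v : R => sg * (v - c)) sg.
  have d1 : is_derive u 1 (fun v : R => v - c) 1.
    have := is_deriveB (is_derive_id u 1) (is_derive_cst c u 1); by rewrite subr0.
  have := @is_deriveZ _ _ _ _ sg _ _ _ d1.
  by rewrite [_ *: 1]mulr1.
have dz (u : R) : (\forall v \near u, zigzag v = sg * (v - c)) -> is_derive u 1 (@zigzag R) sg.
  by move=> nu; apply: near_eq_is_derive (dlin u); near=> v; apply/esym; near: v.
have sE (u : R) : (\forall v \near u, zigzag v = sg * (v - c)) -> zigzag_slope u = sg.
  by move=> nu; rewrite /zigzag_slope; have [] := dz u nu.
split.
- by rewrite (sE t aff); exact: dz.
- by rewrite (sE t aff).
apply: near_eq_is_derive (is_derive_cst sg t 1).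
have := near_join aff; apply: filterS => u nu; exact/esym/sE.
Unshelve. all: by end_near. Qed.

End zigzag_slope.

Section perturbed_regression.
Context (R : realType) (d : nat).
Hypothesis d0 : (0 < d)%N.
Local Notation E := 'rV[R]_d.
Implicit Types (x y : E).
Variables (J : finType) (z : J -> E) (r A : R).
Hypotheses (r0 : 0 < r) (A0 : 0 <= A).
Hypothesis tz : trivIset setT (fun j => eball (z j) r).
Implicit Type s : {ffun J -> bool}.

Let i0 : 'I_d := Ordinal d0.

Definition sign_of (b : bool) : R := if b then 1 else -1.

Lemma norm_sign_of b : `|sign_of b| = 1. Proof. by case: b; rewrite ?normrN normr1. Qed.

Definition local (j : J) x : E := r^-1 *: (x - z j).

Definition pert s x : R := \sum_j sign_of (s j) * (A * bump (local j x)).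
Definition pert_grad s i x : R :=
  \sum_j sign_of (s j) * (A * (r^-1 * bump_grad i (local j x))).
Definition pert_hess s i i' x : R :=
  \sum_j sign_of (s j) * (A * (r^-1 * (r^-1 * bump_hess i i' (local j x)))).

Definition eta_of s x : R := 1 / 2 + zigzag (x ord0 i0) + pert s x.

Lemma local_out j x : ~ eball (z j) r x -> 1 <= enorm (local j x).
Proof.
rewrite /eball /= => /negP; rewrite -leNgt enormB => rx.
by rewrite /local enormZ gtr0_norm ?invr_gt0// mulrC ler_pdivlMr// mul1r.
Qed.

Lemma has_grad_pert s x : has_grad (pert s) x (pert_grad s ^~ x).
Proof.
apply: has_grad_sum => j; do 2 apply: has_gradZ.
exact: has_grad_affine (has_grad_bump _).
Qed.

Lemma has_grad_pert_grad s i x : has_grad (pert_grad s i) x (pert_hess s i ^~ x).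
Proof.
apply: has_grad_sum => j; do 3 apply: has_gradZ.
exact: has_grad_affine (has_grad_bump_grad i _).
Qed.

Let Ar0 : 0 <= A * r^-1. Proof. by rewrite mulr_ge0// invr_ge0 ltW. Qed.

Lemma blip_pert_term (f : E -> R) b l c : 0 <= c -> blip b l f -> forall s j,
  blip (c * b) (c * (l / r)) (fun x => sign_of (s j) * (c * f (local j x))).
Proof.
move=> c0 fb s j; have h := blipZ (sign_of (s j)) (blipZ c (blip_scale (z j) r0 fb)).
by apply: blipW h _ _; rewrite norm_sign_of mul1r ger0_norm.
Qed.

Lemma pert_bound s x : `|pert s x| <= A.
Proof.
have [+ _] : blip A (2 * (A * (8 / r))) (pert s); last exact.
apply: (blip_disjoint_sum _ _ _ _ tz) => //.
- by rewrite mulr_ge0// divr_ge0// ltW.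
- by move=> j; have := blip_pert_term A0 (@blip_bump R d) s j; rewrite mulr1.
- by move=> j y /local_out /bump_out[-> _ _]; rewrite !mulr0.
Qed.

Lemma pert_grad_bound s i x : `|pert_grad s i x| <= A * r^-1 * 8.
Proof.
have [+ _] : blip (A * r^-1 * 8) (2 * (A * r^-1 * (56 / r))) (pert_grad s i); last exact.
apply: (blip_disjoint_sum _ _ _ _ tz) => //.
- exact: mulr_ge0.
- by rewrite mulr_ge0// divr_ge0// ltW.
- move=> j; rewrite [X in blip _ _ X](_ : _ = fun x =>
    sign_of (s j) * (A * r^-1 * bump_grad i (local j x))).
    exact: (blip_pert_term Ar0 (@blip_bump_grad R d i)).
  by apply/funext => y; rewrite !mulrA.
- by move=> j y /local_out /bump_out[_ -> _]; rewrite !mulr0.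
Qed.

Lemma blip_pert_hess s i i' :
  blip (A * r^-1 * r^-1 * 56) (2 * (A * r^-1 * r^-1 * (336 / r))) (pert_hess s i i').
Proof.
have Arr0 : 0 <= A * r^-1 * r^-1 by rewrite mulr_ge0// invr_ge0 ltW.
apply: (blip_disjoint_sum _ _ _ _ tz).
- by apply: mulr_ge0 Arr0 _; exact: ler0n.
- by apply: mulr_ge0 Arr0 _; apply: divr_ge0; [exact: ler0n|exact: ltW].
- move=> j; rewrite [X in blip _ _ X](_ : _ = fun x =>
    sign_of (s j) * (A * r^-1 * r^-1 * bump_hess i i' (local j x))).
    exact: (blip_pert_term Arr0 (@blip_bump_hess R d i i')).
  by apply/funext => y; rewrite !mulrA.
- by move=> j y /local_out /bump_out[_ _ ->]; rewrite !mulr0.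
Qed.

Lemma pert_on s j x : eball (z j) r x -> pert s x = sign_of (s j) * (A * bump (local j x)).
Proof.
move=> xj; rewrite /pert (bigD1 j)//= big1 ?addr0// => i ij.
have [|/local_out/bump_out[-> _ _]] := pselect (eball (z i) r x); last by rewrite !mulr0.
by move=> xi; have e : i = j by [apply: tz => //; exists x]; rewrite e eqxx in ij.
Qed.

Lemma continuous_eta s : continuous (eta_of s).
Proof.
move=> x; apply: (@cvgD _ _ _ _ (nbhs_filter x)).
  apply: (@cvgD _ _ _ _ (nbhs_filter x)); first exact: cvg_cst.
  apply/(@cvgrPdist_le _ _ _ _ (nbhs_filter x)) => e e0.
  have cx : {for x, continuous (fun y : E => y ord0 i0)}.
    by apply: differentiable_continuous; have [] := has_grad_coord i0 x.
  move/(@cvgrPdist_le _ _ _ _ (nbhs_filter x)) : cx => /(_ e e0).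
  apply: filterS => y; exact: le_trans (zigzag_lipschitz _ _).
by apply: differentiable_continuous; have [] := has_grad_pert s x.
Qed.

Lemma measurable_eta s : measurable_fun setT (eta_of s).
Proof.
apply: measurable_funD.
  apply: measurable_funD => //.
  apply: (@measurableT_comp _ _ _ _ _ _ (@zigzag R)); last exact: measurable_rV_coord.
  apply: continuous_measurable_fun => t.
  apply/cvgrPdist_le => e e0; near=> u; apply: (le_trans (zigzag_lipschitz _ _)).
  by near: u; move/cvgrPdist_le : (@cvg_id _ (nbhs t)); apply.
apply: measurable_sum => j; apply: measurable_funM => //; apply: measurable_funM => //.
exact: measurable_bump_scaled.
Unshelve. all: by end_near. Qed.

Lemma eta_range s x : A <= 1 / 8 -> 1 / 8 <= eta_of s x <= 7 / 8.
Proof.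
move=> A8; have := pert_bound s x; have := zigzag_bound (x ord0 i0).
by rewrite /eta_of !ler_norml; lra.
Qed.

Definition eta_grad s i x : R := zigzag_slope (x ord0 i0) * (i == i0)%:R + pert_grad s i x.

Let Omega : set E := [set x | `|zigzag (x ord0 i0)| < 1 / 4].

Lemma open_Omega : open Omega.
Proof.
have cz : continuous (fun x : E => `|zigzag (x ord0 i0)|).
  move=> x; apply/(@cvgrPdist_le _ _ _ _ (nbhs_filter x)) => e e0.
  have cx : {for x, continuous (fun y : E => y ord0 i0)}.
    by apply: differentiable_continuous; have [] := has_grad_coord i0 x.
  move/(@cvgrPdist_le _ _ _ _ (nbhs_filter x)) : cx => /(_ e e0).
  apply: filterS => y xy; apply: (le_trans (ler_dist_dist _ _)).
  exact: le_trans (zigzag_lipschitz _ _) xy.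
rewrite (_ : Omega = (fun x : E => `|zigzag (x ord0 i0)|) @^-1` [set t | t < 1 / 4])//.
by apply: open_comp => // x _; exact: cz.
Qed.

Lemma has_grad_eta s x : Omega x -> has_grad (eta_of s) x (eta_grad s ^~ x).
Proof.
move=> Ox; have [dz _ _] := is_derive_zigzag Ox.
apply: has_gradD (has_grad_pert s x).
apply: has_grad_eq (has_gradD (has_grad_cst (1 / 2) x) (has_grad_comp dz (has_grad_coord i0 x))) _ => i.
by rewrite add0r.
Qed.

Lemma has_grad_eta_grad s i x : Omega x -> has_grad (eta_grad s i) x (pert_hess s i ^~ x).
Proof.
move=> Ox; have [_ _ dz] := is_derive_zigzag Ox.
have h1 := has_gradM (has_grad_comp dz (has_grad_coord i0 x)) (has_grad_cst (i == i0)%:R x).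
apply: has_grad_eq (has_gradD h1 (has_grad_pert_grad s i x)) _ => i'.
by rewrite mul0r !mulr0 !add0r.
Qed.

Lemma eta_twice s : twice_differentiable_on Omega (eta_of s) /\
  (forall x, Omega x -> hess (eta_of s) x = \matrix_(i, i') pert_hess s i' i x).
Proof.
apply: hess_on; first exact: open_Omega.
- by move=> x; exact: has_grad_eta.
- by move=> x i; exact: has_grad_eta_grad.
Qed.

(** Let c be the zero of [zigzag] next to x_0. Along the first axis the
unperturbed function is affine on [c - b, c + b] with values 1/2 - b and 1/2 + b
at the ends, up to their order, and the perturbation is smaller than b. *)
Lemma boundary_near s x b : A < b -> b <= 1 / 4 ->
  exists2 y, eta_of s y = 1 / 2 & enorm (x - y) <= `|zigzag (x ord0 i0)| + b.
Proof.
move=> Ab b4; set t := x ord0 i0; have A_0 : 0 <= A by exact: A0.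
have [c [sg [sg1 tc zE]]] := zigzag_piece t.
pose path (u : R) : E := x + (u - t) *: delta_mx ord0 i0.
have path0 u : path u ord0 i0 = u by rewrite !mxE !eqxx mulr1 -/t; ring.
have dpath u v : enorm (path u - path v) = `|u - v|.
  rewrite (_ : path u - path v = (u - v) *: delta_mx ord0 i0).
    rewrite enormZ [X in _ * X](_ : _ = 1) ?mulr1//.
    rewrite /enorm (bigD1 i0)//= big1; first by rewrite mxE !eqxx expr1n addr0 sqrtr1.
    by move=> i ii0; rewrite mxE eqxx (negbTE ii0) expr0n.
  by rewrite /path opprD addrACA subrr add0r -scalerBl; congr (_ *: _); ring.
have cpath : continuous path.
  move=> u; apply: cvgD; first exact: cvg_cst.
  by apply: cvgZr_tmp; apply: cvgB; [exact: cvg_id|exact: cvg_cst].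
pose F u := eta_of s (path u).
have cF : continuous F.
  by move=> u; apply: (@cvg_comp _ _ _ path (eta_of s) _ (nbhs (path u))); [exact: cpath|exact: continuous_eta].
have Fu u : `|u - c| <= 1 / 4 -> `|F u - (1 / 2 + sg * (u - c))| <= A.
  move=> uc; rewrite /F /eta_of path0 zE//.
  by rewrite [X in `|X|](_ : _ = pert s (path u)) ?pert_bound//; ring.
have cb : c - b <= c + b by lra.
have h1 := Fu (c - b) ltac:(rewrite ler_norml; lra).
have h2 := Fu (c + b) ltac:(rewrite ler_norml; lra).
have cF' : {within `[c - b, c + b], continuous F} by exact: continuous_subspaceT.
have mid : Num.min (F (c - b)) (F (c + b)) <= 1 / 2 <= Num.max (F (c - b)) (F (c + b)).
  rewrite ge_min le_max; move: h1 h2; rewrite !ler_norml.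
  by case: sg1 => ->; move=> h1 h2; apply/andP; split; apply/orP; [left|right|right|left]; lra.
have [u uI Fu2] := IVT cb cF' mid.
exists (path u) => //.
have -> : x = path t by rewrite /path subrr scale0r addr0.
rewrite dpath zE// normrM.
have -> : `|sg| = 1 by case: sg1 => ->; rewrite ?normrN normr1.
move: uI; rewrite in_itv /= mul1r => uI.
have : `|u - c| <= b by rewrite ler_norml; lra.
have := ler_normD (t - c) (c - u); rewrite addrA subrK (distrC c u); lra.
Qed.

End perturbed_regression.

(** * Membership in the class of distributions *)

Section label_densities.
Context (R : realType) (d : nat).
Local Notation E := 'rV[R]_d.
Local Notation leb := (lebesgue_rV R d).
Variables (mu : probability E R) (h e : E -> R).
Hypotheses (mh : measurable_fun setT h) (h0 : forall x, 0 < h x).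
Hypothesis muE : forall A, measurable A -> mu A = (\int[leb]_(x in A) (h x)%:E)%E.
Hypotheses (me : measurable_fun setT e) (e01 : forall x, 0 <= e x <= 1).
Hypothesis e_range : forall x, 1 / 8 <= e x <= 7 / 8.

Let P : probability (observation R d) R := label_measure mu me e01.

Lemma label_density_range b x : 1 / 8 <= label_density e b x <= 1.
Proof. by case: b; rewrite /label_density; have := e_range x; lra. Qed.

Lemma label_measureX_density A b : measurable A ->
  (P (A `*` [set b]) = \int[leb]_(x in A) (label_density e b x * h x)%:E)%E.
Proof.
move=> mA; rewrite /P label_measureX// [LHS]integral_mkcond.
have ml := measurable_label_density me b.
have l0 x : 0 <= label_density e b x by have := label_density_range b x; lra.
have h0' x : 0 <= h x by exact: ltW.
rewrite (@ge0_integral_density _ _ _ leb mu h mh h0' muE); last 2 first.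
- apply/(measurable_restrictT _ _).1 => //; apply/measurable_EFinP.
  exact: measurable_funTS.
- by move=> x; apply: erestrict_ge0 => y _; rewrite lee_fin.
rewrite [RHS]integral_mkcond; apply: eq_integral => x _.
by rewrite !patchE; case: ifP => _; rewrite ?mul0e// EFinM.
Qed.

Lemma priorE b : (prior P b)%:E = P (setT `*` [set b]).
Proof.
rewrite /prior (_ : [set z | z.2 = b] = setT `*` [set b]).
  by rewrite fineK// fin_num_measure//; exact: measurableX.
by apply/seteqP; split => -[x y] //= [].
Qed.

Lemma prior_gt0 b : 0 < prior P b.
Proof.
apply: (@lt_le_trans _ _ (1 / 8)); first by lra.
rewrite -lee_fin priorE /P label_measureX//.
apply: (@le_trans _ _ (\int[mu]_(x in setT) (1 / 8)%:E)%E).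
  by rewrite integral_cst// [X in (_ * X)%E]probability_setT mule1.
apply: ge0_le_integral => //.
- by apply/measurable_EFinP; exact: measurable_label_density.
- by move=> x _; rewrite lee_fin; have := label_density_range b x; lra.
Qed.

(** Bayes' formula for the density of X given Y = b. *)
Definition class_density b x : R := label_density e b x * h x / prior P b.

Lemma class_density_ge0 b x : 0 <= class_density b x.
Proof.
rewrite divr_ge0 ?(ltW (prior_gt0 _))// mulr_ge0 ?(ltW (h0 _))//.
by have := label_density_range b x; lra.
Qed.

Lemma measurable_class_density b : measurable_fun setT (class_density b).
Proof.
by apply: measurable_funM => //; apply: measurable_funM => //; exact: measurable_label_density.
Qed.

Lemma class_density_spec b : is_density (class_distribution P b) (class_density b).
Proof.
split; [exact: measurable_class_density|exact: class_density_ge0|move=> A mA].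
have p0 := prior_gt0 b.
rewrite /class_distribution EFinM fineK; last first.
  by apply: fin_num_measure; exact: measurableX.
rewrite label_measureX_density// -ge0_integralZr//; last 3 first.
- apply/measurable_EFinP/measurable_funTS/measurable_funM => //.
  exact: measurable_label_density.
- move=> x _; rewrite lee_fin mulr_ge0 ?(ltW (h0 _))//.
  by have := label_density_range b x; lra.
by rewrite lee_fin invr_ge0 ltW.
Qed.

Lemma fbar_label : fbar P class_density = h.
Proof.
apply/funext => x; rewrite /fbar /class_density /label_density.
have [p1 p2] := (prior_gt0 true, prior_gt0 false).
by field; rewrite !gt_eqF.
Qed.

Lemma eta_label : eta P class_density = e.
Proof.
apply/funext => x; rewrite /eta fbar_label /class_density /label_density.
have [p1 hx] := (prior_gt0 true, h0 x).
by field; rewrite !gt_eqF.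
Qed.

End label_densities.

Section class_membership.
Context (R : realType) (d : nat).
Hypothesis d0 : (0 < d)%N.
Local Notation E := 'rV[R]_d.
Implicit Types (x y : E).

(** The Hessian of a sum of disjoint rescaled bumps of height A has entries with
Lipschitz constant 672 A / r^3, and [opnorm_entry_bound] loses d^2. *)
Definition perturbation_scale : R := (672 * d%:R ^+ 2)^-1.

(** The second entry makes eps0 times the volume of the unit ball at most the
constant in [design_ball]. *)
Definition eps_star : R :=
  Num.min (1 / 32) ((1 / 2) * (1 / 2 / d%:R) ^+ d / (`|unit_ball_volume R d| + 1)).

Lemma eps_star_gt0 : 0 < eps_star.
Proof.
have h1 : 0 < `|unit_ball_volume R d| + 1 by rewrite ltr_wpDl.
by rewrite lt_min; apply/andP; split; rewrite ?divr_gt0 ?mulr_gt0 ?exprn_gt0 ?divr_gt0 ?ltr0n.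
Qed.

Variables (rho L w e r eps0 M0 : R) (ell g : R -> R).
Hypotheses (rho0 : 0 < rho) (L1 : 1 <= L) (w0 : 0 < w).
Hypothesis w_small : w * (pi * L) ^+ d <= 1 / 2.
Hypothesis w_lip : w * tail_lip d rho <= 1.
Hypothesis w_moment : w * (L `^ rho * (pi * L) ^+ d) <= 1.
Local Notation k := (tail_exponent d rho).
Hypothesis L_large : d%:R ^+ 2 * (4 * k.+1%:R * k.+2%:R + 2 * k.+1%:R) <= L.
Hypotheses (e01 : 0 < e < 1) (eps0_gt0 : 0 < eps0) (eps0_le : eps0 <= eps_star).
Hypotheses (r0 : 0 < r) (r_eps : r <= eps0).
Hypothesis gr : forall e', 0 < e' -> e' < e -> g e' / e' <= r / e.
Hypotheses (M0_ge : 2 * d%:R <= M0) (eps0M0 : eps0 * M0 <= 1 / 4).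
Hypothesis ell_ge : forall delta, 0 < delta -> 2 / eps0 <= ell delta.

Let A : R := perturbation_scale * e * r ^+ 2.

Variables (J : finType) (z : J -> E).
Hypothesis tz : trivIset setT (fun j => eball (z j) r).
Variable s : {ffun J -> bool}.

Local Notation eta_s := (eta_of d0 z r A s).
Hypothesis eta01 : forall x, 0 <= eta_s x <= 1.

Local Notation mu := (design_measure d0 rho L1 w0 w_small).
Local Notation P := (label_measure mu (@measurable_eta R d d0 J z r A s) eta01).
Local Notation design := (@design R d rho L w).
Local Notation i0 := (Ordinal d0).

Let d1 : 1 <= d%:R :> R. Proof. by rewrite ler1n. Qed.

Lemma eps0_32 : eps0 <= 1 / 32.
Proof. by apply: le_trans eps0_le _; rewrite ge_min lexx. Qed.

Lemma scale_denom_gt0 : 0 < (672 * d%:R ^+ 2 : R).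
Proof. by apply: mulr_gt0; [rewrite ltr0n|apply: exprn_gt0; rewrite ltr0n]. Qed.

Lemma scale_d2 : perturbation_scale * (672 * d%:R ^+ 2) = 1.
Proof. by apply: mulVf; rewrite gt_eqF; [|exact: scale_denom_gt0]. Qed.

Lemma scale_gt0 : 0 < perturbation_scale.
Proof. by rewrite invr_gt0; exact: scale_denom_gt0. Qed.

Lemma scale_le : perturbation_scale <= 1 / 672.
Proof.
have := scale_d2; have := scale_gt0; have := d1; rewrite expr2 => h1 h2 h3.
have : 1 <= d%:R * d%:R :> R by nra.
by nra.
Qed.

Lemma r32 : r <= 1 / 32. Proof. exact: le_trans r_eps eps0_32. Qed.

Lemma A_ge0 : 0 <= A.
Proof.
have [e_0 _] := andP e01.
by rewrite !mulr_ge0 ?exprn_ge0 ?(ltW scale_gt0) ?(ltW e_0) ?(ltW r0).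
Qed.

Lemma A_eps : A <= eps0 / 32.
Proof.
have [e_0 e_1] := andP e01; have a0 := scale_gt0.
have a1 : perturbation_scale <= 1 by apply: le_trans scale_le _; lra.
have [r_0 r_1] := (r0, r32).
have ae : perturbation_scale * e <= 1 by apply: mulr_ile1; rewrite ?(ltW a0) ?(ltW e_0) ?(ltW e_1).
apply: (@le_trans _ _ (1 * r ^+ 2)); first by apply: ler_wpM2r; rewrite ?exprn_ge0 ?(ltW r_0).
rewrite mul1r expr2; apply: ler_pM; rewrite ?(ltW r_0)//.
by rewrite -div1r.
Qed.

Lemma entries_le (c : R) : 0 <= c <= 672 -> d%:R ^+ 2 * (perturbation_scale * e * c) <= e.
Proof.
move=> /andP[c_0 c1]; have [e_0 _] := andP e01; have ad := scale_d2.
rewrite (_ : _ * _ = perturbation_scale * (c * d%:R ^+ 2) * e); last by ring.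
apply: (@le_trans _ _ (perturbation_scale * (672 * d%:R ^+ 2) * e)); last by rewrite ad mul1r.
apply: ler_wpM2r; first exact: ltW.
apply: ler_wpM2l; first exact: ltW scale_gt0.
by apply: ler_wpM2r => //; exact: exprn_ge0.
Qed.

Lemma eta_in_range x : 1 / 8 <= eta_s x <= 7 / 8.
Proof.
apply: eta_range => //; first exact: A_ge0.
by have := A_eps; have := eps0_32; lra.
Qed.

Local Notation f := (class_density mu design (@measurable_eta R d d0 J z r A s) eta01).

Local Notation S := [set x | eta_s x = 1 / 2].

(** The perturbation has size at most A, so the decision boundary stays in the
strip where |zigzag (x_0)| <= A. *)
Lemma boundary_strip x b : enlarge S b x -> `|zigzag (x ord0 i0)| <= A + b.
Proof.
case=> y Sy [u]; rewrite /eball /= sub0r enormN => ub <-.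
have y_0 : zigzag (y ord0 i0) = - pert z r A s y.
  by move: Sy; rewrite /= /eta_of => ye; lra.
have h1 : `|zigzag (y ord0 i0)| <= A by rewrite y_0 normrN pert_bound// A_ge0.
have h2 := zigzag_lipschitz ((y + u) ord0 i0) (y ord0 i0).
have h3 : `|(y + u) ord0 i0 - y ord0 i0| <= enorm u by rewrite mxE addrAC subrr add0r coord_le_enorm.
have := ler_normD (zigzag ((y + u) ord0 i0) - zigzag (y ord0 i0)) (zigzag (y ord0 i0)).
rewrite subrK; lra.
Qed.

Lemma boundary_out x b : b <= eps0 -> enlarge S b x -> 1 / 8 <= enorm x.
Proof.
move=> be /boundary_strip h; apply: le_trans (coord_le_enorm x i0); rewrite leNgt; apply/negP => x8.
have := zigzag0 (ltW x8); move: h; rewrite ler_norml => h.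
by have := A_eps; have := eps0_32; lra.
Qed.

Lemma sub_enlarge x b : 0 < b -> S x -> enlarge S b x.
Proof.
move=> b0 Sx; exists x => //; exists 0; last by rewrite addr0.
by rewrite /eball /= subrr enorm0.
Qed.

Local Notation theta := (Param eps0 M0 rho ell g).

Let fbarE : fbar P f = design.
Proof. by apply: fbar_label; exact: eta_in_range. Qed.

Let etaE : eta P f = eta_s.
Proof. by apply: eta_label; [exact: design_gt0|exact: eta_in_range]. Qed.

Let SE : decision_boundary P f = S.
Proof. by rewrite /decision_boundary etaE. Qed.

Lemma holds_A1 : assumption_A1 P f.
Proof.
rewrite /assumption_A1 fbarE; split.
  by apply: aeW => x; exact: continuous_design.
rewrite (_ : [set x | _] = setT); first exact: openT.
by apply/seteqP; split => x // _; exact: continuous_design.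
Qed.

(** Near the boundary only the tail contributes to the density, and each
derivative of the tail gains a factor 1 / L. *)
Lemma holds_A2 : assumption_A2 P theta f.
Proof.
have [k0 L_1] : 0 <= k.+1%:R :> R /\ 1 <= L by split; [exact: ler0n|exact: L1].
have d_1 := d1; have w_0 := w0; have e32 := eps0_32; have e_0 := eps0_gt0.
have Li0 : 0 < L^-1 by rewrite invr_gt0; lra.
have k2 : 0 <= k.+2%:R :> R by exact: ler0n.
have kS : 1 <= k.+1%:R :> R by rewrite ler1n.
have LL := L_large; move: LL; rewrite expr2; set K := 4 * _ * _ + 2 * _ => LL.
have K0 : 2 * k.+1%:R <= K by rewrite /K; nra.
have dK : d%:R * d%:R * K * L^-1 <= 1 by rewrite ler_pdivrMr; lra.
have dd : 1 <= d%:R * d%:R :> R by nra.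
have KK : K <= d%:R * d%:R * K by rewrite ler_peMl//; lra.
have w1 : w <= 1.
  have := w_lip; rewrite /tail_lip => wl; apply: le_trans wl.
  by rewrite ler_peMr//; [lra|nra].
have ell_ge' x : 2 / eps0 <= ell (design x) by apply: ell_ge; exact: design_gt0.
have e2 : 2 <= 2 / eps0 by rewrite ler_pdivlMr//; lra.
have wide0 x : 0 < wide rho L x := wide_gt0 rho L x.
have balls x q : 0 < q <= eps0 ->
    ((eps0 * unit_ball_volume R d * q ^+ d * design x)%:E <= marginal P (eball x q))%E.
  move=> /andP[q0 qe].
  have q32 : 0 < q <= 1 / 32 by lra.
  have Lq : 4 * k.+1%:R * q <= L.
    have : 4 * k.+1%:R * q <= 4 * k.+1%:R * 1 by apply: ler_wpM2l; lra.
    have : d%:R * d%:R * K * L^-1 * L <= 1 * L by apply: ler_wpM2r; lra.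
    rewrite mulfVK; last by rewrite gt_eqF; lra.
    have kk : k.+1%:R <= k.+2%:R :> R by rewrite ler_nat.
    have : 4 * k.+1%:R <= K by rewrite /K; nra.
    lra.
  suff -> : marginal P (eball x q) = mu (eball x q).
    apply: le_trans (design_ball d0 L1 w0 w_small x q32 Lq); rewrite lee_fin.
    have design0 : 0 < design x by exact: design_gt0.
    have ub : eps0 * unit_ball_volume R d <= (1 / 2) * (1 / 2 / d%:R) ^+ d.
      have : eps0 <= (1 / 2) * (1 / 2 / d%:R) ^+ d / (`|unit_ball_volume R d| + 1).
        by apply: le_trans eps0_le _; rewrite ge_min lexx orbT.
      rewrite ler_pdivlMr; last by rewrite ltr_wpDl.
      apply: le_trans; apply: ler_wpM2l; first by lra.
      by have := ler_norm (unit_ball_volume R d); lra.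
    rewrite (_ : (q / 2 / d%:R) ^+ d * _ = (1 / 2) * (1 / 2 / d%:R) ^+ d * q ^+ d * design x).
      apply: ler_wpM2r; first by lra.
      by apply: ler_wpM2r => //; apply: exprn_ge0; lra.
    rewrite (_ : q / 2 / d%:R = (1 / 2 / d%:R) * q); last by ring.
    by rewrite exprMn; ring.
  by apply: marginal_labelE; exact: measurable_eball.
rewrite /assumption_A2 SE fbarE; split; [| | |by move=> x q _; exact: balls] => /=.
- split.
    have [y ye _] : exists2 y, eta_s y = 1 / 2 & enorm (0 - y) <= `|zigzag ((0 : E) ord0 i0)| + 1 / 8.
      by apply: boundary_near => //; [exact: A_ge0|have := A_eps; lra|lra].
    by exists y; split => //; exact: design_gt0.
  move=> x Sx; have x8 := boundary_out (le_refl _) (sub_enlarge eps0_gt0 Sx).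
  have [-> _ _] := design_out rho L w x8.
  apply: (@le_trans _ _ (1 * 1)); first by apply: ler_pM; [lra|exact: ltW|lra|exact: wide_le1].
  by have := M0_ge; lra.
- exact: design_C2.
- move=> x Sx; have x8 := boundary_out (le_refl _) (sub_enlarge eps0_gt0 Sx).
  have [dx gx _] := design_out rho L w x8.
  have design0 : 0 < design x by exact: design_gt0.
  split.
    have -> : grad design x = \row_i design_grad rho L w i x by exact: has_grad_grad (has_grad_design _ _ _ _).
    have h : enorm (\row_i design_grad rho L w i x) <= d%:R * (w * (L^-1 * (2 * k.+1%:R * wide rho L x))).
      apply: enorm_coord_bound => [|i].
        by apply: mulr_ge0; [lra|apply: mulr_ge0; [lra|have := wide0 x; nra]].
      rewrite mxE gx normrM [X in _ * X <= _]normrM [`|w|]gtr0_norm// [`|L^-1|]gtr0_norm//.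
      apply: ler_wpM2l; first by lra.
      apply: ler_wpM2l; first by lra.
      exact: tail_grad_bound.
    apply: (le_trans h).
    rewrite [leLHS](_ : _ = (d%:R * (2 * k.+1%:R) * L^-1) * design x); last first.
      by rewrite dx; ring.
    rewrite mulrC; apply: ler_wpM2l; first by lra.
    apply: le_trans (ell_ge' x); apply: le_trans e2.
    have : d%:R * (2 * k.+1%:R) * L^-1 <= d%:R * d%:R * K * L^-1.
      apply: ler_wpM2r; first by lra.
      by rewrite -mulrA; apply: ler_wpM2l; [lra|nra].
    lra.
  move=> u; rewrite /eball /= sub0r enormN => ue.
  have xu8 : 1 / 8 <= enorm (x + u).
    apply: (@boundary_out _ eps0) => //; exists x => //; exists u => //.
    by rewrite /eball /= sub0r enormN.
  have [_ _ hxu] := design_out rho L w xu8.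
  have [_ hE] := design_twice d rho L w.
  rewrite hE//.
  have harn : wide rho L (x + u) <= 2 * wide rho L x.
    apply: tail_harnack; rewrite -scalerBr addrAC subrr add0r enormZ [`|L^-1|]gtr0_norm//.
    have : 4 * k.+1%:R * (L^-1 * enorm u) <= 4 * k.+1%:R * (L^-1 * (1 / 32)).
      by apply: ler_wpM2l; [lra|apply: ler_wpM2l; lra].
    have : k.+1%:R * L^-1 <= d%:R * d%:R * K * L^-1.
      by apply: ler_wpM2r; lra.
    lra.
  have h : opnorm (\matrix_(i, j) design_hess rho L w j i (x + u)) <=
      d%:R ^+ 2 * (w * (L^-1 * (L^-1 * (K * (2 * wide rho L x))))).
    apply: opnorm_entry_bound => [|i j].
      apply: mulr_ge0; first by lra.
      apply: mulr_ge0; first by lra.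
      apply: mulr_ge0; first by lra.
      by apply: mulr_ge0; [lra|have := wide0 x; lra].
    rewrite mxE hxu normrM [X in _ * X <= _]normrM [X in _ * (_ * X) <= _]normrM.
    rewrite [`|w|]gtr0_norm// [`|L^-1|]gtr0_norm//.
    apply: ler_wpM2l; first by lra.
    apply: ler_wpM2l; first by lra.
    apply: ler_wpM2l; first by lra.
    apply: (le_trans (tail_hess_bound _ _ _ _)); apply: ler_wpM2l; [|exact: harn].
    by rewrite -/K; lra.
  apply: (le_trans h).
  rewrite [leLHS](_ : _ = design x * ((d%:R * d%:R * K * L^-1) * L^-1 * 2)); last first.
    by rewrite dx expr2; ring.
  apply: ler_wpM2l; first by lra.
  apply: le_trans (ell_ge' x); apply: le_trans e2.
  have Li1 : L^-1 <= 1 by rewrite invf_le1; lra.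
  have : (d%:R * d%:R * K * L^-1) * L^-1 <= 1 * 1.
    apply: ler_pM => //; last by lra.
    by apply: mulr_ge0; [nra|lra].
  lra.
Qed.

Lemma A_over_r2 : A * r^-1 * r^-1 = perturbation_scale * e.
Proof.
have r_0 : r != 0 by rewrite gt_eqF// r0.
by rewrite /A; field.
Qed.

Lemma A_over_r : A * r^-1 * 8 <= 1 / 2.
Proof.
have r_0 : r != 0 by rewrite gt_eqF// r0.
have -> : A * r^-1 * 8 = perturbation_scale * e * r * 8 by rewrite /A; field.
have [e_0 e_1] := andP e01; have := scale_le; have := scale_gt0; have := r32; have := r0.
set a := perturbation_scale => rr r_32 a0 a1.
have ae : a * e <= 1 / 672 by nra.
have ae0 : 0 <= a * e by nra.
have : a * e * r <= 1 / 672 * (1 / 32) by apply: ler_pM; lra.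
lra.
Qed.

(** Near the boundary the Hessian of the regression function is that of the
perturbation alone, since [zigzag] is affine there. *)
Lemma holds_A3 : assumption_A3 P theta f.
Proof.
have e32 := eps0_32; have e_0 := eps0_gt0; have Ae := A_eps; have A_0 := A_ge0.
have [ee0 ee1] := andP e01; have a0 := ltW scale_gt0; have ad := scale_d2.
have d_1 := d1; have M := M0_ge; have eM := eps0M0; have r_0 := r0.
have M_1 : 1 <= M0 by lra.
have ae0 : 0 <= perturbation_scale * e by apply: mulr_ge0 a0 _; exact: ltW.
have strip x : enlarge S (2 * eps0) x -> `|zigzag (x ord0 i0)| < 1 / 4.
  by move=> /boundary_strip; lra.
have [tw hE] := eta_twice d0 z r A s.
have gE x : `|zigzag (x ord0 i0)| < 1 / 4 -> grad eta_s x = \row_i eta_grad d0 z r A s i x.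
  by move=> zx; exact: has_grad_grad (has_grad_eta _ _ _ _ zx).
have pg x i : `|pert_grad z r A s i x| <= 1 / 2.
  by apply: (le_trans (pert_grad_bound r0 A_0 tz s i x)); exact: A_over_r.
have slope x : `|zigzag (x ord0 i0)| < 1 / 4 -> `|zigzag_slope (x ord0 i0)| = 1.
  by move=> /is_derive_zigzag[_ [] -> _]; rewrite ?normrN normr1.
have hb i j x : `|pert_hess z r A s i j x| <= perturbation_scale * e * 56.
  by have := (blip_pert_hess r0 A_0 tz s i j).1 x; rewrite A_over_r2.
have hl i j x y : `|pert_hess z r A s i j x - pert_hess z r A s i j y| <=
    perturbation_scale * 672 * (e / r) * enorm (x - y).
  apply: (le_trans ((blip_pert_hess r0 A_0 tz s i j).2 x y)); rewrite A_over_r2.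
  apply: ler_wpM2r; first exact: enorm_ge0.
  by rewrite le_eqVlt; apply/orP; left; apply/eqP; ring.
rewrite /assumption_A3 etaE SE; split => /=.
- by move=> x /strip; exact: tw.
- move=> x Sx; have zx : `|zigzag (x ord0 i0)| < 1 / 4.
    by apply: strip; apply: sub_enlarge => //; lra.
  apply: (@le_trans _ _ (1 / 2)); first by lra.
  apply: le_trans (coord_le_enorm _ i0).
  rewrite gE// mxE /eta_grad eqxx mulr1.
  have := slope x zx; have := pg x i0.
  have := ler_normD (zigzag_slope (x ord0 i0) + pert_grad z r A s i0 x) (- pert_grad z r A s i0 x).
  by rewrite addrK normrN; lra.
- move=> x /strip zx; split.
    apply: (@le_trans _ _ (d%:R * 2)); last by rewrite mulrC.
    apply: enorm_coord_bound => // i; rewrite gE// mxE /eta_grad.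
    apply: le_trans (ler_normD _ _) _.
    have : `|zigzag_slope (x ord0 i0) * (i == i0)%:R| <= 1.
      by rewrite normrM slope// mul1r; case: (i == i0); rewrite ?normr0 ?normr1.
    by have := pg x i; lra.
  rewrite hE//; apply: (@le_trans _ _ (d%:R ^+ 2 * (perturbation_scale * e * 56))).
    apply: opnorm_entry_bound => [|i j]; last by rewrite mxE.
    by apply: mulr_ge0 ae0 _; exact: ler0n.
  apply: le_trans (entries_le _) _; first by rewrite ler0n ler_nat.
  exact: le_trans (ltW ee1) M_1.
- move=> e' /andP[e'0 e'1] x y /strip xz /strip yz xy.
  rewrite !hE//.
  rewrite (_ : _ - _ = \matrix_(i, j) (pert_hess z r A s j i y - pert_hess z r A s j i x)); last first.
    by apply/matrixP => i j; rewrite !mxE.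
  (* a Hessian of size at most e / 12 settles e <= e'; its Lipschitz constant
     settles e' < e *)
  have [ee'|e'e] := leP e e'.
    apply: (@le_trans _ _ (d%:R ^+ 2 * (perturbation_scale * e * (56 + 56)))).
      apply: opnorm_entry_bound => [|i j].
        by apply: mulr_ge0 ae0 _; apply: addr_ge0; exact: ler0n.
      rewrite mxE; apply: le_trans (ler_normB _ _) _; rewrite mulrDr.
      by apply: lerD; exact: hb.
    by apply: le_trans (entries_le _) ee'; rewrite -natrD ler0n ler_nat.
  have ger : enorm (y - x) * e <= e' * r.
    have := gr e'0 e'e; rewrite ler_pdivrMr// mulrAC ler_pdivlMr// => gre.
    have : enorm (y - x) * e <= g e' * e by apply: ler_wpM2r => //; exact: ltW.
    lra.
  apply: (@le_trans _ _ (d%:R ^+ 2 * (perturbation_scale * 672 * (e / r) * enorm (y - x)))).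
    apply: opnorm_entry_bound => [|i j]; last by rewrite mxE; exact: hl.
    apply: mulr_ge0; last exact: enorm_ge0.
    apply: mulr_ge0; first by apply: mulr_ge0 a0 _; exact: ler0n.
    by apply: divr_ge0; exact: ltW.
  have -> : d%:R ^+ 2 * (perturbation_scale * 672 * (e / r) * enorm (y - x)) =
      (perturbation_scale * (672 * d%:R ^+ 2)) * (enorm (y - x) * e / r).
    by ring.
  by rewrite ad mul1r ler_pdivrMr.
split; first by apply: continuous_subspaceT; exact: continuous_eta.
rewrite fbarE => x xS _; have dx : 0 < design x by exact: design_gt0.
have el := ell_ge dx.
apply: (@le_trans _ _ (eps0 / 2)).
  rewrite (_ : eps0 / 2 = 1 / (2 / eps0)); last by field; rewrite gt_eqF.
  by rewrite !div1r lef_pV2 ?posrE ?divr_gt0//; apply: lt_le_trans el; rewrite divr_gt0.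
rewrite leNgt; apply/negP => xlt; apply: xS.
have zx : `|zigzag (x ord0 i0)| < eps0 / 2 + A.
  have := pert_bound r0 A_0 tz s x.
  move: xlt; rewrite /eta_of !ltr_norml !ler_norml; lra.
have [y ye xy] : exists2 y, eta_s y = 1 / 2 & enorm (x - y) <= `|zigzag (x ord0 i0)| + eps0 / 4.
  by apply: boundary_near => //; lra.
exists y => //; exists (x - y); last by rewrite addrC subrK.
by rewrite /eball /= sub0r enormN; lra.
Qed.

Lemma holds_A4 : assumption_A4 P theta.
Proof.
rewrite /assumption_A4 /=.
have -> : (\int[marginal P]_x (enorm x `^ rho)%:E = \int[mu]_x (enorm x `^ rho)%:E)%E.
  by apply: eq_measure_integral => B mB _; exact: marginal_labelE.
apply: le_trans (design_moment d0 rho0 L1 w0 w_small) _; rewrite lee_fin.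
have := w_moment; have := M0_ge; have := d1; lra.
Qed.

(** The thresholds for M0 and eps0 depend on d only, and the other parameters of
the class enter through conditions on L, w and r that large L, small w and small
r satisfy. *)
Theorem perturbed_in_class_P : class_P theta P.
Proof.
exists f; split; last by split; [exact: holds_A1|exact: holds_A2|exact: holds_A3|exact: holds_A4].
move=> b; apply: class_density_spec => //; first exact: measurable_design.
- by move=> x; exact: design_gt0.
- exact: eta_in_range.
Qed.

End class_membership.

(** * Packing of cells *)

Lemma truncn_half (R : realType) (x : R) : 1 <= x -> x / 2 <= (Num.truncn x)%:R <= x.
Proof.
move=> x1; have x0 : 0 <= x by exact: le_trans ler01 x1.
have /andP[t1 t2] := truncn_itv x0; rewrite t1 andbT.
have : 1 <= (Num.truncn x)%:R :> R by rewrite ler1n truncn_gt0.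
by move: t2; rewrite -natr1; lra.
Qed.

Section cells.
Context (R : realType) (d : nat).
Hypothesis d0 : (0 < d)%N.
Local Notation E := 'rV[R]_d.
Local Notation i0 := (Ordinal d0).
Implicit Types (x y : E).
Variables (L r t : R).
Hypotheses (L1 : 1 <= L) (r0 : 0 < r) (r32 : r <= 1 / 32).

(** The first index selects one of about L hyperplanes, the second one a point
of a grid of step 2 r in that hyperplane. *)
Definition cell := ('I_(Num.truncn L) * {ffun 'I_d.-1 -> 'I_(Num.truncn (L / r))})%type.

(** The first coordinate k + 1/4 makes [zigzag] vanish at the centre. *)
Definition centre (j : cell) : E :=
  \row_i oapp (fun i' => 2 * r * (j.2 i')%:R) (j.1%:R + 1 / 4) (unlift i0 i).

Lemma centre0 j : centre j ord0 i0 = j.1%:R + 1 / 4.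
Proof. by rewrite mxE unlift_none. Qed.

Lemma Lr1 : 1 <= L / r.
Proof. by rewrite ler_pdivlMr//; have := L1; have := r32; lra. Qed.

Lemma card_cell : L / 2 * (L / r / 2) ^+ d.-1 <= #|{: cell}|%:R.
Proof.
have /andP[h1 _] := truncn_half L1; have /andP[h2 _] := truncn_half Lr1.
have l1 := L1; have l2 := Lr1.
rewrite card_prod card_ffun !card_ord natrM natrX; apply: ler_pM => //.
- by lra.
- by apply: exprn_ge0; lra.
- by apply: lerXn2r => //; rewrite nnegrE; lra.
Qed.

Lemma centre_bound j i : 0 <= centre j ord0 i <= 2 * L.
Proof.
have l1 := L1; have r_0 := r0; rewrite mxE; case: unliftP => [i' _|_] /=.
  have /andP[_ h] := truncn_half Lr1.
  have : (j.2 i')%:R <= (Num.truncn (L / r))%:R :> R by rewrite ler_nat ltnW.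
  have := ler0n R (j.2 i'); set n := _%:R => n0 nK.
  have : n * r <= L by rewrite -ler_pdivlMr//; exact: le_trans h.
  by nra.
have /andP[_ h] := truncn_half L1.
have : j.1.+1%:R <= (Num.truncn L)%:R :> R by rewrite ler_nat.
by have := ler0n R j.1; rewrite -natr1; lra.
Qed.

(** Centres on different hyperplanes are at distance at least 1, and on the same
hyperplane some coordinate differs by at least 2 r. *)
Lemma trivIset_cells : trivIset setT (fun j => eball (centre j) r).
Proof.
have sep j j' : j <> j' -> exists i, 2 * r <= `|centre j ord0 i - centre j' ord0 i|.
  case: j j' => [k l] [k' l'] jj'.
  have dist1 m n : m <> n -> 1 <= `|m%:R - n%:R| :> R.
    move=> mn; have [mn1|nm|//] := ltngtP m n.
      have : m.+1%:R <= n%:R :> R by rewrite ler_nat.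
      by rewrite -natr1 distrC; have := ler_norm (n%:R - m%:R : R); lra.
    have : n.+1%:R <= m%:R :> R by rewrite ler_nat.
    by rewrite -natr1; have := ler_norm (m%:R - n%:R : R); lra.
  have [kk|/eqP kk] := eqVneq k k'.
    have [i li] : exists i, l i <> l' i.
      apply: contrapT => /forallNP ll; apply: jj'; rewrite kk; congr pair.
      by apply/ffunP => i; apply: contrapT.
    exists (lift i0 i); rewrite !mxE liftK /= -mulrBr normrM ger0_norm; last by have := r0; lra.
    rewrite ler_peMr ?dist1//; first by have := r0; lra.
    by move=> /val_inj.
  exists i0; rewrite !centre0 /= opprD addrACA subrr addr0.
  apply: (@le_trans _ _ 1); first by have := r32; lra.
  by apply: dist1 => /val_inj.
move=> j j' _ _ [x [xj xj']]; apply: contrapT => /sep[i].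
have := le_lt_trans (coord_le_enorm _ i) xj; have := le_lt_trans (coord_le_enorm _ i) xj'.
by rewrite !mxE !ltr_norml ler_normr => h1 h2 /orP[]; lra.
Qed.

Hypotheses (t0 : 0 <= t) (tr : t <= r / 2 / d%:R).

Definition slab_radius (i : 'I_d) : R := if i == i0 then t else r / 2 / d%:R.

(** Thin in the direction normal to the decision boundary: this is where the
perturbation, and not [zigzag], decides the sign of eta - 1/2. *)
Definition slab (j : cell) : set E :=
  box (fun i => centre j ord0 i - slab_radius i) (fun i => centre j ord0 i + slab_radius i).

Lemma slab_radius_bound i : 0 <= slab_radius i <= r / 2 / d%:R.
Proof.
have rd : 0 <= r / 2 / d%:R by exact: le_trans tr.
by rewrite /slab_radius; case: ifP => _; rewrite ?rd ?lexx ?t0 ?tr.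
Qed.

Lemma slab_coord j x i : slab j x -> `|x ord0 i - centre j ord0 i| <= slab_radius i.
Proof. by move=> /(_ i); rewrite ler_norml; lra. Qed.

Lemma slab_eball j x : slab j x -> enorm (x - centre j) <= r / 2.
Proof.
move=> xj; have d1 : d%:R != 0 :> R by rewrite pnatr_eq0 -lt0n.
have /andP[b0 b1] := slab_radius_bound i0.
rewrite -[leRHS](divfK d1) mulrC; apply: enorm_coord_bound => [|i]; first exact: le_trans b1.
have /andP[_ b2] := slab_radius_bound i.
by rewrite mxE [X in _ + X]mxE; apply: le_trans b2; exact: slab_coord.
Qed.

Lemma lebesgue_slab j : lebesgue_rV R d (slab j) = (2 * t * (r / d%:R) ^+ d.-1)%:E.
Proof.
have rE i : centre j ord0 i + slab_radius i - (centre j ord0 i - slab_radius i) =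
    2 * slab_radius i by ring.
rewrite lebesgue_box => [|i]; last by have := slab_radius_bound i; lra.
congr (_%:E); under eq_bigr do rewrite rE.
rewrite (bigD1 i0)//= /slab_radius eqxx; congr (_ * _).
rewrite (eq_bigr (fun=> r / d%:R)); last by move=> i /negbTE ->; field; rewrite pnatr_eq0 -lt0n.
by rewrite prodr_const cardC1 card_ord.
Qed.

End cells.
(** * The lower bound at given scales *)

(** With m = d - 1, this is the number of cells times the cost of a wrong sign
in one cell. *)
Lemma cell_count_algebra (R : realFieldType) (a e r w f L D : R) m : r != 0 -> D != 0 ->
  a ^+ 2 * (w * L * L ^+ m) * f * (e ^+ 2 * r ^+ 4) / (256 * (2 * D) ^+ m) =
  L / 2 * (L / r / 2) ^+ m *
    (a * e * r ^+ 2 / 8 * (w * f * (2 * (a * e * r ^+ 2 / 8) * (r / D) ^+ m)) / 4).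
Proof.
move=> r0 D0; rewrite !exprMn !exprVn.
have [h1 h2 h3] : [/\ r ^+ m != 0, D ^+ m != 0 & 2 ^+ m != 0 :> R].
  by rewrite !expf_neq0// pnatr_eq0.
move: (r ^+ m) (D ^+ m) (2 ^+ m) (L ^+ m) h1 h2 h3 => u v q p h1 h2 h3.
by field; rewrite h1 h2 h3.
Qed.

Section minimax_core.
Context (R : realType) (d : nat).
Hypothesis d0 : (0 < d)%N.
Local Notation E := 'rV[R]_d.
Local Notation i0 := (Ordinal d0).
Local Notation leb := (lebesgue_rV R d).
Implicit Types (x y : E).

Variables (rho eps0 M0 gamma lambda : R) (ell g : R -> R).
Hypotheses (rho0 : 0 < rho) (gamma02 : 0 < gamma <= 2).
Hypotheses (eps0_gt0 : 0 < eps0) (eps0_le : eps0 <= eps_star R d).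
Hypotheses (M0_ge : 2 * d%:R <= M0) (eps0M0 : eps0 * M0 <= 1 / 4).
Hypothesis ell_ge : forall delta, 0 < delta -> 2 / eps0 <= ell delta.
Hypothesis lambda_ge : lambda_star R d <= lambda.
Local Notation k := (tail_exponent d rho).

(** A lower bound for the tail on the cells, all of which lie in the ball of
radius 3 d L. *)
Definition tail_floor : R := (1 + (3 * d%:R) ^+ 2)^-1 ^+ k.+1.
(** The three terms make half of the mass remain for the bump, the derivatives
of the tail small, and the cells light enough to hide their bits. *)
Definition weight_scale : R := (2 * pi ^+ d + tail_lip d rho + 2 ^+ d)^-1.
(** The largest W for which L = 1 / W is as large as the bound on the
derivatives of the tail demands. *)
Definition width_max : R := (d%:R ^+ 2 * (4 * k.+1%:R * k.+2%:R + 2 * k.+1%:R))^-1.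
Definition core_const : R :=
  perturbation_scale R d ^+ 2 * weight_scale * tail_floor / (256 * (2 * d%:R) ^+ d.-1).

Lemma tail_floor_gt0 : 0 < tail_floor.
Proof. by rewrite exprn_gt0// invr_gt0 ltr_pwDl// sqr_ge0. Qed.

Lemma weight_scale_gt0 : 0 < weight_scale.
Proof.
have k0 := ler0n R k.+1.
rewrite invr_gt0 ltr_pwDr ?exprn_gt0// addr_ge0//.
  by rewrite mulr_ge0// exprn_ge0// pi_ge0.
by rewrite /tail_lip !mulr_ge0 ?addr_ge0 ?mulr_ge0.
Qed.

Lemma width_max_bounds : 0 < width_max <= 1.
Proof.
have d1 : 1 <= d%:R :> R by rewrite ler1n.
have k1 : 1 <= k.+1%:R :> R by rewrite ler1n.
have k2 : 1 <= k.+2%:R :> R by rewrite ler1n.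
have dd : 1 <= d%:R ^+ 2 :> R by rewrite exprn_ege1.
have h : 1 <= d%:R ^+ 2 * (4 * k.+1%:R * k.+2%:R + 2 * k.+1%:R) :> R by nra.
by rewrite invr_gt0 invf_le1 ?h ?andbT; apply: lt_le_trans h.
Qed.

Lemma core_const_gt0 : 0 < core_const.
Proof.
have a0 := scale_gt0 R d0; have c0 := weight_scale_gt0; have t0 := tail_floor_gt0.
apply: divr_gt0; first by apply: mulr_gt0 t0; apply: mulr_gt0 c0; rewrite exprn_gt0.
by apply: mulr_gt0; [lra|apply: exprn_gt0; apply: mulr_gt0; rewrite ltr0n].
Qed.

Lemma bump_half x : enorm x <= 1 / 2 -> 1 / 4 <= bump x.
Proof.
move=> x2; have := enorm_ge0 x; move: (x2) => + e0'.
have x1 : enorm x <= 1 by lra.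
rewrite /bump (bump_baseE x1); set b := 1 - _ => _.
have b1 : 3 / 4 <= b by rewrite /b; nra.
have b2 : 9 / 16 <= b ^+ 2 by nra.
by rewrite (_ : b ^+ 4 = b ^+ 2 * b ^+ 2); [nra|ring].
Qed.

Section fixed_cells.
Variables (W e r : R).
Hypotheses (W0 : 0 < W) (W_le : W <= width_max).
Hypotheses (e0 : 0 < e) (e1 : e < 1) (r0 : 0 < r) (r_eps : r <= eps0).
Hypothesis gr : forall e', 0 < e' -> e' < e -> g e' / e' <= r / e.

Let L := W^-1.
Let w := weight_scale * W `^ (rho + d%:R).
Let A := perturbation_scale R d * e * r ^+ 2.

Let p1 (s : R) : 1 `^ s = 1. Proof. by rewrite powR1. Qed.

Let W1 : W <= 1.
Proof. by have /andP[_ h] := width_max_bounds; exact: le_trans W_le h. Qed.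

Let L0 : 0 < L. Proof. by rewrite invr_gt0. Qed.
Let L1 : 1 <= L. Proof. by rewrite invf_ge1. Qed.
Let w0 : 0 < w. Proof. by rewrite mulr_gt0 ?weight_scale_gt0 ?powR_gt0. Qed.

Let wL : w * L ^+ d = weight_scale * W `^ rho.
Proof.
rewrite /w powRD; last by rewrite (gt_eqF W0) implybT.
rewrite powR_mulrn ?ltW// /L exprVn -mulrA mulfK// expf_neq0// gt_eqF//.
Qed.

Let Wrho1 : W `^ rho <= 1.
Proof.
by rewrite -[leRHS](p1 rho); apply: ge0_ler_powR; rewrite ?nnegrE ?ler01 ?(ltW W0) ?(ltW rho0).
Qed.

Let weights : [/\ weight_scale * pi ^+ d <= 1 / 2, weight_scale * tail_lip d rho <= 1 &
  weight_scale * 2 ^+ d <= 1].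
Proof.
have c0 := weight_scale_gt0.
have h : weight_scale * (2 * pi ^+ d + tail_lip d rho + 2 ^+ d) = 1.
  by apply: mulVf; rewrite gt_eqF// -invr_gt0.
have p0 : 0 <= pi ^+ d :> R by rewrite exprn_ge0// pi_ge0.
have t0 : 0 <= tail_lip d rho :> R.
  by rewrite /tail_lip !mulr_ge0 ?addr_ge0 ?mulr_ge0.
have q0 : 0 <= 2 ^+ d :> R by rewrite exprn_ge0.
have := mulr_ge0 (ltW c0) p0; have := mulr_ge0 (ltW c0) t0; have := mulr_ge0 (ltW c0) q0.
by split; lra.
Qed.

Let w_small : w * (pi * L) ^+ d <= 1 / 2.
Proof.
have [h _ _] := weights; rewrite exprMn mulrCA wL mulrA mulrC mulrA.
rewrite (_ : _ * _ = weight_scale * pi ^+ d * W `^ rho); last by ring.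
have := powR_ge0 W rho; have := Wrho1; have : 0 <= weight_scale * pi ^+ d.
  by rewrite mulr_ge0 ?exprn_ge0 ?pi_ge0 ?ltW ?weight_scale_gt0.
by move=> *; nra.
Qed.

Let w_le : w <= weight_scale.
Proof.
rewrite /w ler_piMr ?(ltW weight_scale_gt0)//.
rewrite -[leRHS](p1 (rho + d%:R)).
by apply: ge0_ler_powR; rewrite ?nnegrE ?ler01 ?addr_ge0 ?(ltW W0) ?(ltW rho0).
Qed.

Let w_lip : w * tail_lip d rho <= 1.
Proof.
have [_ h _] := weights; apply: le_trans h; apply: ler_wpM2r w_le.
by rewrite /tail_lip !mulr_ge0 ?addr_ge0 ?mulr_ge0.
Qed.

Let w_moment : w * (L `^ rho * (pi * L) ^+ d) <= 1.
Proof.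
have [h _ _] := weights; have WL : W `^ rho * L `^ rho = 1.
  by rewrite -powRM ?ltW// mulfV ?gt_eqF// powR1.
rewrite exprMn (_ : w * _ = (w * L ^+ d) * L `^ rho * pi ^+ d); last by ring.
by rewrite wL -(mulrA _ (W `^ rho)) WL mulr1; lra.
Qed.

Let L_large : d%:R ^+ 2 * (4 * k.+1%:R * k.+2%:R + 2 * k.+1%:R) <= L.
Proof.
have /andP[h _] := width_max_bounds.
by rewrite -[leLHS]invrK lef_pV2 ?posrE.
Qed.

Let r32 : r <= 1 / 32.
Proof. by apply: le_trans r_eps _; apply: (eps0_32 eps0_le). Qed.

Let d1 : 1 <= d%:R :> R. Proof. by rewrite ler1n. Qed.

Let scale_d : perturbation_scale R d * d%:R <= 1 / 672.
Proof.
have := scale_d2 R d0; have := scale_gt0 R d0; have := d1.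
set a := perturbation_scale R d; rewrite expr2 => x1 x2 x3.
have x4 : 0 < a * d%:R by apply: mulr_gt0; lra.
have : a * d%:R * 1 <= a * d%:R * d%:R by apply: ler_wpM2l; lra.
by lra.
Qed.

Let A0 : 0 < A.
Proof. by rewrite mulr_gt0 ?mulr_gt0 ?exprn_gt0 ?scale_gt0. Qed.

Let A_d : A * d%:R <= r / 672.
Proof.
have a0 := scale_gt0 R d0; have ad := scale_d; have r_0 := r0; have r_32 := r32.
have e_0 := e0; have e_1 := e1.
rewrite (_ : A * _ = (perturbation_scale R d * d%:R) * (e * r) * r); last by rewrite /A; ring.
have er : e * r <= 1 by nra.
have er0 : 0 <= e * r by nra.
have p0 : 0 <= perturbation_scale R d * d%:R by rewrite mulr_ge0// ltW.
have : (perturbation_scale R d * d%:R) * (e * r) <= 1 / 672 * 1 by apply: ler_pM.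
by move=> h; have := ler_wpM2r (ltW r_0) h; lra.
Qed.

Local Notation cell := (cell d L r).
Local Notation centre := (@centre R d d0 L r).
Let t := A / 8.

Let t0 : 0 <= t. Proof. by rewrite divr_ge0// ltW. Qed.

Let tr : t <= r / 2 / d%:R.
Proof.
have dp : 0 < d%:R :> R by rewrite ltr0n.
by rewrite ler_pdivlMr// /t; have := A_d; have := r0; lra.
Qed.

Local Notation slab := (@slab R d d0 L r t).
Local Notation mu := (design_measure d0 rho L1 w0 w_small).

Let tz : trivIset setT (fun j => eball (centre j) r).
Proof. by apply: trivIset_cells. Qed.

(** The cells do not meet the support of the bump. *)
Lemma mass_cell j : (mu (eball (centre j) r) <= (w * (2 * r) ^+ d)%:E)%E.
Proof.
have r_0 := r0; have r_32 := r32; have w_0 := w0.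
rewrite design_measureE EFinM; have mE := measurable_eball (centre j) r.
apply: (@le_trans _ _ (\int[leb]_(x in eball (centre j) r) w%:E)%E); last first.
  rewrite integral_cst//; apply: lee_wpmul2l; first by rewrite lee_fin ltW.
  by apply: lebesgue_eball_le; exact: ltW.
apply: ge0_le_integral => //.
- by move=> x _; rewrite lee_fin ltW//; exact: design_gt0.
- by apply/measurable_EFinP/measurable_funTS; exact: measurable_design.
move=> x xj; rewrite lee_fin.
have x8 : 1 / 8 <= enorm x.
  apply: le_trans (coord_le_enorm x i0).
  have := le_lt_trans (coord_le_enorm _ i0) xj; rewrite mxE [X in _ + X]mxE centre0.
  by have := ler0n R j.1; rewrite ltr_norml ler_normr => n0 xx; apply/orP; left; lra.
have [-> _ _] := design_out rho L w x8.
by rewrite ler_piMr ?wide_le1// ltW.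
Qed.

Lemma wide_slab j x : slab j x -> tail_floor <= wide rho L x.
Proof.
move=> xj; have l1 := L1; have r_32 := r32.
have xi i : `|x ord0 i| <= 3 * L.
  have := slab_coord i xj; have := centre_bound d0 L1 r0 r32 j i.
  have : r / 2 / d%:R <= r / 2.
    by have r_0 := r0; rewrite ler_pdivrMr ?ltr0n// ler_peMr// ; lra.
  by have := slab_radius_bound d0 t0 tr i; rewrite !ler_norml; lra.
have xe : enorm (L^-1 *: x) <= 3 * d%:R.
  rewrite enormZ gtr0_norm ?invr_gt0// mulrC ler_pdivrMr// -mulrA mulrCA.
  by apply: enorm_coord_bound => //; lra.
apply: lerXn2r; rewrite ?nnegrE ?(ltW (tail_base_gt0 _))//.
rewrite /tail_base lef_pV2 ?posrE ?ltr_pwDl ?sqr_ge0 ?sqn_ge0//.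
by rewrite lerD2l -enorm_le// mulr_ge0.
Qed.

Lemma mass_slab j :
  ((w * tail_floor * (2 * t * (r / d%:R) ^+ d.-1))%:E <= mu (slab j))%E.
Proof.
have w_0 := w0; have mD : measurable (slab j) by exact: measurable_box.
rewrite design_measureE EFinM -(lebesgue_slab d0 t0 tr j) -integral_cst//.
have t_0 := tail_floor_gt0.
apply: ge0_le_integral => //.
- by move=> x _; rewrite lee_fin mulr_ge0// ltW.
- by apply/measurable_EFinP/measurable_funTS; exact: measurable_design.
move=> x xj; rewrite lee_fin.
apply: (@le_trans _ _ (w * wide rho L x)); first by rewrite ler_pM2l//; exact: wide_slab xj.
rewrite /design lerDr mulr_ge0 ?bulk_ge0//; exact: bulk_weight_ge0.
Qed.

(** Every classifier fails for some s by [assouad]. The hypothesis on n is what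
hides the bits: 4 (2 A)^2 n times the mass of a cell is at most 1/2. *)
Lemma design_excess n : n%:R * (e ^+ 2 * r ^+ (4 + d) * W `^ (rho + d%:R)) <= 1 ->
  ((core_const * (e ^+ 2 * r ^+ 4 * W `^ rho))%:E <=
   minimax_excess_risk n (class_P (Param eps0 M0 rho ell g) `&` @class_Q R d gamma lambda))%E.
Proof.
move=> n_small; have A_0 := A0; have r_0 := r0; have w_0 := w0; have e_0 := e0.
have r_32 := r32; have Ad := A_d; have d_1 := d1; have l0 := L0.
have A_le : A <= r / 672 by apply: le_trans Ad; rewrite ler_peMr// ltW.
have A8 : A <= 1 / 8 by lra.
have range s x : 1 / 8 <= eta_of d0 centre r A s x <= 7 / 8.
  by apply: eta_range => //; exact: ltW.
have eta01 s x : 0 <= eta_of d0 centre r A s x <= 1 by have := range s x; lra.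
have on s j x : eball (centre j) r x ->
    eta_of d0 centre r A s x = 1 / 2 + zigzag (x ord0 i0) + sign_of R (s j) * (A * bump (local centre r j x)).
  by move=> xj; rewrite /eta_of (pert_on A r0 tz s xj).
have slab_sub j : slab j `<=` eball (centre j) r.
  by move=> x /(slab_eball t0 tr); rewrite /eball /= enormB; lra.
have slab_eta s j x : slab j x -> exists2 b, A / 4 <= b &
    `|eta_of d0 centre r A s x - (1 / 2 + sign_of R (s j) * b)| <= A / 8.
  move=> xj; exists (A * bump (local centre r j x)).
    have : 1 / 4 <= bump (local centre r j x).
      apply: bump_half; rewrite enormZ gtr0_norm ?invr_gt0// mulrC ler_pdivrMr// mulrC.
      by have := slab_eball t0 tr xj; lra.
    by have := A_0; nra.
  rewrite (on s j x (slab_sub _ _ xj)).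
  have x0 := slab_coord i0 xj; rewrite /slab_radius eqxx centre0 in x0.
  rewrite (@zigzag_nat _ j.1); last by apply: le_trans x0 _; rewrite /t; lra.
  by apply: le_trans x0; rewrite le_eqVlt; apply/orP; left; apply/eqP; congr `|_|; ring.
apply: le_ereal_inf_tmp => _ [C mC <-].
have h0 : 0 < A / 8 by lra.
have out j (s : {ffun cell -> bool}) x : ~ eball (centre j) r x ->
    eta_of d0 centre r A s x = eta_of d0 centre r A (flip j s) x.
  move=> xj; congr (_ + _); apply: eq_bigr => i _; rewrite ffunE.
  case: eqP => [->|//]; have [-> _ _] := bump_out (local_out r0 xj).
  by rewrite !mulr0.
have diff j (s : {ffun cell -> bool}) x : eball (centre j) r x ->
    `|eta_of d0 centre r A s x - eta_of d0 centre r A (flip j s) x| <= 2 * A.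
  move=> _; rewrite /eta_of opprD addrACA subrr add0r.
  apply: le_trans (ler_normB _ _) _; rewrite (_ : 2 * A = A + A); last by ring.
  by apply: lerD; apply: pert_bound => //; exact: ltW.
have up j (s : {ffun cell -> bool}) x : slab j x -> s j -> 1 / 2 + A / 8 <= eta_of d0 centre r A s x.
  by move=> /(slab_eta s)[b Ab]; rewrite /sign_of => + sj; rewrite sj ler_norml; lra.
have down j (s : {ffun cell -> bool}) x : slab j x -> ~~ s j -> eta_of d0 centre r A s x <= 1 / 2 - A / 8.
  by move=> /(slab_eta s)[b Ab]; rewrite /sign_of => + /negbTE sj; rewrite sj ler_norml; lra.
have budget : n%:R * (4 * (2 * A) ^+ 2 * (w * (2 * r) ^+ d)) <= 1 / 2.
  have [_ _ h2] := weights.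
  rewrite (_ : _ * _ = (16 * perturbation_scale R d ^+ 2) * (weight_scale * 2 ^+ d) *
      (n%:R * (e ^+ 2 * r ^+ (4 + d) * W `^ (rho + d%:R)))); last first.
    by rewrite /A /w exprD [(2 * r) ^+ d]exprMn; ring.
  have a0 := scale_gt0 R d0; have a1 := scale_le R d0.
  have aa : 16 * perturbation_scale R d ^+ 2 <= 1 / 2 by rewrite expr2; nra.
  have aa0 : 0 <= 16 * perturbation_scale R d ^+ 2 by rewrite mulr_ge0// sqr_ge0.
  have c0 : 0 <= weight_scale * 2 ^+ d by rewrite mulr_ge0 ?exprn_ge0 ?(ltW weight_scale_gt0).
  have n0 : 0 <= n%:R * (e ^+ 2 * r ^+ (4 + d) * W `^ (rho + d%:R)).
    apply: mulr_ge0; first exact: ler0n.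
    by apply: mulr_ge0; [apply: mulr_ge0; apply: exprn_ge0; exact: ltW|exact: powR_ge0].
  have : (16 * perturbation_scale R d ^+ 2) * (weight_scale * 2 ^+ d) <= 1 / 2 * 1 by apply: ler_pM.
  move=> h; rewrite -[leRHS]mulr1 -[X in X * 1]mulr1.
  by apply: ler_pM => //; exact: mulr_ge0.
have tD : trivIset setT slab.
  move=> j j' _ _ [x [xj xj']]; apply: tz => //; exists x; split; exact: slab_sub.
have delta2 : 4 * (2 * A) ^+ 2 <= 1 by rewrite expr2; nra.
have [s excess] := assouad (fun s => measurable_eta d0 centre r A s) eta01 range
  (fun j => measurable_eball (centre j) r) (fun j => measurable_box _ _)
  tD out diff up down h0 delta2 mass_cell mass_slab budget mC.
set P := label_measure _ _ _ in excess.
have PP : class_P (Param eps0 M0 rho ell g) P.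
  by apply: perturbed_in_class_P => //; apply/andP.
have PQ : class_Q gamma lambda P.
  apply: (@design_class_Q R d d0 rho L w L1 w0 w_small w_lip P gamma lambda) => // B mB.
  exact: marginal_labelE.
apply: (@le_trans _ _ (risk C P - bayes_risk P)%E); last by apply: ereal_sup_ubound; exists P.
apply: le_trans excess; rewrite lee_fin.
have t_0 := tail_floor_gt0.
have rd0 : 0 <= (r / d%:R) ^+ d.-1 by rewrite exprn_ge0// divr_ge0// ltW.
have -> : core_const * (e ^+ 2 * r ^+ 4 * W `^ rho) = L / 2 * (L / r / 2) ^+ d.-1 *
    (A / 8 * (w * tail_floor * (2 * t * (r / d%:R) ^+ d.-1)) / 4).
  have Wrho : weight_scale * W `^ rho = w * L * L ^+ d.-1.
    by rewrite -mulrA -exprS prednK// wL.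
  rewrite /core_const (_ : _ * _ = perturbation_scale R d ^+ 2 * (weight_scale * W `^ rho) * tail_floor *
    (e ^+ 2 * r ^+ 4) / (256 * (2 * d%:R) ^+ d.-1)); last by ring.
  by rewrite Wrho /t /A; apply: cell_count_algebra; [rewrite gt_eqF|rewrite pnatr_eq0 -lt0n].
apply: ler_wpM2r; last by apply: card_cell.
apply: divr_ge0 => //; apply: mulr_ge0; first exact: ltW.
apply: mulr_ge0; first by apply: mulr_ge0; exact: ltW.
by apply: mulr_ge0 => //; apply: mulr_ge0 => //; exact: t0.
Qed.

End fixed_cells.
End minimax_core.
(** * From scales to rates *)

Section small_functions.
Context (R : realType) (g : R -> R).
Hypothesis Gg : class_G g.

Lemma gt0_powRD (x a b : R) : 0 < x -> x `^ (a + b) = x `^ a * x `^ b.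
Proof. by move=> x0; rewrite powRD// (gt_eqF x0) implybT. Qed.

Lemma powR_le1 (x a : R) : 0 < x <= 1 -> 0 <= a -> x `^ a <= 1.
Proof.
move=> /andP[x0 x1] a0; have p1 : 1 `^ a = 1 :> R by rewrite powR1.
by rewrite -[leRHS]p1; apply: ge0_ler_powR; rewrite ?nnegrE ?ler01 ?(ltW x0).
Qed.

Lemma powR_sqrM (x y a b : R) : 0 <= x ->
  (x ^+ 2 * y `^ a) `^ b = x `^ (2 * b) * y `^ (a * b).
Proof.
move=> x0; rewrite powRM ?exprn_ge0 ?powR_ge0// (powRrM x 2 b) (powRrM y a b).
by rewrite (powR_mulrn 2 x0).
Qed.

Lemma inverse01K x : 0 < x < 1 -> inverse01 g (g x) = x.
Proof.
have [_ mono _] := Gg => x01; apply: pinvKV; last by rewrite inE /= in_itv.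
move=> a b; rewrite !inE /= !in_itv /= => /andP[a0 a1] /andP[b0 b1] gab.
have [ab|ba|//] := ltgtP a b; first by have := mono _ _ a0 ab b1; rewrite gab ltxx.
by have := mono _ _ b0 ba a1; rewrite gab ltxx.
Qed.

Lemma power_near0 (M c : R) : 0 < M -> 0 < c ->
  exists2 x0, 0 < x0 < 1 & forall x, 0 < x -> x <= x0 -> g x <= c * x `^ M.
Proof.
have [_ _ litt] := Gg => /litt /eqoP h c0.
have [b /= b0 hb] := h c c0.
exists (Num.min (b / 2) (1 / 2)); first by rewrite lt_min gt_min !divr_gt0//=; apply/orP; right; lra.
move=> x x0; rewrite le_min => /andP[xb _].
have := hb x; rewrite /= [`|x `^ M|]ger0_norm ?powR_ge0// => gx.
apply: le_trans (ler_norm _) _; apply: gx => //.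
by rewrite sub0r normrN gtr0_norm//; lra.
Qed.

End small_functions.

Section rates.
Context (R : realType) (d : nat).
Hypothesis d0 : (0 < d)%N.
Variables (rho eps0 : R) (g : R -> R) (mm : nat -> \bar R) (c0 Wm : R).
Hypotheses (rho0 : 0 < rho) (eps00 : 0 < eps0) (eps01 : eps0 <= 1) (Gg : class_G g).
Hypotheses (c00 : 0 < c0) (Wm0 : 0 < Wm) (Wm1 : Wm <= 1).
Hypothesis regular : exists2 r0 : R, 0 < r0 & forall r s : R,
  (g @` `]0, 1[) r -> (g @` `]0, 1[) s -> r <= s -> s < r0 ->
  r / inverse01 g r <= s / inverse01 g s.
Hypothesis core : forall (W e r : R) (n : nat), 0 < W -> W <= Wm -> 0 < e -> e < 1 ->
  0 < r -> r <= eps0 -> (forall e', 0 < e' -> e' < e -> g e' / e' <= r / e) ->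
  n%:R * (e ^+ 2 * r ^+ (4 + d) * W `^ (rho + d%:R)) <= 1 ->
  ((c0 * (e ^+ 2 * r ^+ 4 * W `^ rho))%:E <= mm n)%E.

Local Notation rate_exponent nu := (4 + d%:R + nu * (rho + d%:R)).

Lemma rate_exponent_gt0 nu : 0 <= nu -> 0 < rate_exponent nu.
Proof.
move=> nu0; have := ler0n R d; have := rho0 => r0 dd.
have h : 0 <= nu * (rho + d%:R) by apply: mulr_ge0 => //; lra.
lra.
Qed.

(** With 1 / q = g e the equation for q becomes explicit in e. *)
Lemma rate_solution n nu q : is_rate_solution d n rho nu g q ->
  exists e, [/\ 0 < e < 1, 0 < q, 1 / q = g e, inverse01 g (1 / q) = e &
    q `^ rate_exponent nu = n%:R * e ^+ 2].
Proof.
case=> q0 [e /=]; rewrite in_itv /= => e01 ge qn; exists e; split => //.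
- apply: le_lt_trans q0; rewrite divr_ge0// fine_ge0//.
  by apply: le_trans (ereal_sup_ubound (ex_intro2 _ _ e _ erefl)); rewrite ?lee_fin//= in_itv.
- by rewrite -ge inverse01K.
have e0 : 0 < e by case/andP: e01.
move: qn; rewrite -ge inverse01K// => <-; rewrite mulfVK// expf_neq0// gt_eqF//.
Qed.

(** If q increases then e with g e = 1 / q decreases, so the left-hand side of
the equation for q is strictly increasing. *)
Lemma rate_solution_unique n nu : 0 <= nu -> is_subset1 [set q | is_rate_solution d n rho nu g q].
Proof.
move=> nu0; have A0 := rate_exponent_gt0 nu0; have [_ mono _] := Gg.
suff lt p q : is_rate_solution d n rho nu g p -> is_rate_solution d n rho nu g q -> ~ p < q.
  by move=> p q sp sq; have [/(lt _ _ sp sq)|/(lt _ _ sq sp)|] := ltgtP p q.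
move=> sp sq pq.
have [e [/andP[e_0 e1] p0 ge _ pn]] := rate_solution sp.
have [f [/andP[f_0 f1] q0 gf _ qn]] := rate_solution sq.
have gfe : g f < g e by rewrite -gf -ge !div1r ltf_pV2.
have fe : f < e.
  have [//|ef|e_f] := ltgtP f e; last by move: gfe; rewrite e_f ltxx.
  by have := mono _ _ e_0 ef f1; move: gfe; lra.
have : p `^ rate_exponent nu < q `^ rate_exponent nu.
  by apply: gt0_ltr_powR; rewrite ?nnegrE ?(ltW p0) ?(ltW q0).
rewrite pn qn ltNge => /negP; apply; apply: ler_wpM2l => //.
by rewrite lerXn2r ?nnegrE ?(ltW f_0) ?(ltW e_0) ?(ltW fe).
Qed.

(** A scale below which the monotonicity of r / g^-1 (r), read in terms of e as
that of g e / e, is available. *)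
Lemma regular_scale : exists2 e1, 0 < e1 < 1 & g e1 <= eps0 /\
  forall e e', 0 < e' -> e' < e -> e <= e1 -> g e' / e' <= g e / e.
Proof.
have [r0 r00 reg] := regular; have [in01 mono _] := Gg.
have [x0 /andP[x00 x01] gx] := power_near0 Gg ltr01 ltr01.
pose e1 := Num.min x0 (Num.min (eps0 / 2) (r0 / 2)).
have e1x : e1 <= x0 by rewrite /e1 ge_min lexx.
have e1e : e1 <= eps0 / 2 by rewrite /e1 !ge_min lexx !orbT.
have e1r : e1 <= r0 / 2 by rewrite /e1 !ge_min lexx !orbT.
have e10 : 0 < e1 by rewrite !lt_min x00 !divr_gt0.
have ge1 : g e1 <= e1 by have := gx e1 e10 e1x; rewrite mul1r powRr1// ltW.
have eps_0 := eps00.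
exists e1; first by rewrite e10; lra.
split; first by lra.
move=> e e' e'0 e'e ee1; have e0 : 0 < e by lra.
have img x : 0 < x -> x < 1 -> (g @` `]0, 1[) (g x) by exists x => //=; rewrite in_itv /=; apply/andP.
have e_1 : e < 1 by lra.
have e'_1 : e' < 1 by lra.
have e01 : 0 < e < 1 by apply/andP.
have e'01 : 0 < e' < 1 by apply/andP.
have := reg (g e') (g e) (img _ e'0 e'_1) (img _ e0 e_1) (ltW (mono _ _ e'0 e'e e_1)).
rewrite !inverse01K//; apply.
have : g e <= g e1 by have [->|ne] := eqVneq e e1; [exact: lexx|apply/ltW/mono => //; [rewrite lt_neqAle ne|lra]].
lra.
Qed.

(** The scales are r = g e = 1 / q and a multiple W of r^nu. *)
Lemma rate_bound : exists2 c, 0 < c & forall (n : nat) (nu q : R), (0 < n)%N -> 0 <= nu ->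
  is_rate_solution d n rho nu g q ->
  ((c * inverse01 g (1 / q) `^ (2 * d%:R * (1 + nu) / rate_exponent nu)
      * n%:R `^ (- ((4 + nu * rho) / rate_exponent nu)))%:E <= mm n)%E.
Proof.
have [e1 /andP[e10 e11] [ge1 reg]] := regular_scale; have [in01 mono _] := Gg.
have /andP[r10 r11] : 0 < g e1 < 1 by apply: in01; apply/andP.
set r1 := g e1 in ge1 r10 r11.
have Wr : 0 < Wm `^ rho by exact: powR_gt0.
exists (c0 * Wm `^ rho * (e1 ^+ 2 * r1 ^+ 4)).
  by apply: mulr_gt0; apply: mulr_gt0 => //; exact: exprn_gt0.
move=> n nu q n0 nu0 /rate_solution[e [/andP[e_0 e_1] q0 qr -> qA]].
have A0 := rate_exponent_gt0 nu0; set A := rate_exponent nu in A0 qA *.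
have /andP[r_0 r_1] : 0 < g e < 1 by apply: in01; apply/andP.
set r := g e in qr r_0 r_1; set N : R := n%:R.
have N0 : 0 < N by rewrite ltr0n.
have NA : N * e ^+ 2 * r `^ A = 1.
  by rewrite -qA -powRM ?(ltW q0) ?(ltW r_0)// -qr mulrCA mulfV ?gt_eqF// mulr1 powR1.
pose V := r `^ nu; have V0 : 0 < V by exact: powR_gt0.
have rA : r `^ A = r ^+ (4 + d) * V `^ (rho + d%:R).
  rewrite /V -powRrM -powR_mulrn ?(ltW r_0)// -gt0_powRD//; congr (_ `^ _).
  by rewrite natrD.
have target : e `^ (2 * d%:R * (1 + nu) / A) * N `^ (- ((4 + nu * rho) / A)) =
    e ^+ 2 * r ^+ 4 * V `^ rho.
  set s := (4 + nu * rho) / A.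
  have -> : N `^ (- s) = (e ^+ 2 * r `^ A) `^ s.
    have Ns : N `^ s != 0 by rewrite gt_eqF ?powR_gt0.
    rewrite powRN; apply: (mulfI Ns).
    rewrite mulfV// -powRM ?(ltW N0) ?mulr_ge0 ?exprn_ge0 ?powR_ge0 ?(ltW e_0)//.
    by rewrite mulrA NA powR1.
  rewrite powR_sqrM ?(ltW e_0)//.
  have -> : r `^ (A * s) = r ^+ 4 * V `^ rho.
    rewrite -powR_mulrn ?(ltW r_0)// /V -(powRrM r nu rho) -gt0_powRD//; congr (_ `^ _).
    by rewrite /s mulrC mulfVK// gt_eqF.
  rewrite [LHS]mulrA -[RHS]mulrA; congr (_ * _).
  rewrite -gt0_powRD// -powR_mulrn ?(ltW e_0)//; congr (_ `^ _).
  by rewrite /s /A; field; rewrite gt_eqF.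
rewrite -mulrA target.
have W0 : 0 < V * Wm by exact: mulr_gt0.
have WW : V * Wm <= Wm.
  by rewrite ler_piMl ?(ltW Wm0)//; apply: powR_le1 => //; rewrite r_0 ltW.
have budget : N * (e ^+ 2 * r ^+ (4 + d) * (V * Wm) `^ (rho + d%:R)) <= 1.
  rewrite powRM ?(ltW V0) ?(ltW Wm0)// [leLHS](_ : _ = (N * e ^+ 2 * r `^ A) * Wm `^ (rho + d%:R)).
    by rewrite NA mul1r; apply: powR_le1; rewrite ?Wm0 ?addr_ge0 ?(ltW rho0).
  by rewrite rA; ring.
(* above the scale e1 nothing is known about g, but there e and r are bounded
   below, so that the fixed pair e1, g e1 can take their place *)
have [ee1|e1e] := leP e e1.
  have re1 : r <= r1.
    by rewrite /r /r1; have [->|ne] := eqVneq e e1; [exact: lexx|apply/ltW/mono => //; rewrite lt_neqAle ne].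
  have := core W0 WW e_0 e_1 r_0 (le_trans re1 ge1) (fun e' e'0 e'e => reg e e' e'0 e'e ee1) budget.
  apply: le_trans; rewrite lee_fin powRM ?(ltW V0) ?(ltW Wm0)//.
  rewrite (_ : c0 * (e ^+ 2 * _ * _) = c0 * Wm `^ rho * 1 * (e ^+ 2 * r ^+ 4 * V `^ rho)); last by ring.
  apply: ler_wpM2r; first by rewrite !mulr_ge0 ?exprn_ge0 ?powR_ge0 ?(ltW r_0) ?(ltW e_0).
  apply: ler_wpM2l; first by rewrite mulr_ge0 ?(ltW c00) ?(ltW Wr).
  by rewrite mulr_ile1 ?exprn_ge0 ?exprn_ile1 ?(ltW e10) ?(ltW r10) ?(ltW e11) ?(ltW r11).
have r1r : r1 <= r by apply/ltW/mono.
have budget1 : N * (e1 ^+ 2 * r1 ^+ (4 + d) * (V * Wm) `^ (rho + d%:R)) <= 1.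
  apply: le_trans budget; apply: ler_wpM2l; first exact: ltW.
  apply: ler_wpM2r; first exact: powR_ge0.
  by apply: ler_pM; rewrite ?exprn_ge0 ?lerXn2r ?nnegrE ?(ltW e10) ?(ltW r10) ?(ltW e_0) ?(ltW r_0) ?(ltW e1e).
have := core W0 WW e10 e11 r10 ge1 (fun e' e'0 e'e => reg e1 e' e'0 e'e (lexx _)) budget1.
apply: le_trans; rewrite lee_fin powRM ?(ltW V0) ?(ltW Wm0)//.
rewrite [leLHS](_ : _ = c0 * Wm `^ rho * (e1 ^+ 2 * r1 ^+ 4) * V `^ rho * (e ^+ 2 * r ^+ 4)); last by ring.
rewrite [leRHS](_ : _ = c0 * Wm `^ rho * (e1 ^+ 2 * r1 ^+ 4) * V `^ rho * 1); last by ring.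
apply: ler_wpM2l.
  apply: mulr_ge0; last exact: powR_ge0.
  by apply: mulr_ge0; apply: mulr_ge0; rewrite ?exprn_ge0 ?(ltW c00) ?(ltW Wr) ?(ltW e10) ?(ltW r10).
by rewrite mulr_ile1 ?exprn_ge0 ?exprn_ile1 ?(ltW e_0) ?(ltW r_0) ?(ltW e_1) ?(ltW r_1).
Qed.

Let natr_powR_le1 n (a : R) : (0 < n)%N -> 0 < n%:R `^ (- a) /\ (0 <= a -> n%:R `^ (- a) <= 1 :> R).
Proof.
move=> n0; have N0 : 0 < n%:R :> R by rewrite ltr0n.
split; first exact: powR_gt0.
move=> a0; rewrite -[leRHS](powRr0 (n%:R : R)).
by apply: ler_powR; [rewrite ler1n|rewrite oppr_le0].
Qed.

(** Only W depends on n: the risk comes from spreading the tail. *)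
Lemma tail_rate : exists2 c, 0 < c & forall n : nat, (0 < n)%N ->
  ((c * n%:R `^ (- (rho / (rho + d%:R))))%:E <= mm n)%E.
Proof.
have [e1 /andP[e10 e11] [ge1 reg]] := regular_scale; have [in01 mono _] := Gg.
have /andP[r10 r11] : 0 < g e1 < 1 by apply: in01; apply/andP.
set r1 := g e1 in ge1 r10 r11.
have rd : 0 < rho + d%:R by rewrite ltr_pwDl.
exists (c0 * (e1 ^+ 2 * r1 ^+ 4 * Wm `^ rho)).
  by apply: mulr_gt0 => //; apply: mulr_gt0; [apply: mulr_gt0; exact: exprn_gt0|exact: powR_gt0].
move=> n n0; have N0 : 0 < n%:R :> R by rewrite ltr0n.
pose v := n%:R `^ (- (rho + d%:R)^-1) : R.
have [v0 /(_ (ltW _)) v1] := natr_powR_le1 (rho + d%:R)^-1 n0; rewrite -/v in v0 v1.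
have {}v1 : v <= 1 by apply: v1; rewrite invr_gt0.
have vrd : v `^ (rho + d%:R) = n%:R^-1.
  by rewrite /v -powRrM mulNr mulVf ?gt_eqF// powR_inv1// ltW.
have := @core (Wm * v) e1 r1 n (mulr_gt0 Wm0 v0).
rewrite ler_piMr ?(ltW Wm0)// => /(_ isT e10 e11 r10 ge1 (fun e' e'0 e'e => reg e1 e' e'0 e'e (lexx _))).
rewrite !powRM ?(ltW Wm0) ?(ltW v0)// vrd.
rewrite (_ : n%:R * _ = e1 ^+ 2 * r1 ^+ (4 + d) * Wm `^ (rho + d%:R)); last first.
  by field; rewrite gt_eqF.
have -> : v `^ rho = n%:R `^ (- (rho / (rho + d%:R))).
  by rewrite /v -powRrM mulNr mulrC.
set x := n%:R `^ _ => h.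
rewrite (_ : _ * x = c0 * (e1 ^+ 2 * r1 ^+ 4 * (Wm `^ rho * x))); last by ring.
apply: h.
apply: mulr_ile1; [|exact: powR_ge0| |].
- by apply: mulr_ge0; apply: exprn_ge0; exact: ltW.
- by rewrite mulr_ile1 ?exprn_ge0 ?exprn_ile1 ?(ltW e10) ?(ltW r10) ?(ltW e11) ?(ltW r11).
- by apply: powR_le1; [apply/andP|exact: ltW].
Qed.

(** Only e and r depend on n: the risk comes from small perturbations. As e
decreases like n^(-eps / 2), the loss of a factor e^2 is n^(-eps). *)
Lemma smooth_rate (eps : R) : 0 < eps -> exists2 c, 0 < c & forall n : nat, (0 < n)%N ->
  ((c * n%:R `^ (- (4 / (4 + d%:R) + eps)))%:E <= mm n)%E.
Proof.
move=> eps_0; pose tau := eps / 2; have tau0 : 0 < tau by rewrite divr_gt0.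
pose D : R := 4 + d%:R; have D0 : 0 < D by rewrite ltr_wpDr.
(* with this M the bound eps0 * e^M on g e is below r, as n^(- tau M) is at
   most n^(-1 / D) *)
pose M := 1 + (tau * D)^-1; have M1 : 1 <= M by rewrite lerDl invr_ge0 mulr_ge0// ltW.
have M0 : 0 < M by exact: lt_le_trans M1.
have [e1 /andP[e10 e11] gx] := power_near0 Gg M0 eps00.
exists (c0 * (e1 ^+ 2 * eps0 ^+ 4 * Wm `^ rho)).
  by apply: mulr_gt0 => //; apply: mulr_gt0; [apply: mulr_gt0; exact: exprn_gt0|exact: powR_gt0].
move=> n n0; have N0 : 0 < n%:R :> R by rewrite ltr0n.
pose u := n%:R `^ (- tau) : R; pose v := n%:R `^ (- D^-1) : R.
have [u0 /(_ (ltW tau0))] := natr_powR_le1 tau n0; rewrite -/u in u0 * => u1.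
have [v0 v1'] := natr_powR_le1 D^-1 n0; rewrite -/v in v0 v1'.
have v1 : v <= 1 by apply: v1'; rewrite invr_ge0 ltW.
have ue : e1 * u <= e1 by rewrite ler_piMr// ltW.
have eu0 : 0 < e1 * u by exact: mulr_gt0.
have eu1 : e1 * u < 1 by exact: le_lt_trans e11.
have vr : eps0 * v <= eps0 by rewrite ler_piMr// ltW.
have euM : (e1 * u) `^ M <= v.
  rewrite powRM ?(ltW e10) ?(ltW u0)//.
  have eM : e1 `^ M <= 1 by apply: powR_le1; rewrite ?e10 ltW.
  have uM : u `^ M <= v.
    rewrite /u /v -powRrM; apply: ler_powR; first by rewrite ler1n.
    rewrite mulNr lerN2 /M mulrDr mulr1 invfM mulrA mulfV ?gt_eqF// mul1r lerDr ltW//.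
  apply: le_trans uM; rewrite ler_piMl// powR_ge0//.
have gr e' : 0 < e' -> e' < e1 * u -> g e' / e' <= (eps0 * v) / (e1 * u).
  move=> e'0 e'e; rewrite ler_pdivlMr// mulrAC ler_pdivrMr//.
  have ge' := gx e' e'0 ltac:(lra).
  apply: (@le_trans _ _ (eps0 * e' `^ M * (e1 * u))); first by rewrite ler_pM2r.
  have pM x : 0 < x -> x `^ M = x * x `^ (M - 1).
    by move=> x0; rewrite mulr_powRB1// ltW.
  have mon : e' `^ (M - 1) <= (e1 * u) `^ (M - 1).
    by apply: ge0_ler_powR; rewrite ?nnegrE ?subr_ge0 ?(ltW e'0) ?(ltW eu0) ?(ltW e'e).
  have small : e' `^ (M - 1) * (e1 * u) <= v.
    by apply: le_trans euM; rewrite (pM _ eu0) mulrC ler_pM2l.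
  rewrite pM// (_ : _ * (e1 * u) = eps0 * (e' `^ (M - 1) * (e1 * u)) * e'); last by ring.
  by rewrite ler_pM2r// ler_pM2l.
have vD : v ^+ (4 + d) = n%:R^-1.
  rewrite -powR_mulrn ?(ltW v0)// /v -powRrM natrD -/D mulNr mulVf ?gt_eqF// powR_inv1// ltW//.
have := @core Wm (e1 * u) (eps0 * v) n Wm0 (lexx _) eu0 eu1 (mulr_gt0 eps00 v0) vr gr.
have -> : n%:R * ((e1 * u) ^+ 2 * (eps0 * v) ^+ (4 + d) * Wm `^ (rho + d%:R)) =
    (e1 * u) ^+ 2 * (eps0 ^+ (4 + d) * Wm `^ (rho + d%:R)).
  by rewrite [(eps0 * v) ^+ _]exprMn vD; field; rewrite gt_eqF.
have rd : 0 < rho + d%:R by rewrite ltr_pwDl.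
have le1 : (e1 * u) ^+ 2 * (eps0 ^+ (4 + d) * Wm `^ (rho + d%:R)) <= 1.
  apply: mulr_ile1; rewrite ?exprn_ge0 ?exprn_ile1 ?(ltW eu0) ?(ltW eu1)//.
    by rewrite mulr_ge0 ?exprn_ge0 ?powR_ge0 ?(ltW eps00).
  apply: mulr_ile1; rewrite ?exprn_ge0 ?exprn_ile1 ?powR_ge0 ?(ltW eps00)//.
  by apply: powR_le1; rewrite ?Wm0 // ltW.
move=> /(_ le1).
have -> : n%:R `^ (- (4 / (4 + d%:R) + eps)) = v ^+ 4 * u ^+ 2.
  rewrite -!powR_mulrn ?(ltW v0) ?(ltW u0)// /v /u -!powRrM -gt0_powRD//; congr (_ `^ _).
  by rewrite /tau /D; field; rewrite gt_eqF.
rewrite (_ : c0 * ((e1 * u) ^+ 2 * _ * _) = c0 * (e1 ^+ 2 * eps0 ^+ 4 * Wm `^ rho) * (v ^+ 4 * u ^+ 2))//.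
by ring.
Qed.

Lemma combined_rate (eps : R) : 0 < eps -> exists2 c, 0 < c & forall n : nat, (0 < n)%N ->
  ((c * n%:R `^ (- (Num.min (4 / (4 + d%:R)) (rho / (rho + d%:R)) + eps)))%:E <= mm n)%E.
Proof.
move=> eps_0; have [_|_] := leP (4 / (4 + d%:R)) (rho / (rho + d%:R)); first exact: smooth_rate.
have [c c_0 hc] := tail_rate; exists c => // n n0; apply: le_trans (hc n n0).
rewrite lee_fin ler_pM2l// ler_powR ?ler1n//; lra.
Qed.

End rates.
(** * The minimax lower bounds *)

Theorem theorem4 (R : realType) (d : nat) (hd : (0 < d)%N) :
  exists lambda_s eps_s M_s : R, [/\ 0 < lambda_s, 0 < eps_s, 0 < M_s &
  forall (rho : R) (g : R -> R) (gamma : R),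
    0 < rho -> class_G g ->
    (exists2 r0 : R, 0 < r0 & forall r s : R,
       (g @` `]0, 1[) r -> (g @` `]0, 1[) s -> r <= s -> s < r0 ->
       r / inverse01 g r <= s / inverse01 g s) ->
    0 < gamma <= 2 ->
  forall (lambda M0 eps0 : R) (ell : R -> R),
    lambda_s <= lambda -> M_s <= M0 ->
    0 < eps0 <= Num.min eps_s (1 / (4 * M0)) ->
    class_L ell -> (forall delta, 0 < delta -> 2 / eps0 <= ell delta) ->
  let theta := Param eps0 M0 rho ell g in
  Theta theta ->
  let mm n := minimax_excess_risk n
                (@class_P R d theta `&` @class_Q R d gamma lambda) in
  [/\ (forall (n : nat) (nu : R), (0 < n)%N -> 0 <= nu ->
         is_subset1 [set q | is_rate_solution d n rho nu g q]),
      (exists2 c : R, 0 < c &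
         forall (n : nat) (nu q : R), (0 < n)%N -> 0 <= nu ->
           is_rate_solution d n rho nu g q ->
           ((c * inverse01 g (1 / q) `^
                   (2 * d%:R * (1 + nu) / (4 + d%:R + nu * (rho + d%:R)))
               * n%:R `^ (- ((4 + nu * rho) / (4 + d%:R + nu * (rho + d%:R)))))%:E
              <= mm n)%E)
    & (forall eps : R, 0 < eps ->
         exists2 c : R, 0 < c &
         forall n : nat, (0 < n)%N ->
           ((c * n%:R `^ (- (Num.min (4 / (4 + d%:R)) (rho / (rho + d%:R)) + eps)))%:E
              <= mm n)%E)]].
Proof.
have d1 : 1 <= d%:R :> R by rewrite ler1n.
have lambda0 : 0 < lambda_star R d.
  have Z0 : 0 < (bulk_mass R d)^-1 by rewrite invr_gt0; exact: bulk_mass_gt0.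
  have h : 0 < 3584 * (bulk_mass R d)^-1 by apply: mulr_gt0 Z0; rewrite ltr0n.
  rewrite /lambda_star; move: h; set h := 3584 * _ => h0.
  by apply: mulr_gt0; lra.
exists (lambda_star R d), (eps_star R d), (2 * d%:R).
split=> //; [exact: eps_star_gt0|lra|].
move=> rho g gamma rho0 Gg regular gamma02 lambda M0 eps0 ell lambda_ge M0_ge.
rewrite le_min => /andP[eps00 /andP[eps_le epsM]] Lell ell_ge theta _ mm.
have eps0M : eps0 * M0 <= 1 / 4.
  have M0p : 0 < 4 * M0 by lra.
  by move: epsM; rewrite ler_pdivlMr//; lra.
have eps01 : eps0 <= 1 by have := eps0_32 eps_le; lra.
have /andP[Wm0 Wm1] := width_max_bounds hd rho.
have core W e r n : 0 < W -> W <= width_max d rho -> 0 < e -> e < 1 ->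
    0 < r -> r <= eps0 -> (forall e', 0 < e' -> e' < e -> g e' / e' <= r / e) ->
    n%:R * (e ^+ 2 * r ^+ (4 + d) * W `^ (rho + d%:R)) <= 1 ->
    ((core_const d rho * (e ^+ 2 * r ^+ 4 * W `^ rho))%:E <= mm n)%E.
  by move=> *; apply: design_excess.
have c00 := core_const_gt0 hd rho.
split.
- by move=> n nu _; exact: rate_solution_unique.
- have [c c0 h] := rate_bound rho0 eps00 Gg c00 Wm0 Wm1 regular core.
  by exists c.
- by move=> eps; exact: (combined_rate rho0 eps00 eps01 Gg c00 Wm0 Wm1 regular core).
Qed.
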